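(* Let $1<p<\infty$ and let $(X,\mathsf d,\mu)$ be a complete and separable metric measure space, with $\mu$ a locally finite Borel measure, that is a $(1,p)$-PI space (that is, $\mu$ is doubling and $X$ supports a weak local $(1,p)$-Poincaré inequality). Let $C\ge 1$ and let $\Omega\subset X$ be a $C$-GHS domain. Then $N^{1,\infty}(\Omega)$ is dense in $N^{1,p}(\Omega)$ with respect to the norm of $N^{1,p}(\Omega)$.
   Context: **Doubling.** $\mu$ is doubling if there is a constant $C_\mu>0$ with $\mu(2B)\le C_\mu\,\mu(B)$ for every ball $B\subset X$ ($\mu$ is nonzero). **$(q,p)$-PI space.** $\mu$ is doubling and there are constants $c_*>0$, $\sigma>0$ such that for every $u\in L^1_{\rm loc}(X)$, every upper gradient $g$ of $u$ and every ball $B$, $$\Big(\frac1{\mu(B)}\int_B|u-u_B|^q\,d\mu\Big)^{1/q}\le c_*\operatorname{diam}(B)\Big(\frac1{\mu(5\sigma B)}\int_{5\sigma B}g^p\,d\mu\Big)^{1/p},$$ where $u_B=\frac1{\mu(B)}\int_B u\,d\mu$. **Modulus.** For a family $\Gamma$ of curves and $1\le p<\infty$, $\mathrm{Mod}_p(\Gamma)=\inf\|\rho\|_{L^p}^p$, and $\mathrm{Mod}_\infty(\Gamma)=\inf\|\rho\|_{L^\infty}$, the infimum being over nonnegative Borel functions $\rho$ with $\int_\gamma\rho\,ds\ge1$ for every rectifiable $\gamma\in\Gamma$. **Newtonian Sobolev space.** Let $1<p\le\infty$ and let $\Omega\subset X$ be open. A function $g$ is an upper gradient of $u$ if $|u(\gamma(a))-u(\gamma(b))|\le\int_\gamma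 g\,ds$ for every rectifiable curve $\gamma:[a,b]\to\Omega$; it is a $p$-weak upper gradient if this holds for all rectifiable curves outside a family of zero $\mathrm{Mod}_p$. $N^{1,p}(\Omega)$ consists of the functions $u\in L^p(\Omega)$ that have a $p$-weak upper gradient $g\in L^p(\Omega)$, with norm $\|u\|_{N^{1,p}(\Omega)}=\|u\|_{L^p(\Omega)}+\inf_g\|g\|_{L^p(\Omega)}$, the infimum being over ($p$-weak) upper gradients $g$ of $u$. **Internal metric.** $\mathsf d_\Omega(x,y)=\inf\ell(\gamma)$ over curves $\gamma\subset\Omega$ joining $x$ and $y$; $B_\Omega(x,r)$ denotes a ball for $\mathsf d_\Omega$, and $\operatorname{dist}_\Omega$ denotes distance with respect to $\mathsf d_\Omega$. **Quasihyperbolic metric.** For a domain (open connected set) $\Omega\subsetneq X$, $\operatorname{dist}_{qh}(x,y)=\inf_\gamma\int_\gamma\operatorname{dist}(z,\partial\Omega)^{-1}\,ds(z)$ over rectifiable curves $\gamma\subset\Omega$ joining $x,y$. A curve attaining the infimum is a quasihyperbolic geodesic. Here $\operatorname{dist}(\cdot,\partial\Omega)$ is taken with respect to $\mathsf d$. **$C$-GHS domain (or space).** A bounded domain $\Omega\subsetneq X$ such that: (i) ($C$-ball-separation) for all $x,y\in\Omega$, every quasihyperbolic geodesic $\Gamma$ joining $x$ and $y$, and every $z\in\Gamma$, the internal ball $B_\Omega(z,C\operatorname{dist}(z,\partial\Omega))$ meets every curve $\gamma\subset\Omega$ joining $x$ and $y$; (ii) ($C$-Gehring–Hayman) for all $x,y\in\Omega$,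 every quasihyperbolic geodesic joining $x$ and $y$ has metric length at most $C\operatorname{dist}_\Omega(x,y)$; (iii) $(\Omega,\mathsf d_\Omega)$ is a locally compact length space. *)

(* Defs.v *)
From HB Require Import structures.
From mathcomp Require Import all_boot all_order all_algebra.
From mathcomp Require Import all_classical all_reals all_analysis.
From mathcomp Require Import measurable_realfun.

Set Implicit Arguments.
Unset Strict Implicit.
Unset Printing Implicit Defensive.

Import Order.TTheory GRing.Theory Num.Theory.
Import numFieldNormedType.Exports.

Local Open Scope classical_set_scope.
Local Open Scope ring_scope.
Local Open Scope ereal_scope.

#[short(type="completeMetricType")]
HB.structure Definition CompleteMetric (R : numDomainType) :=
  {T of Complete T & Metric R T}.

Section curves.
Context {R : realType} {X : metricType R}.

(* A curve is a continuous map [a, b] -> X; the values of cfun outside [a, b]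
   are irrelevant.  The degenerate case a = b is allowed. *)
Record curve := Curve {
  cstart : R;
  cend : R;
  cfun :> R -> X;
  cstart_le_end : (cstart <= cend)%R;
  cfun_continuous : {within `[cstart, cend], continuous cfun} }.

Implicit Types (c : curve) (D : set X).

Definition trace c : set X := c @` `[cstart c, cend c].

Definition joins c (x y : X) := c (cstart c) = x /\ c (cend c) = y.

Definition length_on (f : R -> X) (a b : R) : \bar R :=
  ereal_sup [set (\sum_(0 <= i < size s)
      mdist (f (nth b (a :: s) i)) (f (nth b (a :: s) i.+1)))%R%:E
    | s in itv_partition a b].

Definition clength c := length_on c (cstart c) (cend c).

Definition rectifiable c := clength c < +oo.

(* The arc-length parametrization: c is constant on each fibre of the length
   function, so any point of the fibre over t gives the same value. *)
Definition arclength_param c (t : R) : X :=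
  c (inf [set s | s \in `[cstart c, cend c] /\
                  length_on c (cstart c) s = t%:E]).

(* Only meaningful for rectifiable c. *)
Definition line_integral c (g : X -> \bar R) : \bar R :=
  \int[lebesgue_measure]_(t in `[0%R, fine (clength c)])
    g (arclength_param c t).

Definition internal_dist D (x y : X) : \bar R :=
  ereal_inf [set clength c | c in [set c | trace c `<=` D /\ joins c x y]].

Definition internal_ball D (x : X) (r : \bar R) : set X :=
  [set y | D y /\ internal_dist D x y < r].

Definition boundary D : set X := closure D `\` interior D.

Definition qh_length D c : \bar R :=
  line_integral c (fun z => (edist_inf (boundary D) z)^-1).

Definition qh_dist D (x y : X) : \bar R :=
  ereal_inf [set qh_length D c
    | c in [set c | [/\ rectifiable c, trace c `<=` D & joins c x y]]].

Definition qh_geodesic D (x y : X) c :=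
  [/\ rectifiable c, trace c `<=` D, joins c x y &
      qh_length D c = qh_dist D x y].

Definition diam (A : set X) : \bar R :=
  ereal_sup [set d | exists x y, [/\ A x, A y & d = (mdist x y)%:E]].

End curves.
Arguments curve {R} X.

Definition length_space (R : realType) (M : metricType R) :=
  forall x y : M, (mdist x y)%:E = internal_dist [set: M] x y.

Section GHS.
Context {R : realType} {X : metricType R}.
Implicit Types (C : R) (D : set X).

Definition ball_separation C D :=
  forall (x y : X) (G : curve X), D x -> D y -> qh_geodesic D x y G ->
  forall z, trace G z ->
  forall c : curve X, trace c `<=` D -> joins c x y ->
    internal_ball D z (C%:E * edist_inf (boundary D) z) `&` trace c !=set0.

Definition gehring_hayman C D :=
  forall (x y : X) (G : curve X), D x -> D y -> qh_geodesic D x y G ->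
    clength G <= C%:E * internal_dist D x y.

(* (D, internal_dist D) is presented as a metric space M whose points are
   identified with those of D by the bijection f; in particular the internal
   distance is finite, and compactness and length in M refer to it. *)
Definition internal_locally_compact_length_space D :=
  exists (M : metricType R) (f : M -> X),
    [/\ set_bij [set: M] D f,
        forall a b, internal_dist D (f a) (f b) = (mdist a b)%:E,
        locally_compact [set: M] & length_space M].

Record GHS_domain C D : Prop := {
  GHS_open : open D;
  GHS_connected : connected D;
  GHS_proper : D <> [set: X];
  GHS_bounded : exists k : R, forall x y, D x -> D y -> (mdist x y <= k)%R;
  GHS_ball_separation : ball_separation C D;
  GHS_gehring_hayman : gehring_hayman C D;
  GHS_length_space : internal_locally_compact_length_space D }.

End GHS.

Definition separable (T : topologicalType) :=
  exists2 A : set T, countable A & dense A.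

Notation borel X := (g_sigma_algebraType (@open X)).

Section metric_measure_space.
Context {R : realType} {X : completeMetricType R}.
Variable mu : {measure set (borel X) -> \bar R}.
Implicit Types (D : set X) (p q : \bar R) (u : X -> R) (g rho : X -> \bar R).

Definition locally_finite :=
  forall x : X, exists2 r : R, (0 < r)%R & mu (ball x r) < +oo.

Definition doubling :=
  mu [set: X] <> 0 /\
  exists2 C : R, (0 < C)%R & forall (x : X) (r : R), (0 < r)%R ->
    mu (ball x (2 * r)%R) <= C%:E * mu (ball x r).

(* Measurability with respect to the mu-completion of the Borel sets.  The
   library integral of a nonnegative function is a supremum over simple
   functions below it and ess_sup is defined by null sets, so Lnorm has the
   expected value on such functions. *)
Definition ae_measurable D u :=
  exists2 v : borel X -> R, measurable_fun [set: borel X] v &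
    {ae mu, forall x, D x -> u x = v x}.

Definition Lnorm_on D p (f : X -> \bar R) : \bar R :=
  'N[mu]_p[(f \_ D : borel X -> \bar R)].

Definition Lp D p : set (X -> R) :=
  [set u | ae_measurable D u /\ Lnorm_on D p (EFin \o u) < +oo].

Definition L1loc : set (X -> R) :=
  [set u | forall x, exists2 r : R, (0 < r)%R & Lp (ball x r) 1 u].

Definition nonneg_borel D g :=
  measurable_fun (D : set (borel X)) g /\ forall x, D x -> 0 <= g x.

Definition upper_gradient_along u g (c : curve X) :=
  `|u (c (cstart c)) - u (c (cend c))|%:E <= line_integral c g.

Definition upper_gradient D u g :=
  nonneg_borel D g /\
  forall c : curve X, rectifiable c -> trace c `<=` D ->
    upper_gradient_along u g c.

Definition admissible (Gamma : set (curve X)) rho :=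
  nonneg_borel [set: X] rho /\
  forall c, Gamma c -> rectifiable c -> 1 <= line_integral c rho.

Definition Mod p (Gamma : set (curve X)) : \bar R :=
  if p is r%:E then
    ereal_inf [set Lnorm_on [set: X] p rho `^ r | rho in admissible Gamma]
  else
    ereal_inf [set Lnorm_on [set: X] p rho | rho in admissible Gamma].

Definition weak_upper_gradient D p u g :=
  nonneg_borel D g /\
  exists2 Gamma : set (curve X), Mod p Gamma = 0 &
    forall c, rectifiable c -> trace c `<=` D -> ~ Gamma c ->
      upper_gradient_along u g c.

(* The Newtonian space; values of the functions outside D are irrelevant. *)
Definition N1 D p : set (X -> R) :=
  [set u | Lp D p u /\
           exists2 g, weak_upper_gradient D p u g & Lnorm_on D p g < +oo].

Definition N1norm D p u : \bar R :=
  Lnorm_on D p (EFin \o u) +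
  ereal_inf [set Lnorm_on D p g | g in weak_upper_gradient D p u].

Definition mean (B : set X) (f : X -> \bar R) : \bar R :=
  (mu B)^-1 * \int[mu]_(x in (B : set (borel X))) f x.

Definition poincare (q p : R) :=
  exists c sigma : R, [/\ (0 < c)%R, (0 < sigma)%R &
    forall u g, L1loc u -> upper_gradient [set: X] u g ->
    forall (x : X) (r : R), (0 < r)%R ->
      let B := ball x r in
      let uB := fine (mean B (EFin \o u)) in
      mean B (fun y => (`|u y - uB| `^ q)%:E) `^ q^-1 <=
      c%:E * diam B * mean (ball x (5 * sigma * r)%R) (fun y => g y `^ p) `^ p^-1].

Definition PI_space (q p : R) := doubling /\ poincare q p.

End metric_measure_space.

(* Main.v *)
(* Let g be a p-integrable upper gradient of u. Call a point of Omega good if it lies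
   in a fixed compact core of Omega, the maximal function of g^p there is at most
   Lam^p, |u| <= Lam, and the averages of u on small balls converge to u. For good
   y, y' and any curve h in Omega joining them, |u y - u y'| is at most the integral
   along h of rho = K (Lam + W), where W is a maximal function of g over Whitney
   balls: nearby points are compared by telescoping averages, distant ones by
   chaining Whitney balls along a quasihyperbolic geodesic. Ball separation makes h
   pass close to every ball of the chain, and the Gehring-Hayman inequality bounds
   the overlap of the portions of h used by different balls.

   Hence v x = min (Lam, inf (u y + integral of rho along h)), the infimum being over
   good y and curves h from y to x, is bounded, has the bounded upper gradient rho and
   agrees with u at good points. Since u - v vanishes there, (g + rho) times the
   indicator of a Borel set G containing the bad points is a p-weak upper gradient of
   u - v. The weak type estimate for the maximal function gives Lam^p mu(G) -> 0, and
   W is dominated by a p-integrable function not depending on the core, so the norm of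
   u - v tends to 0. *)
Require Import Defs.
From mathcomp Require Import all_boot all_order all_algebra.
From mathcomp Require Import all_classical all_reals all_analysis.
From mathcomp Require Import measurable_realfun.
From mathcomp Require Import lra ring.

Set Implicit Arguments.
Unset Strict Implicit.
Unset Printing Implicit Defensive.

Import Order.TTheory GRing.Theory Num.Theory.
Import numFieldNormedType.Exports.

Local Open Scope classical_set_scope.
Local Open Scope ring_scope.

(** * Length and arc-length parametrization *)

Section length.
Context {R : realType} {X : metricType R}.
Implicit Types (f : R -> X) (a b c : R) (s : seq R).

(** Ball separation and the Gehring-Hayman inequality speak only about quasihyperbolic geodesics, so
    existence of these comes first. The internal space is locally compact but need not be complete:
    minimizing curves are kept away from the boundary because the distance to it decays at most
    exponentially in quasihyperbolic length, and completeness of X then supplies the limits. The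
    core consists of points reached by paths that stay deep in Omega. Two good points are thus
    joined by a deep curve, and ball separation against that curve forces the geodesic between them
    to have depth at least eta / (1 + C). Hence W needs only Whitney balls of that depth, which
    makes rho bounded, while its p-integrable majorant ignores the depth. For Lam^p mu(G) to become
    small, and not merely bounded, the weak type estimate keeps the integral of g^p over a
    superlevel set only. The Poincare inequality is global; it is localized by giving the gradient
    the value +oo outside a ball, and applied to an indicator function it shows that balls of radius
    comparable to the boundary distance stay in Omega. *)

Fixpoint polygonal f a s : R :=
  if s is x :: s' then mdist (f a) (f x) + polygonal f x s' else 0.

Lemma polygonalE f a b s :
  \sum_(0 <= i < size s)
    mdist (f (nth b (a :: s) i)) (f (nth b (a :: s) i.+1)) = polygonal f a s.
Proof.
elim: s a => [|x s IH] a; first by rewrite big_nil.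
by rewrite /= big_nat_recl //= -IH.
Qed.

Lemma length_onE f a b :
  length_on f a b = ereal_sup [set (polygonal f a s)%:E | s in itv_partition a b].
Proof.
by rewrite /length_on; congr ereal_sup; apply: eq_imagel => s _; rewrite polygonalE.
Qed.

Lemma polygonal_ge0 f a s : 0 <= polygonal f a s.
Proof. by elim: s a => //= x s IH a; rewrite addr_ge0 ?mdist_ge0. Qed.

Lemma polygonal_cat f a s t :
  polygonal f a (s ++ t) = polygonal f a s + polygonal f (last a s) t.
Proof. by elim: s a => [|x s IH] a /=; rewrite ?add0r // IH addrA. Qed.

Lemma polygonal_le f a b s : itv_partition a b s ->
  ((polygonal f a s)%:E <= length_on f a b)%E.
Proof. by move=> h; rewrite length_onE; apply: ereal_sup_ubound; exists s. Qed.

Lemma length_on_le f a b (y : \bar R) :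
  (forall s, itv_partition a b s -> ((polygonal f a s)%:E <= y)%E) ->
  (length_on f a b <= y)%E.
Proof.
by move=> h; rewrite length_onE; apply: ge_ereal_sup => _ [s hs <-]; exact: h.
Qed.

Lemma length_onxx f a : length_on f a a = 0%E.
Proof.
apply/eqP; rewrite eq_le; apply/andP; split.
  by apply: length_on_le => s /itv_partitionxx ->.
have h : itv_partition a a [::] by split => //=.
exact: polygonal_le f _ _ _ h.
Qed.

Lemma mdist_le_length_on f a b : a <= b ->
  ((mdist (f a) (f b))%:E <= length_on f a b)%E.
Proof.
rewrite le_eqVlt => /predU1P[->|ab]; first by rewrite mdistxx length_onxx.
by have /(polygonal_le f) := itv_partition1 ab; rewrite /= addr0.
Qed.

Lemma length_on_ge0 f a b : a <= b -> (0 <= length_on f a b)%E.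
Proof. by move/(mdist_le_length_on f); apply: le_trans; rewrite lee_fin mdist_ge0. Qed.

Lemma length_on_superadd f a c b : a <= c -> c <= b ->
  (length_on f a c + length_on f c b <= length_on f a b)%E.
Proof.
move=> ac cb.
have h s t : itv_partition a c s -> itv_partition c b t ->
    ((polygonal f a s)%:E + (polygonal f c t)%:E <= length_on f a b)%E.
  move=> hs ht; have := itv_partition_cat hs ht => /(polygonal_le f).
  by rewrite polygonal_cat; case: hs => _ /eqP ->.
(* Outside the infinite case the two suprema are taken one after the other, each by subtracting a
   finite term. *)
have [->|fin] := eqVneq (length_on f a b) +oo%E; first by rewrite leey.
have h2 s : itv_partition a c s ->
    ((polygonal f a s)%:E + length_on f c b <= length_on f a b)%E.
  move=> hs; rewrite -leeBrDl//; apply: length_on_le => t ht.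
  by rewrite leeBrDl//; exact: h.
have cbfin : length_on f c b \is a fin_num.
  have [s hs] : exists s, itv_partition a c s.
    move: ac; rewrite le_eqVlt => /predU1P[->|ac]; first by exists [::]; split => //=.
    by exists [:: c]; exact: itv_partition1.
  rewrite ge0_fin_numE ?length_on_ge0//; apply: le_lt_trans (_ : length_on f a b < _)%E.
    by apply: le_trans (h2 _ hs); rewrite leeDr// lee_fin polygonal_ge0.
  by rewrite ltey.
rewrite -leeBrDr//; apply: length_on_le => s hs.
by rewrite leeBrDr//; exact: h2.
Qed.

Lemma mdist_add_length_on f a x b : a < x -> x <= b ->
  ((mdist (f a) (f x))%:E + length_on f x b <= length_on f a b)%E.
Proof.
move=> ax xb; apply: le_trans (length_on_superadd f (ltW ax) xb).
by apply: leeD => //; exact/mdist_le_length_on/ltW.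
Qed.

(** Inserting [c] as a vertex can only lengthen the polygon, and the refined polygon splits at
    [c]. *)
Lemma polygonal_split f a c b s : a <= c -> c <= b -> itv_partition a b s ->
  ((polygonal f a s)%:E <= length_on f a c + length_on f c b)%E.
Proof.
elim: s a => [|x s IH] a ac cb hs.
  by rewrite adde_ge0// length_on_ge0.
have hs' := itv_partition_cons hs.
have ax : a < x by case: hs => /= /andP[].
have [xc|cx] := leP x c.
  rewrite /= EFinD; apply: (@le_trans _ _
    ((mdist (f a) (f x))%:E + (length_on f x c + length_on f c b))%E).
    by rewrite leeD2l//; exact: IH.
  by rewrite addeA leeD2r// mdist_add_length_on.
have hc : itv_partition c b (x :: s).
  by case: hs => /= /andP[_ p] l; split => //=; rewrite cx.
apply: (@le_trans _ _ ((mdist (f a) (f c))%:E + (polygonal f c (x :: s))%:E)%E).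
  by rewrite -EFinD lee_fin /= addrA lerD2r metric_triangle.
by apply: leeD; [exact: mdist_le_length_on|exact: polygonal_le].
Qed.

Lemma length_onD f a c b : a <= c -> c <= b ->
  length_on f a b = (length_on f a c + length_on f c b)%E.
Proof.
move=> ac cb; apply/eqP; rewrite eq_le length_on_superadd// andbT.
by apply: length_on_le => s; exact: polygonal_split.
Qed.

Lemma length_on_lip f a b : a <= b ->
  (forall s t : R, a <= s -> s <= t -> t <= b -> mdist (f s) (f t) <= t - s) ->
  (length_on f a b <= (b - a)%:E)%E.
Proof.
move=> ab h; apply: length_on_le => s; rewrite lee_fin.
elim: s a h {ab} => [|x s IH] a h hs.
  by rewrite /= subr_ge0; exact: itv_partition_le hs.
have ax : a < x by case: hs => /= /andP[].
have xb := itv_partition_le (itv_partition_cons hs).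
have -> : b - a = (x - a) + (b - x) by ring.
apply: lerD; first by apply: h => //; exact: ltW.
apply: IH (itv_partition_cons hs) => u v xu uv vb.
by apply: h => //; rewrite (le_trans _ xu)// ltW.
Qed.

End length.

Section arclength.
Context {R : realType} {X : metricType R}.
Implicit Types (c : curve X).

Lemma curve_near c (s e : R) : cstart c <= s <= cend c -> 0 < e ->
  exists2 d, 0 < d & forall q, cstart c <= q <= cend c -> `|s - q| < d ->
    mdist (c s) (c q) < e.
Proof.
move=> hs e0; have /subspace_continuousP/(_ s) := @cfun_continuous _ _ c.
rewrite /= in_itv/= hs => /(_ isT) /metricType_numDomainType.cvgrPdist_lt/(_ _ e0).
rewrite near_withinE => /nbhs_ballP[d/= d0 hd]; exists d => // q hq hsq.
by apply: hd; rewrite //= in_itv.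
Qed.

(** Take a polygon whose length is within [e / 2] of the length from [s] on, and insert a point [q]
    so near [s] that [c q] is within [e / 2] of [c s]. The part beyond [q] then carries all but [e]
    of the length, so at most [e] is left before [q]. The left version is symmetric. *)
Lemma length_small_right c (s e : R) : rectifiable c ->
  cstart c <= s < cend c -> 0 < e ->
  exists2 q, s < q <= cend c & (length_on c s q <= e%:E)%E.
Proof.
move=> rc /andP[as_ sb] e0; set b := cend c in sb *.
have fin : length_on c s b \is a fin_num.
  rewrite ge0_fin_numE ?length_on_ge0 ?(ltW sb)//; apply: le_lt_trans rc.
  by rewrite /clength (length_onD c as_ (ltW sb)) leeDr// length_on_ge0.
have e20 : 0 < e / 2 by rewrite divr_gt0.
have [_ [l hl <-] hlt] : exists2 x, [set (polygonal c s l)%:E | l in itv_partition s b] x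
    & (length_on c s b - (e / 2)%:E < x)%E.
  by rewrite length_onE; apply: ub_ereal_sup_adherent; rewrite // -length_onE.
case: l hl hlt => [/itv_partition_nil sb'|x l hl hlt].
  by rewrite sb' ltxx in sb.
have sx : s < x by case: hl => /= /andP[].
have xb := itv_partition_le (itv_partition_cons hl).
have [|d d0 hd] := @curve_near c s (e / 2) _ e20; first by rewrite as_ ltW.
pose q := Num.min x (s + d / 2).
have sq : s < q by rewrite lt_min sx ltrDl divr_gt0.
have qx : q <= x by rewrite ge_min lexx.
have qb : q <= b := le_trans qx xb.
exists q; first by rewrite sq.
have dq : mdist (c s) (c q) < e / 2.
  apply: hd; first by rewrite qb (le_trans as_)// ltW.
  rewrite distrC gtr0_norm ?subr_gt0// ltrBlDl.
  apply: le_lt_trans (_ : s + d / 2 < _); first by rewrite ge_min lexx orbT.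
  by rewrite ltrD2l ltr_pdivrMr// ltr_pMr// ltr1n.
have qfin : length_on c q b \is a fin_num.
  move: fin; rewrite (length_onD c (ltW sq) qb) fin_numD => /andP[] //.
have sqfin : length_on c s q \is a fin_num.
  move: fin; rewrite (length_onD c (ltW sq) qb) fin_numD => /andP[] //.
have h : ((polygonal c s (x :: l))%:E <= (e / 2)%:E + length_on c q b)%E.
  apply: (@le_trans _ _ ((mdist (c s) (c q))%:E + ((mdist (c q) (c x))%:E + length_on c x b))%E).
    apply: (@le_trans _ _ ((mdist (c s) (c q))%:E + ((mdist (c q) (c x))%:E + (polygonal c x l)%:E))%E).
      by rewrite -!EFinD lee_fin /= addrA lerD2r metric_triangle.
    by rewrite !leeD2l// polygonal_le//; exact: itv_partition_cons hl.
  apply: leeD; first by rewrite lee_fin ltW.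
  by rewrite (length_onD c qx xb) leeD2r// mdist_le_length_on.
move: hlt h; rewrite (length_onD c (ltW sq) qb).
rewrite -(fineK qfin) -(fineK sqfin) -!EFinD lte_fin !lee_fin.
move: (fine _) (fine _) (polygonal _ _ _) => A B D; lra.
Qed.

Lemma length_small_left c (s e : R) : rectifiable c ->
  cstart c < s <= cend c -> 0 < e ->
  exists2 q, cstart c <= q < s & (length_on c q s <= e%:E)%E.
Proof.
move=> rc /andP[as_ sb] e0; set a := cstart c in as_ *.
have fin : length_on c a s \is a fin_num.
  rewrite ge0_fin_numE ?length_on_ge0 ?(ltW as_)//; apply: le_lt_trans rc.
  by rewrite /clength (length_onD c (ltW as_) sb) leeDl// length_on_ge0.
have e20 : 0 < e / 2 by rewrite divr_gt0.
have [_ [l hl <-] hlt] : exists2 x, [set (polygonal c a l)%:E | l in itv_partition a s] x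
    & (length_on c a s - (e / 2)%:E < x)%E.
  by rewrite length_onE; apply: ub_ereal_sup_adherent; rewrite // -length_onE.
case/lastP: l hl hlt => [/itv_partition_nil sb'|l x hl hlt].
  by rewrite sb' ltxx in as_.
case: hl; rewrite last_rcons rcons_path => /andP[pl xs] /eqP xE; subst x.
set x := last a l in xs; have hl : itv_partition a x l by split => //=.
have ax := itv_partition_le hl.
have [|d d0 hd] := @curve_near c s (e / 2) _ e20; first by rewrite sb ltW.
pose q := Num.max x (s - d / 2).
have sq : q < s by rewrite gt_max xs gtrBl divr_gt0.
have qx : x <= q by rewrite le_max lexx.
have qb : a <= q := le_trans ax qx.
exists q; first by rewrite sq qb.
have dq : mdist (c q) (c s) < e / 2.
  rewrite metric_sym; apply: hd; first by rewrite qb (le_trans _ sb)// ltW.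
  rewrite gtr0_norm ?subr_gt0// ltrBlDr -ltrBlDl.
  apply: lt_le_trans (_ : s - d / 2 <= _); last by rewrite le_max lexx orbT.
  by rewrite ltrD2l ltrN2 ltr_pdivrMr// ltr_pMr// ltr1n.
have qfin : length_on c a q \is a fin_num.
  move: fin; rewrite (length_onD c qb (ltW sq)) fin_numD => /andP[] //.
have sqfin : length_on c q s \is a fin_num.
  move: fin; rewrite (length_onD c qb (ltW sq)) fin_numD => /andP[] //.
have h : ((polygonal c a (rcons l s))%:E <= length_on c a q + (e / 2)%:E)%E.
  rewrite -cats1 polygonal_cat /= addr0 -/x.
  apply: (@le_trans _ _ (length_on c a x + (mdist (c x) (c q))%:E + (mdist (c q) (c s))%:E)%E).
    rewrite EFinD -addeA leeD ?polygonal_le//.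
    by rewrite -EFinD lee_fin metric_triangle.
  apply: leeD; last by rewrite lee_fin ltW.
  by rewrite (length_onD c ax qx) leeD2l// mdist_le_length_on.
move: hlt h; rewrite (length_onD c qb (ltW sq)).
rewrite -(fineK qfin) -(fineK sqfin) -!EFinD lte_fin !lee_fin.
move: (fine _) (fine _) (polygonal _ _ _) => A B D; lra.
Qed.

End arclength.

Lemma clamp_contract {R : realType} (s t L : R) : s <= t -> 0 <= L ->
  Num.max 0 (Num.min s L) <= Num.max 0 (Num.min t L) /\
  Num.max 0 (Num.min t L) - Num.max 0 (Num.min s L) <= t - s.
Proof.
move=> st L0; have [sL|Ls] := leP s L; have [tL|Lt] := leP t L.
- by have [s0|s0] := leP 0 s; have [t0|t0] := leP 0 t; lra.
- by have [s0|s0] := leP 0 s; have [t0|t0] := leP 0 L; lra.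
- by have [s0|s0] := leP 0 L; have [t0|t0] := leP 0 t; lra.
- by lra.
Qed.

Section unit_param.
Context {R : realType} {X : metricType R}.
Variable c : curve X.
Hypothesis rc : rectifiable c.
Let a := cstart c.
Let b := cend c.
Let L := fine (clength c).

Let ab : a <= b. Proof. exact: cstart_le_end. Qed.

Let finL : clength c \is a fin_num.
Proof. by rewrite ge0_fin_numE ?length_on_ge0. Qed.

Lemma clength_fineK : (fine (clength c))%:E = clength c.
Proof. by rewrite fineK. Qed.

Lemma fine_clength_ge0 : 0 <= fine (clength c).
Proof. by rewrite fine_ge0// length_on_ge0. Qed.

Let lfin s : a <= s <= b -> length_on c a s \is a fin_num.
Proof.
move=> /andP[as_ sb]; rewrite ge0_fin_numE ?length_on_ge0//; apply: le_lt_trans rc.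
by rewrite /clength (length_onD c as_ sb) leeDl// length_on_ge0.
Qed.

Let l_mono s t : a <= s -> s <= t -> (length_on c a s <= length_on c a t)%E.
Proof. by move=> as_ st; rewrite (length_onD c as_ st) leeDl// length_on_ge0. Qed.

(** Intermediate value argument: [s0] is the supremum of the parameters with length at most [t], and
    the two one-sided smallness lemmas exclude a jump of the length at [s0]. *)
Lemma length_on_surj (t : R) : 0 <= t <= L ->
  exists2 s, a <= s <= b & length_on c a s = t%:E.
Proof.
move=> /andP[t0 tL].
pose S := [set s | a <= s <= b /\ (length_on c a s <= t%:E)%E].
have Sa : S a by split; rewrite ?lexx ?ab// length_onxx lee_fin.
have Sb : ubound S b by move=> s [/andP[]].
have hS : has_sup S by split; [exists a|exists b].
pose s0 := sup S.
have as0 : a <= s0 by apply: ub_le_sup => //; exists b.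
have s0b : s0 <= b by apply: ge_sup => //; exists a.
exists s0; first by rewrite as0.
apply/eqP; rewrite eq_le; apply/andP; split.
  apply/lee_addgt0Pr => e e0.
  move: (as0); rewrite le_eqVlt => /predU1P[<-|as0'].
    by rewrite length_onxx -EFinD lee_fin addr_ge0// ltW.
  have [|q /andP[aq qs] hq] := @length_small_left _ _ c s0 e rc _ e0.
    by rewrite as0'.
  have [s [_ Ss] qs'] := sup_gt hS.1 qs.
  rewrite (length_onD c aq (ltW qs)) leeD//.
  by apply: le_trans Ss; apply: l_mono => //; exact: ltW.
apply/lee_addgt0Pr => e e0.
move: (s0b); rewrite le_eqVlt => /predU1P[->|s0b'].
  rewrite -/(clength c) -clength_fineK -EFinD lee_fin (le_trans tL)// lerDl.
  exact: ltW.
have [|q /andP[sq qb] hq] := @length_small_right _ _ c s0 e rc _ e0.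
  by rewrite as0.
have : (t%:E < length_on c a q)%E.
  rewrite ltNge; apply/negP => h.
  have : q <= s0.
    apply: ub_le_sup; [by exists b|split => //].
    by rewrite qb (le_trans as0)// ltW.
  by rewrite leNgt sq.
rewrite (length_onD c as0 (ltW sq)) => /ltW /le_trans; apply.
by rewrite leeD2l.
Qed.

Lemma curve_eq_of_length s s' : a <= s <= b -> a <= s' <= b ->
  length_on c a s = length_on c a s' -> c s = c s'.
Proof.
wlog ss : s s' / s <= s'.
  move=> h hs hs' e; have [/h|/ltW/h] := leP s s'; first exact.
  by move=> ->.
move=> hs /andP[as' sb'] e; apply: mdist_positivity; apply/eqP.
rewrite eq_le mdist_ge0 andbT -lee_fin.
apply: le_trans (mdist_le_length_on c ss) _.
have /andP[as_ sb] := hs; move: e; rewrite (length_onD c as_ ss).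
have hf : length_on c s s' \is a fin_num.
  have : length_on c a s' \is a fin_num by apply: lfin; rewrite as'.
  by rewrite (length_onD c as_ ss) fin_numD => /andP[].
rewrite -(fineK (lfin hs)) -(fineK hf) -EFinD => -[] e; rewrite lee_fin.
by move: e; move: (fine _) (fine _) => x y; lra.
Qed.

(** The infimum of the fibre is not known to lie in the fibre; continuity of [c] carries the common
    value on the fibre over to it. *)
Lemma arclength_paramE s t : a <= s <= b -> length_on c a s = t%:E ->
  arclength_param c t = c s.
Proof.
move=> hs hst; rewrite /arclength_param.
set A := [set _ | _]; have As : A s by split => //; rewrite in_itv.
have lA : lbound A a by move=> x [+ _]; rewrite in_itv => /andP[].
have hA : has_inf A by split; [exists s|exists a].
set r := inf A.
have ar : a <= r by apply: lb_le_inf => //; exists s.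
have rs : r <= s by apply: ge_inf => //; exists a.
apply: mdist_positivity; apply/eqP; rewrite eq_le mdist_ge0 andbT.
apply/ler_addgt0Pr => e e0; rewrite add0r.
have rab : a <= r <= b by rewrite ar (le_trans rs)//; case/andP: hs.
have [d d0 hd] := curve_near rab e0.
have [s' [hs' As'] s'r] := inf_adherent d0 hA.
have <- : c s' = c s.
  by apply: curve_eq_of_length; rewrite ?hst.
apply/ltW/hd; first by move: hs'; rewrite in_itv.
have rs' : r <= s' by apply: ge_inf; [exists a|split].
by rewrite distrC ger0_norm ?subr_ge0// ltrBlDl.
Qed.

(** Clamping the parameter gives a 1-Lipschitz map on the whole line with values in the trace, so
    that later paths can be shifted, reversed and glued as total maps. *)
Definition unit_param (t : R) : X :=
  arclength_param c (Num.max 0 (Num.min t (fine (clength c)))).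

Let clampP t : 0 <= Num.max 0 (Num.min t L) <= L.
Proof. by rewrite le_max lexx ge_max fine_clength_ge0 ge_min lexx orbT. Qed.

Lemma unit_paramE t : 0 <= t <= L -> unit_param t = arclength_param c t.
Proof. by move=> /andP[t0 tL]; rewrite /unit_param min_l// max_r. Qed.

Lemma unit_param_length s : a <= s <= b ->
  unit_param (fine (length_on c a s)) = c s.
Proof.
move=> hs; rewrite unit_paramE; first by apply: arclength_paramE; rewrite ?fineK// lfin.
case/andP: (hs) => as_ sb.
rewrite fine_ge0 ?length_on_ge0//= fine_le// ?lfin//; exact: l_mono.
Qed.

Lemma unit_param0 : unit_param 0 = c (cstart c).
Proof. by rewrite -(@unit_param_length a) ?lexx// length_onxx. Qed.

Lemma unit_paramL : unit_param (fine (clength c)) = c (cend c).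
Proof. by rewrite -(@unit_param_length b) ?lexx// ab. Qed.

Lemma unit_param_trace t : trace c (unit_param t).
Proof.
have [s hs e] := length_on_surj (clampP t).
by rewrite /unit_param (arclength_paramE hs e); exists s => //=; rewrite in_itv.
Qed.

Lemma unit_param_onto z : trace c z -> exists2 t, 0 <= t <= L & unit_param t = z.
Proof.
move=> [s /=]; rewrite in_itv /= => hs <-; exists (fine (length_on c a s)).
  case/andP: (hs) => as_ sb.
  rewrite fine_ge0 ?length_on_ge0//= fine_le// ?lfin//; exact: l_mono.
exact: unit_param_length.
Qed.

Lemma unit_param_lip s t : mdist (unit_param s) (unit_param t) <= `|s - t|.
Proof.
wlog st : s t / s <= t.
  by move=> h; have [/h//|/ltW/h] := leP s t; rewrite metric_sym distrC.
rewrite /unit_param; set s1 := Num.max 0 _; set t1 := Num.max 0 _.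
have [x /andP[ax xb] hx] := length_on_surj (clampP s).
have [y /andP[ay yb] hy] := length_on_surj (clampP t).
rewrite -/s1 in hx; rewrite -/t1 in hy.
have clamp_ht := clamp_contract st fine_clength_ge0.
have s1t1 : s1 <= t1 by exact: clamp_ht.1.
have ts : t1 - s1 <= t - s by exact: clamp_ht.2.
rewrite distrC ger0_norm ?subr_ge0//; apply: le_trans ts.
rewrite (@arclength_paramE x) ?ax// (@arclength_paramE y) ?ay//.
have [xy|/ltW yx] := leP x y.
  rewrite -lee_fin; apply: le_trans (mdist_le_length_on c xy) _.
  by rewrite EFinB leeBrDl// -hx -hy -length_onD.
have -> : c x = c y.
  apply: curve_eq_of_length; rewrite ?ax ?ay//; apply/eqP.
  by rewrite eq_le (l_mono ay yx) andbT hx hy lee_fin.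
by rewrite mdistxx subr_ge0.
Qed.

(** [unit_param] takes the values of [c] at the arc lengths of partition points, so every polygon of
    [c] is bounded by the length of [unit_param]. *)
Let total : (L%:E <= length_on unit_param 0 L)%E.
Proof.
have h s x : a <= x -> itv_partition x b s ->
    ((polygonal c x s)%:E <=
     length_on unit_param (fine (length_on c a x)) (fine (clength c)))%E.
  elim: s x => [|y s IH] x ax hs.
    rewrite length_on_ge0// fine_le// ?lfin ?ax ?(itv_partition_le hs)//.
    by apply: l_mono => //; exact: itv_partition_le hs.
  have xy : x < y by case: hs => /= /andP[].
  have yb := itv_partition_le (itv_partition_cons hs).
  have ay : a <= y by rewrite (le_trans ax)// ltW.
  rewrite (@length_onD _ _ _ _ (fine (length_on c a y))); last 2 first.
  - by rewrite fine_le// ?lfin ?ax ?ay//= ?(le_trans (ltW xy))// l_mono// ltW.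
  - by rewrite fine_le// ?lfin ?ay// l_mono.
  rewrite /= EFinD leeD//; last by apply: IH => //; exact: itv_partition_cons hs.
  rewrite -(@unit_param_length x) ?ax ?(le_trans (ltW xy))//.
  rewrite -(@unit_param_length y) ?ay//.
  apply: mdist_le_length_on.
  by rewrite fine_le// ?lfin ?ax ?ay//= ?(le_trans (ltW xy))// l_mono// ltW.
rewrite /L clength_fineK /clength; apply: length_on_le => s hs.
by have := h s a (lexx _) hs; rewrite length_onxx.
Qed.

(** The Lipschitz bound gives at most the parameter length on every subinterval, and the pieces add
    up to at least the full length by [total]; so equality holds on each piece. *)
Lemma unit_param_speed s t : 0 <= s -> s <= t -> t <= L ->
  length_on unit_param s t = (t - s)%:E.
Proof.
have lip u v : u <= v -> (length_on unit_param u v <= (v - u)%:E)%E.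
  move=> uv; apply: length_on_lip => // x y ux xy yv.
  by apply: le_trans (unit_param_lip _ _) _; rewrite distrC ger0_norm ?subr_ge0.
move=> s0 st tL; apply/eqP; rewrite eq_le lip//=.
have fn u v : u <= v -> length_on unit_param u v \is a fin_num.
  by move=> uv; rewrite ge0_fin_numE ?length_on_ge0// (le_lt_trans (lip _ _ uv))// ltey.
move: total (lip _ _ s0) (lip _ _ tL); rewrite (length_onD _ s0 (le_trans st tL)).
rewrite (length_onD _ st tL) -(fineK (fn _ _ s0)) -(fineK (fn _ _ st)) -(fineK (fn _ _ tL)).
rewrite -!EFinD !lee_fin; move: (fine _) (fine _) (fine _) => x y z; lra.
Qed.

Lemma line_integralE (g : X -> \bar R) :
  line_integral c g =
  (\int[lebesgue_measure]_(t in `[0%R, fine (clength c)]) g (unit_param t))%E.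
Proof.
apply: eq_integral => t /set_mem; rewrite /= in_itv /= => ht.
by rewrite unit_paramE.
Qed.

End unit_param.

(** * 1-Lipschitz paths *)

Section interval_integral.
Context {R : realType}.
Implicit Types (F G : R -> \bar R) (a b c x : R).
Local Notation mu := (@lebesgue_measure R).
Local Open Scope ereal_scope.

Definition itg F a b := \int[mu]_(t in `[a, b]) F t.

(** The image of Lebesgue measure under [phi] has the right value on half-open intervals, which
    determines it; what remains is integration against an image measure. *)
Lemma itg_substitution (phi : measurableTypeR R -> measurableTypeR R) a b a' b' F :
  measurable_fun setT phi ->
  (forall u v : R, mu (phi @^-1` `]u, v]) = mu `]u, v]) ->
  phi @^-1` `[a', b'] = `[a, b]%classic ->
  measurable_fun setT F -> (forall t, 0 <= F t) ->
  itg (F \o phi) a b = itg F a' b'.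
Proof.
move=> mphi hphi himg mF F0; rewrite /itg -himg.
rewrite -(@ge0_integral_pushforward _ _ _ _ _ phi mphi mu `[a', b'] F)//=;
  last exact: measurable_funTS.
apply: eq_measure_integral => //= A mA _.
pose nu := (pushforward mu phi : {measure set (measurableTypeR R) -> \bar R}).
suff -> : mu A = nu mphi A by [].
by apply: lebesgue_measure_unique => // _ [[u v]] _ <-; rewrite -hphi.
Qed.

Lemma itg_shift F x a b : measurable_fun setT F -> (forall t, 0 <= F t) ->
  itg (fun t => F (x + t)%R) a b = itg F (x + a)%R (x + b)%R.
Proof.
move=> mF F0.
have pre (y z : R) (i j : bool) : (fun t : R => x + t)%R @^-1`
    [set` Interval (BSide i y) (BSide j z)] =
    [set` Interval (BSide i (y - x)%R) (BSide j (z - x)%R)].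
  apply/seteqP; split => t /=; rewrite !in_itv /=;
    by case: i; case: j => /=; move=> /andP[? ?]; apply/andP; split; lra.
apply: (@itg_substitution (fun t => x + t)%R _ _ _ _ F) => //.
- by apply: measurable_funD.
- move=> u v; rewrite pre !lebesgue_measure_itv/= !lte_fin ltrD2r.
  by case: ifPn => // _; congr EFin; ring.
- by rewrite pre ![(x + _)%R]addrC !addrK.
Qed.

Lemma itg_flip F x a b : measurable_fun setT F -> (forall t, 0 <= F t) ->
  itg (fun t => F (x - t)%R) a b = itg F (x - b)%R (x - a)%R.
Proof.
move=> mF F0.
apply: (@itg_substitution (fun t => x - t)%R _ _ _ _ F) => //.
- by apply: measurable_funB.
- move=> u v; rewrite (_ : _ @^-1` _ = `[(x - v)%R, (x - u)%R[%classic); last first.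
    by apply/seteqP; split => t /=; rewrite !in_itv /=;
      move=> /andP[? ?]; apply/andP; split; lra.
  rewrite !lebesgue_measure_itv/= !lte_fin ltrD2l ltrN2.
  by case: ifPn => // _; congr EFin; ring.
- by apply/seteqP; split => t /=; rewrite !in_itv /=;
     move=> /andP[? ?]; apply/andP; split; lra.
Qed.

Lemma itg_cat F a b c : measurable_fun setT F -> (forall t, 0 <= F t) ->
  (a <= b)%R -> (b <= c)%R -> itg F a c = itg F a b + itg F b c.
Proof.
move=> mF F0 ab bc; rewrite /itg.
rewrite -(@integral_itv_obnd_cbnd _ b (BRight c) F); last exact: measurable_funTS.
rewrite -ge0_integral_setU//=.
- congr (integral _ _ _); apply/seteqP; split => t /=; rewrite !in_itv/=.
    by move=> /andP[at_ tc]; have [tb|tb] := leP t b; [left|right]; apply/andP.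
  by move=> [/andP[? ?]|/andP[? ?]]; apply/andP; split; lra.
- exact: measurable_funTS.
- apply/eqP; rewrite predeqE => t /=; split => // -[]; rewrite !in_itv/=.
  by move=> /andP[_ tb] /andP[bt _]; move: (lt_le_trans bt tb); rewrite ltxx.
Qed.

Lemma itgxx F a : itg F a a = 0.
Proof. by rewrite /itg set_itv1 integral_set1. Qed.

Lemma itg_ge0 F a b : (forall t, 0 <= F t) -> 0 <= itg F a b.
Proof. by move=> F0; apply: integral_ge0. Qed.

Lemma le_itg F G a b : measurable_fun setT F -> (forall t, 0 <= F t) ->
  measurable_fun setT G -> (forall t, (a <= t <= b)%R -> F t <= G t) ->
  itg F a b <= itg G a b.
Proof.
move=> mF F0 mG FG; by apply: ge0_le_integral => //=; exact: measurable_funTS.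
Qed.

Lemma eq_itg F G a b : (forall t, (a <= t <= b)%R -> F t = G t) ->
  itg F a b = itg G a b.
Proof. by move=> FG; apply: eq_integral => t /set_mem; rewrite /= in_itv => /FG. Qed.

Lemma itg_cst (r : \bar R) a b : (a <= b)%R ->
  itg (cst r) a b = r * (b - a)%:E.
Proof.
move=> ab; rewrite /itg integral_cst//= lebesgue_measure_itv/= lte_fin.
by case: ltP => // ba; rewrite (_ : b = a) ?subrr// ; apply/eqP; rewrite eq_le ba.
Qed.

End interval_integral.

Definition lip1 {R : realType} {X : metricType R} (h : R -> X) :=
  forall s t, mdist (h s) (h t) <= `|s - t|.

Section lip1.
Context {R : realType} {X : metricType R}.
Implicit Types (h : R -> X) (a b : R) (D : set X).

Lemma lip1_continuous h : lip1 h -> continuous h.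
Proof.
move=> hl s; apply/metricType_numDomainType.cvgrPdist_lt => e e0.
apply/nbhs_ballP; exists e => //= t /=; rewrite /ball /= => st.
exact: le_lt_trans (hl s t) st.
Qed.

Lemma lip1_const (x : X) : lip1 (fun=> x).
Proof. by move=> s t; rewrite mdistxx. Qed.

Lemma lip1_shift h x : lip1 h -> lip1 (fun t => h (x + t)).
Proof. by move=> hl s t; apply: le_trans (hl _ _) _; rewrite opprD addrACA subrr add0r. Qed.

Lemma lip1_flip h x : lip1 h -> lip1 (fun t => h (x - t)).
Proof.
move=> hl s t; apply: le_trans (hl _ _) _.
by rewrite opprB [t - x]addrC addrACA subrr add0r addrC distrC.
Qed.

Definition glue a h1 h2 (t : R) : X := if t <= a then h1 t else h2 t.

Lemma lip1_glue a h1 h2 : lip1 h1 -> lip1 h2 -> h1 a = h2 a -> lip1 (glue a h1 h2).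
Proof.
move=> l1 l2 e s t; wlog st : s t / s <= t.
  by move=> h; have [/h//|/ltW/h] := leP s t; rewrite metric_sym distrC.
rewrite /glue; case: (leP s a) => sa; case: (leP t a) => ta //; last first.
  by move: (le_trans st ta); rewrite leNgt sa.
apply: le_trans (metric_triangle _ (h1 a) _) _.
have l2' : mdist (h1 a) (h2 t) <= `|a - t| by rewrite e l2.
apply: le_trans (lerD (l1 _ _) l2') _.
rewrite ![`|_ - _|]ler0_norm ?subr_le0//; last exact: ltW.
by lra.
Qed.

Lemma lip1_continuous_within h a b : lip1 h -> {within `[a, b], continuous h}.
Proof. by move=> hl; apply: continuous_subspaceT; exact: lip1_continuous. Qed.

Definition lip_curve h (hl : lip1 h) a b (ab : a <= b) : curve X :=
  Curve ab (@lip1_continuous_within h a b hl).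

Lemma lip_curve_length h (hl : lip1 h) a b (ab : a <= b) :
  (clength (lip_curve hl ab) <= (b - a)%:E)%E.
Proof.
rewrite /clength /=; apply: length_on_lip => // s t as_ st tb.
by apply: le_trans (hl _ _) _; rewrite distrC ger0_norm ?subr_ge0.
Qed.

Lemma lip_curve_rectifiable h (hl : lip1 h) a b (ab : a <= b) :
  rectifiable (lip_curve hl ab).
Proof. by apply: le_lt_trans (lip_curve_length _ _) _; rewrite ltey. Qed.

Lemma lip_curve_trace h (hl : lip1 h) a b (ab : a <= b) z :
  trace (lip_curve hl ab) z -> exists2 t, a <= t <= b & z = h t.
Proof. by move=> [t /=]; rewrite in_itv /= => ht <-; exists t. Qed.

Lemma internal_dist_lip h D a b : lip1 h -> (forall t, a <= t <= b -> D (h t)) ->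
  a <= b -> (internal_dist D (h a) (h b) <= (b - a)%:E)%E.
Proof.
move=> hl hD ab; apply: le_trans (lip_curve_length hl ab).
apply: ereal_inf_lbound; exists (lip_curve hl ab) => //; split => //.
by move=> z /lip_curve_trace[t /hD ? ->].
Qed.

Lemma lip_curve_unit_param h (hl : lip1 h) a b (ab : a <= b) t :
  (forall s, a <= s <= b -> length_on h a s = (s - a)%:E) ->
  0 <= t <= b - a -> arclength_param (lip_curve hl ab) t = h (a + t).
Proof.
move=> sp /andP[t0 tb].
have hat : a <= a + t <= b by apply/andP; split; lra.
apply: (@arclength_paramE _ _ (lip_curve hl ab)) => //.
- exact: lip_curve_rectifiable.
- by rewrite /= sp//; congr EFin; ring.
Qed.

End lip1.

Section lip1_measurable.
Context {R : realType} {X : completeMetricType R}.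
Implicit Types (h : R -> X) (a b : R) (D : set X).

Lemma lip1_measurable h : lip1 h ->
  measurable_fun [set: measurableTypeR R] (h : measurableTypeR R -> borel X).
Proof.
move=> hl; apply: (@measurability _ _ (measurableTypeR R) (borel X) _ h (@open X) erefl).
move=> _ [B oB <-]; rewrite setTI; apply: open_measurable.
by apply: open_comp => // x _; exact: lip1_continuous.
Qed.

Lemma lip1_measurable_comp h D (g : X -> \bar R) : lip1 h -> (forall t, D (h t)) ->
  measurable (D : set (borel X)) -> measurable_fun (D : set (borel X)) g ->
  measurable_fun setT (fun t => g (h t)).
Proof.
move=> hl hD mD mg.
apply: (@measurable_comp _ _ _ _ _ _ (D : set (borel X)) g setT h) => //.
  by move=> _ [t _ <-].
exact: lip1_measurable.
Qed.

Lemma line_integral_lip_curve h (hl : lip1 h) a b (ab : a <= b) (g : X -> \bar R) :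
  (forall s, a <= s <= b -> length_on h a s = (s - a)%:E) ->
  measurable_fun setT (fun t => g (h t)) -> (forall t, (0 <= g (h t))%E) ->
  line_integral (lip_curve hl ab) g = itg (fun t => g (h t)) a b.
Proof.
move=> sp mg g0.
have L : fine (clength (lip_curve hl ab)) = b - a.
  by rewrite /clength /= sp// lexx ab.
rewrite /line_integral L.
rewrite (_ : itg _ _ _ = itg (fun t => g (h t)) (a + 0) (a + (b - a))); last first.
  by rewrite addr0 [a + _]addrC subrK.
rewrite -itg_shift//.
by apply: eq_itg => t ht; rewrite lip_curve_unit_param.
Qed.

End lip1_measurable.

(** * Quasihyperbolic length and geodesics *)

(** Over [n] equal steps the increments add up to at most [|K| (b - a)^2 / n], which tends to 0.
    This takes the place of differentiation: two quantities with the same first-order growth are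
    compared without computing any derivative. *)
Lemma quadratic_increment_le (R : realType) (f : R -> R) (a b K : R) : a <= b ->
  (forall s t, a <= s -> s <= t -> t <= b -> f t - f s <= K * (t - s) ^+ 2) ->
  f b <= f a.
Proof.
move=> ab hf; rewrite leNgt; apply/negP => fab.
pose w := f b - f a; have w0 : 0 < w by rewrite subr_gt0.
pose B := `|K| * (b - a) ^+ 2.
have B0 : 0 <= B by rewrite mulr_ge0// sqr_ge0.
have [n /andP[_ hn]] : exists n : nat, true && (B / w < n%:R).
  by exists (Num.Def.truncn (B / w)).+1; rewrite /= truncnS_gt.
have n0 : 0 < n%:R :> R by apply: le_lt_trans hn; rewrite divr_ge0// ltW.
pose dl := (b - a) / n%:R.
have dl0 : 0 <= dl by rewrite divr_ge0 ?subr_ge0// ltW.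
have ndl : n%:R * dl = b - a by rewrite mulrC divfK// gt_eqF.
have step k : (k <= n)%N -> f (a + k%:R * dl) - f a <= k%:R * (`|K| * dl ^+ 2).
  elim: k => [|k IH] kn; first by rewrite !mul0r addr0 subrr.
  have kn' : a + k.+1%:R * dl <= b.
    by rewrite -lerBrDl -ndl ler_wpM2r// ler_nat.
  have := IH (ltnW kn).
  have : f (a + k.+1%:R * dl) - f (a + k%:R * dl) <= `|K| * dl ^+ 2.
    apply: le_trans (hf (a + k%:R * dl) _ _ _ kn') _.
    - by rewrite lerDl mulr_ge0.
    - by rewrite lerD2l ler_wpM2r// ler_nat.
    - have -> : a + k.+1%:R * dl - (a + k%:R * dl) = dl by rewrite -natr1; ring.
      by rewrite ler_wpM2r ?sqr_ge0// ler_norm.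
  have -> : k.+1%:R * (`|K| * dl ^+ 2) = k%:R * (`|K| * dl ^+ 2) + `|K| * dl ^+ 2.
    by rewrite -natr1; ring.
  by move: (_ * dl ^+ 2) (_ * (_ * dl ^+ 2)) (f _) (f _) (f a) => *; lra.
have := step n (leqnn _); rewrite ndl (_ : a + (b - a) = b); last by ring.
have -> : n%:R * (`|K| * dl ^+ 2) = B / n%:R.
  by rewrite /B /dl; field; rewrite gt_eqF.
rewrite -/w leNgt => /negP; apply.
by rewrite ltr_pdivrMr// mulrC -ltr_pdivrMr.
Qed.

Section boundary_distance.
Context {R : realType} {X : completeMetricType R}.
Variable Om : set X.
Hypothesis oOm : open Om.
Hypothesis bOm : boundary Om !=set0.

Definition bdist (x : X) : R := fine (edist_inf (boundary Om) x).

Lemma edistE (x y : X) : edist (x, y) = (mdist x y)%:E.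
Proof.
apply/eqP; rewrite eq_le; apply/andP; split.
  apply/lee_addgt0Pr => e e0; rewrite -EFinD; apply: edist_fin.
    by rewrite ltr_wpDl// mdist_ge0.
  by rewrite ballEmdist /= ltrDl.
apply: le_ereal_inf_tmp => _ [r [r0 h] <-]; rewrite ballEmdist /= in h.
by rewrite lee_fin ltW.
Qed.

Lemma bdistE x : edist_inf (boundary Om) x = (bdist x)%:E.
Proof.
rewrite /bdist fineK// ge0_fin_numE ?edist_inf_ge0//.
case: bOm => b hb; apply: le_lt_trans (_ : edist (x, b) < _)%E.
  by apply: ereal_inf_lbound; exists b.
by rewrite edistE ltey.
Qed.

Lemma bdist_ge0 x : 0 <= bdist x.
Proof. by rewrite fine_ge0// edist_inf_ge0. Qed.

Lemma bdist_le_mdist x b : boundary Om b -> bdist x <= mdist x b.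
Proof.
by move=> hb; rewrite -lee_fin -bdistE -edistE; apply: ereal_inf_lbound; exists b.
Qed.

Lemma bdist_triangle x y : bdist x <= mdist x y + bdist y.
Proof.
by rewrite -lee_fin EFinD -!bdistE -edistE; exact: edist_inf_triangle.
Qed.

Lemma bdist_lip x y : `|bdist x - bdist y| <= mdist x y.
Proof.
have := bdist_triangle x y; have := bdist_triangle y x; rewrite metric_sym => h1 h2.
by rewrite ler_norml; apply/andP; split; lra.
Qed.

Lemma bdist_gt0 x : Om x -> 0 < bdist x.
Proof.
move=> Ox; have /nbhs_ballP[e /= e0 he] : nbhs x Om by exact: open_nbhs_nbhs.
rewrite -lte_fin; apply: lt_le_trans (_ : e%:E <= _)%E; first by rewrite lte_fin.
rewrite -bdistE; apply: le_ereal_inf_tmp => _ [b [_ hb] <-].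
rewrite edistE lee_fin leNgt; apply/negP => xb; apply: hb.
by apply: open_nbhs_nbhs; split => //; apply: he; rewrite ballEmdist.
Qed.

Lemma bdist_closure x : closure Om x -> 0 < bdist x -> Om x.
Proof.
move=> cx dx; apply: contrapT => nx.
have := @bdist_le_mdist x x; rewrite mdistxx leNgt dx => h.
suff /h : boundary Om x by [].
by split => // /nbhs_singleton.
Qed.

Lemma bdist_continuous : continuous bdist.
Proof.
move=> x; apply/(@cvgrPdist_lt _ R^o) => e e0.
apply/nbhs_ballP; exists e => //= y; rewrite ballEmdist /= => xy.
exact: le_lt_trans (bdist_lip _ _) xy.
Qed.

Lemma bdist_comp_continuous (h : R -> X) : lip1 h -> continuous (fun t => bdist (h t)).
Proof.
move=> hl t; apply: continuous_comp; first exact: lip1_continuous.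
exact: bdist_continuous.
Qed.

Lemma bdist_lower (h : R -> X) a b : lip1 h -> (forall t, a <= t <= b -> Om (h t)) ->
  a <= b -> exists2 m, 0 < m & forall t, a <= t <= b -> m <= bdist (h t).
Proof.
move=> hl hO ab.
have [|c hc cmin] := @EVT_min R (fun t => bdist (h t)) a b ab.
  by apply: continuous_subspaceT => t; exact: bdist_comp_continuous.
exists (bdist (h c)); last by move=> t ht; apply: cmin; rewrite in_itv.
by apply/bdist_gt0/hO; move: hc; rewrite in_itv.
Qed.

Definition qhw (h : R -> X) (t : R) : \bar R := ((bdist (h t))^-1)%:E.

Lemma qhw_measurable h : lip1 h -> (forall t, Om (h t)) ->
  measurable_fun setT (qhw h).
Proof.
move=> hl hO; apply/measurable_EFinP; apply: continuous_measurable_fun => t.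
apply: cvgV; first by rewrite gt_eqF// bdist_gt0.
exact: bdist_comp_continuous.
Qed.

Lemma qhw_ge0 h t : (0 <= qhw h t)%E.
Proof. by rewrite lee_fin invr_ge0 bdist_ge0. Qed.

Lemma qh_lengthE c : rectifiable c -> trace c `<=` Om ->
  qh_length Om c = itg (qhw (unit_param c)) 0 (fine (clength c)).
Proof.
move=> rc tc; rewrite /qh_length line_integralE//; apply: eq_itg => t _.
rewrite bdistE inver gt_eqF// bdist_gt0//; apply/tc; exact: unit_param_trace.
Qed.

Lemma itg_qhw_bounds h (s t m M : R) : lip1 h -> (forall t, Om (h t)) -> s <= t ->
  (forall u, s <= u <= t -> m <= (bdist (h u))^-1 <= M) ->
  ((m * (t - s))%:E <= itg (qhw h) s t /\ itg (qhw h) s t <= (M * (t - s))%:E)%E.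
Proof.
move=> hl hO st hb; have mq := qhw_measurable hl hO; split.
  have [m0|m0] := leP 0 m; last first.
    apply: (@le_trans _ _ 0%E); last by apply: itg_ge0 => u; exact: qhw_ge0.
    by rewrite lee_fin nmulr_rle0// subr_ge0.
  rewrite EFinM -itg_cst//; apply: le_itg => //.
  by move=> u /hb /andP[]; rewrite lee_fin.
rewrite EFinM -itg_cst//; apply: le_itg => //; first by move=> u; exact: qhw_ge0.
by move=> u /hb /andP[]; rewrite lee_fin.
Qed.

Lemma inv_lip (m x y r : R) : 0 < m -> m <= x -> m <= y -> `|x - y| <= r ->
  y^-1 <= x^-1 + m^-2 * r.
Proof.
move=> m0 mx my h; have x0 := lt_le_trans m0 mx; have y0 := lt_le_trans m0 my.
rewrite -lerBlDl; have -> : y^-1 - x^-1 = (x * y)^-1 * (x - y).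
  by field; rewrite !gt_eqF.
apply: le_trans (ler_norm _) _; rewrite normrM ler_pM//.
rewrite ger0_norm ?invr_ge0 ?mulr_ge0 ?(ltW x0) ?(ltW y0)//.
rewrite lef_pV2 ?posrE ?mulr_gt0 ?exprn_gt0// expr2 ler_pM//; exact: ltW.
Qed.

Lemma itg_qhw_fin h s t : lip1 h -> (forall t, Om (h t)) -> s <= t ->
  itg (qhw h) s t \is a fin_num.
Proof.
move=> hl hO st; have [m m0 hm] := bdist_lower hl (fun t _ => hO t) st.
have [|_ h2] := @itg_qhw_bounds h s t 0 m^-1 hl hO st.
  move=> u /hm um; rewrite invr_ge0 bdist_ge0/= lef_pV2// posrE//.
  exact: lt_le_trans um.
rewrite ge0_fin_numE; last by apply: itg_ge0 => u; exact: qhw_ge0.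
by apply: le_lt_trans h2 _; rewrite ltey.
Qed.

(** On [[s, t]] the weight differs from its value at [s] by at most [m^-2 (t - s)], because the
    boundary distance is 1-Lipschitz and at least [m]. *)
Lemma itg_qhw_increment h (a b s t m : R) : lip1 h -> (forall t, Om (h t)) -> 0 < m ->
  (forall t, a <= t <= b -> m <= bdist (h t)) -> a <= s -> s <= t -> t <= b ->
  (t - s) / bdist (h s) - m^-2 * (t - s) ^+ 2 <= fine (itg (qhw h) s t).
Proof.
move=> hl hO m0 hm as_ st tb.
have [|h1 _] := @itg_qhw_bounds h s t ((bdist (h s))^-1 - m^-2 * (t - s)) m^-1 hl hO st.
  move=> u /andP[su ut]; apply/andP; split; last first.
    have mu : m <= bdist (h u) by apply: hm; apply/andP; split; lra.
    by rewrite lef_pV2// posrE//; exact: lt_le_trans mu.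
  rewrite lerBlDr; apply: inv_lip => //.
  - by apply: hm; apply/andP; split; lra.
  - by apply: hm; apply/andP; split; lra.
  - apply: le_trans (bdist_lip _ _) _; apply: le_trans (hl _ _) _.
    by rewrite ger0_norm ?subr_ge0// lerD2r.
rewrite -lee_fin fineK; last exact: itg_qhw_fin.
by apply: le_trans h1; rewrite lee_fin le_eqVlt; apply/orP; left; apply/eqP; ring.
Qed.

Lemma itg_qhwD h a b c : lip1 h -> (forall t, Om (h t)) -> a <= b -> b <= c ->
  fine (itg (qhw h) a c) = fine (itg (qhw h) a b) + fine (itg (qhw h) b c).
Proof.
move=> hl hO ab bc; rewrite (itg_cat (qhw_measurable hl hO) _ ab bc).
  by rewrite fineD//; exact: itg_qhw_fin.
by move=> t; exact: qhw_ge0.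
Qed.

(* Comparing increments over short intervals avoids a change of variables: both
   sides increase like (t - s) / bdist (h s) up to an error of order (t - s)^2. *)
Lemma qh_length_lip_curve_le h (hl : lip1 h) a b (ab : a <= b) (e : R -> R) (K : R) :
  (forall t, Om (h t)) ->
  (forall s t, a <= s -> s <= t -> t <= b ->
    (t - s) / bdist (h s) - K * (t - s) ^+ 2 <= e t - e s) ->
  (qh_length Om (lip_curve hl ab) <= (e b - e a)%:E)%E.
Proof.
move=> hO he; set c := lip_curve hl ab.
have rc : rectifiable c := lip_curve_rectifiable _ _.
have tc : trace c `<=` Om by move=> z /lip_curve_trace[t _ ->].
have ul := unit_param_lip rc.
have uO t : Om (unit_param c t) by apply/tc/unit_param_trace.
have [m m0 hm] := bdist_lower hl (fun t _ => hO t) ab.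
have hmu t : m <= bdist (unit_param c t).
  by have [s hs ->] := lip_curve_trace (unit_param_trace rc t); exact: hm.
rewrite qh_lengthE// -[itg _ _ _]fineK; last first.
  by apply: itg_qhw_fin => //; exact: fine_clength_ge0.
pose l t := fine (length_on h a t).
have llip s t : a <= s -> s <= t -> 0 <= l s /\ l s <= l t <= l s + (t - s).
  move=> as_ st.
  have lipst u v : u <= v -> (length_on h u v <= (v - u)%:E)%E.
    move=> uv; apply: length_on_lip => // x y ux xy yv.
    by apply: le_trans (hl _ _) _; rewrite distrC ger0_norm ?subr_ge0.
  have fn u v : u <= v -> length_on h u v \is a fin_num.
    by move=> uv; rewrite ge0_fin_numE ?length_on_ge0// (le_lt_trans (lipst _ _ uv))// ltey.
  rewrite /l (length_onD h as_ st) fineD ?fn// lerDl lerD2l.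
  rewrite !fine_ge0 ?length_on_ge0//; split => //=.
  by rewrite -lee_fin fineK ?fn// lipst.
have lb : l b = fine (clength c) by [].
have la : l a = 0 by rewrite /l length_onxx.
have ucl t : a <= t <= b -> unit_param c (l t) = h t.
  by move=> ht; exact: (unit_param_length rc).
suff : fine (itg (qhw (unit_param c)) 0 (l b)) - e b <=
       fine (itg (qhw (unit_param c)) 0 (l a)) - e a.
  rewrite la itgxx lb lee_fin; move: (fine (itg _ _ _)); rewrite /=; move=> r; lra.
(* The error [m^-2] comes from freezing the weight along the arc-length parametrization at its value
   at [h s]; the error [K] is the one allowed for [e]. *)
apply: (@quadratic_increment_le R (fun t => fine (itg (qhw (unit_param c)) 0 (l t)) - e t)
  a b (m^-2 + K)) => // s t as_ st tb.
have [ls0 /andP[lst lts]] := llip s t as_ st.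
rewrite (itg_qhwD ul uO ls0 lst).
have [|_ h2] := @itg_qhw_bounds (unit_param c) (l s) (l t) 0
    ((bdist (h s))^-1 + m^-2 * (t - s)) ul uO lst.
  move=> u /andP[su ut]; rewrite invr_ge0 bdist_ge0 andTb; apply: inv_lip => //.
    by apply: hm; apply/andP; split; lra.
  apply: le_trans (bdist_lip _ _) _.
  rewrite -ucl; last by apply/andP; split; lra.
  by apply: le_trans (ul _ _) _; rewrite distrC ger0_norm ?subr_ge0//; lra.
have h3 : fine (itg (qhw (unit_param c)) (l s) (l t)) <=
    ((bdist (h s))^-1 + m^-2 * (t - s)) * (t - s).
  rewrite -lee_fin fineK; last exact: itg_qhw_fin.
  apply: le_trans h2 _; rewrite lee_fin ler_wpM2l//; last by lra.
  by rewrite addr_ge0 ?invr_ge0 ?bdist_ge0// mulr_ge0 ?invr_ge0 ?sqr_ge0 ?subr_ge0.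
have := he s t as_ st tb.
have -> : (m^-2 + K) * (t - s) ^+ 2 = m^-2 * (t - s)^+2 + K * (t - s)^+2 by ring.
move: h3; have -> : ((bdist (h s))^-1 + m^-2 * (t - s)) * (t - s) =
  (t - s) / bdist (h s) + m^-2 * (t - s) ^+ 2 by ring.
move: (m^-2 * _) (K * _) ((t - s) / _) (fine _) (fine _) => ? ? ? ? ?; clear; lra.
Qed.

Lemma qh_length_lip_curve h (hl : lip1 h) a b (ab : a <= b) : (forall t, Om (h t)) ->
  (qh_length Om (lip_curve hl ab) <= itg (qhw h) a b)%E.
Proof.
move=> hO; have [m m0 hm] := bdist_lower hl (fun t _ => hO t) ab.
rewrite -[leRHS]fineK; last exact: itg_qhw_fin.
have -> : fine (itg (qhw h) a b) = fine (itg (qhw h) a b) - fine (itg (qhw h) a a).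
  by rewrite itgxx subr0.
apply: (@qh_length_lip_curve_le h hl a b ab (fun t => fine (itg (qhw h) a t)) (m^-2)) => //.
move=> s t as_ st tb; rewrite (itg_qhwD hl hO as_ st) addrAC subrr add0r.
exact: (@itg_qhw_increment h a b).
Qed.

(** Along a 1-Lipschitz path [- ln (bdist (h t))] grows at rate at most [1 / bdist (h t)], which is
    the quasihyperbolic weight. This is what keeps curves of bounded quasihyperbolic length away
    from the boundary. *)
Lemma bdist_exp_lower h a b : lip1 h -> (forall t, Om (h t)) -> a <= b ->
  bdist (h a) * expR (- fine (itg (qhw h) a b)) <= bdist (h b).
Proof.
move=> hl hO ab; have [m m0 hm] := bdist_lower hl (fun t _ => hO t) ab.
have d0 t : 0 < bdist (h t) by exact: bdist_gt0.
suff : - ln (bdist (h b)) - fine (itg (qhw h) a b) <=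
       - ln (bdist (h a)) - fine (itg (qhw h) a a).
  rewrite itgxx subr0 => hln.
  rewrite -[leRHS]lnK ?posrE// -[X in X * _]lnK ?posrE// -expRD ler_expR.
  by move: hln; move: (ln _) (ln _) (fine _) => *; lra.
apply: (@quadratic_increment_le R
  (fun t => - ln (bdist (h t)) - fine (itg (qhw h) a t)) a b (m^-2 + m^-2)) => //.
move=> s t as_ st tb; rewrite (itg_qhwD hl hO as_ st).
have := @itg_qhw_increment h a b s t m hl hO m0 hm as_ st tb.
have hst : `|bdist (h s) - bdist (h t)| <= t - s.
  apply: le_trans (bdist_lip _ _) _; apply: le_trans (hl _ _) _.
  by rewrite distrC ger0_norm// subr_ge0.
have : ln (bdist (h s)) - ln (bdist (h t)) <= (t - s) / bdist (h t).
  rewrite -ln_div ?posrE//; set q := bdist (h s) / _.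
  have q0 : 0 < q by rewrite divr_gt0.
  have -> : q = 1 + (q - 1) by ring.
  apply: le_trans (le_ln1Dx _) _; first by lra.
  have -> : q - 1 = (bdist (h s) - bdist (h t)) / bdist (h t).
    by rewrite mulrBl divff// gt_eqF.
  rewrite ler_pM2r ?invr_gt0//.
  by move: hst; rewrite ler_norml => /andP[_].
have : (t - s) / bdist (h t) <= (t - s) / bdist (h s) + m^-2 * (t - s) ^+ 2.
  have -> : (t - s) / bdist (h s) + m^-2 * (t - s) ^+ 2 =
    (t - s) * ((bdist (h s))^-1 + m^-2 * (t - s)) by ring.
  rewrite ler_wpM2l ?subr_ge0//; apply: inv_lip => //; apply: hm; apply/andP; split; lra.
have -> : (m^-2 + m^-2) * (t - s) ^+ 2 = m^-2 * (t - s)^+2 + m^-2 * (t - s)^+2 by ring.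
move: (m^-2 * _) ((t - s) / _) ((t - s) / _) (ln _) (ln _) (fine _) (fine _) => *; lra.
Qed.

End boundary_distance.

(** * Limits of paths along ultrafilters, in the internal metric *)

Lemma ultra_compact_cvg (I : Type) (U : set_system I) (T : topologicalType)
    (K : set T) (phi : I -> T) : UltraFilter U -> compact K ->
  (\forall i \near U, K (phi i)) -> exists2 q, K q & phi @ U --> q.
Proof.
move=> UU cK UK.
have ult : UltraFilter (phi @ U).
  constructor; first exact: fmap_proper_filter.
  move=> G GG sub; apply/seteqP; split => [A GA|A]; last exact: sub.
  have [//|UnA] := in_ultra_setVsetC (phi @^-1` A) UU.
  have /filterI/(_ GA) : G (~` A) by apply: sub.
  by rewrite setICl => /filter_ex[].
move: cK; rewrite compact_ultra => /(_ _ ult UK)[q [Kq hq]].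
by exists q.
Qed.

Lemma ultra_bounded_cvg (R : realType) (I : Type) (U : set_system I) (x : I -> R) (a b : R) :
  UltraFilter U -> (forall i, a <= x i <= b) ->
  exists2 l, a <= l <= b & x @ U --> l.
Proof.
move=> UU hx; have [|l /= hl hc] := @ultra_compact_cvg _ U R `[a, b] x UU (@segment_compact _ _ _).
  by apply: nearW => i /=; rewrite in_itv /= hx.
by exists l => //; move: hl; rewrite in_itv.
Qed.

Lemma near_ex_lt (R : realType) (I : Type) (U : set_system I) (x : I -> R) (l e : R) :
  Filter U -> x @ U --> l -> 0 < e -> \forall i \near U, `|l - x i| < e.
Proof. by move=> FU h e0; move/(@cvgrPdist_lt _ R^o): h; exact. Qed.

Lemma mdist_le_internal_dist (R : realType) (X : metricType R) (D : set X) x y :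
  ((mdist x y)%:E <= internal_dist D x y)%E.
Proof.
apply: le_ereal_inf_tmp => _ [c [_ [<- <-]] <-].
by apply: mdist_le_length_on; exact: cstart_le_end.
Qed.

Section internal_space.
Context {R : realType} {X : completeMetricType R}.
Variables (Om : set X) (M : metricType R) (f : M -> X).
Hypotheses (oOm : open Om) (bOm : boundary Om !=set0).
Hypothesis fbij : set_bij [set: M] Om f.
Hypothesis fdist : forall a b, internal_dist Om (f a) (f b) = (mdist a b)%:E.
Hypothesis lcM : locally_compact [set: M].
Local Notation bdist := (bdist Om).

Lemma internal_embed m : Om (f m).
Proof. by case: fbij => + _ _ => /(_ m I). Qed.

Lemma internal_onto x : Om x -> exists m, f m = x.
Proof. by move=> Ox; case: fbij => _ _ /(_ x Ox)[m _ <-]; exists m. Qed.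

Lemma internal_embed_inj m m' : f m = f m' -> m = m'.
Proof. by case: fbij => _ inj _ h; apply: inj; rewrite ?inE. Qed.

Lemma internal_embed_lip m m' : mdist (f m) (f m') <= mdist m m'.
Proof. by rewrite -lee_fin -fdist; exact: mdist_le_internal_dist. Qed.

Lemma internal_embed_lip1 P : lip1 P -> lip1 (fun t => f (P t)).
Proof. by move=> hP s t; apply: le_trans (hP s t); exact: internal_embed_lip. Qed.

Lemma internal_lift_le h a b : lip1 h -> (forall t, Om (h t)) -> a <= b ->
  forall m m', f m = h a -> f m' = h b -> mdist m m' <= b - a.
Proof.
move=> hl hO ab m m' e e'; rewrite -lee_fin -fdist e e'.
exact: internal_dist_lip.
Qed.

(** Each piece of the path is itself a competitor for the internal distance of its ends, so a path
    that is 1-Lipschitz in [X] and stays in [Om] is 1-Lipschitz for the internal metric too. *)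
Lemma internal_lift h : lip1 h -> (forall t, Om (h t)) ->
  exists2 P : R -> M, (forall t, f (P t) = h t) & lip1 P.
Proof.
move=> hl hO; have /choice[P hP] : forall t, exists m, f m = h t.
  by move=> t; exact: internal_onto.
exists P => // s t; wlog st : s t / s <= t.
  by move=> H; have [/H//|/ltW/H] := leP s t; rewrite metric_sym distrC.
rewrite distrC ger0_norm ?subr_ge0//; exact: (internal_lift_le hl hO st).
Qed.

Lemma internal_embed_continuous : continuous f.
Proof.
move=> m; apply/metricType_numDomainType.cvgrPdist_lt => e e0.
apply/nbhs_ballP; exists e => //= m'; rewrite ballEmdist /= => mm.
exact: le_lt_trans (internal_embed_lip _ _) mm.
Qed.

Section ultralimit.
Variables (I : Type) (U : set_system I) (P : I -> R -> M) (x0 : M) (eta : R).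
Hypothesis UU : UltraFilter U.
Hypothesis Plip : forall i, lip1 (P i).
Hypothesis P0 : forall i, P i 0 = x0.
Hypothesis eta0 : 0 < eta.
Hypothesis Peta : forall i s, eta <= bdist (f (P i s)).


Lemma mdist_cvg_le s t (q q' : M) : P^~ s @ U --> q -> P^~ t @ U --> q' ->
  mdist q q' <= `|s - t|.
Proof.
move=> hs ht; apply/ler_addgt0Pr => e e0; have e20 : 0 < e / 2 by rewrite divr_gt0.
have /metricType_numDomainType.cvgrPdist_lt/(_ _ e20) hs' := hs.
have /metricType_numDomainType.cvgrPdist_lt/(_ _ e20) ht' := ht.
have [i [h1 h2]] := filter_ex (filterI hs' ht').
have := metric_triangle q (P i s) q'; have := metric_triangle (P i s) (P i t) q'.
have := Plip i s t; rewrite [mdist (P i t) q']metric_sym.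
by move: h1 h2 => /=; lra.
Qed.

Lemma bdist_cvg_ge s (q : M) : P^~ s @ U --> q -> eta <= bdist (f q).
Proof.
move=> hs; apply/ler_addgt0Pr => e e0.
have /metricType_numDomainType.cvgrPdist_lt/(_ _ e0) hs' := hs.
have [i h1] := filter_ex hs'.
have := bdist_triangle bOm (f (P i s)) (f q); have := Peta i s.
have := internal_embed_lip q (P i s); rewrite [mdist (f (P i s)) _]metric_sym.
by move: h1 => /=; lra.
Qed.

Lemma ultra_cvg_open s (q : M) : P^~ s @ U --> q ->
  exists2 e, 0 < e & forall t, `|s - t| < e -> exists q' : M, P^~ t @ U --> q'.
Proof.
move=> hs; have [K] := lcM (Logic.I : [set: M] q).
rewrite /within /= => nK [cK _].
have /nbhs_ballP[e /= e0 he] : nbhs q K by apply: filterS nK => y; exact.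
have e20 : 0 < e / 2 by rewrite divr_gt0.
exists (e / 2) => // t st.
have [|q' _ hq'] := @ultra_compact_cvg _ U M K (P^~ t) UU cK; last by exists q'.
have /metricType_numDomainType.cvgrPdist_lt/(_ _ e20) hs' := hs.
apply: filterS hs' => i hi; apply: he; rewrite ballEmdist /=.
have := metric_triangle q (P i s) (P i t); have := Plip i s t.
by move: hi => /=; lra.
Qed.

(** Since [M] need not be complete, the limit is found in [X]: the limits at times below [s0] form a
    1-Lipschitz path there, which converges to a point [z]. All its points have boundary distance at
    least [eta], hence so does [z], and [z] lies in [Om]. The path prolonged by [z] bounds the
    internal distance to [z], which turns convergence in [X] into convergence in [M]. *)
Lemma ultra_cvg_closed s0 : 0 < s0 ->
  (forall s, 0 <= s < s0 -> exists q : M, P^~ s @ U --> q) ->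
  exists q : M, P^~ s0 @ U --> q.
Proof.
move=> s00 hs.
have /choice[q hq] : forall s, exists q : M, 0 <= s < s0 -> P^~ s @ U --> q.
  move=> s; have [/hs[q hq]|_] := boolP (0 <= s < s0); first by exists q.
  by exists x0.
pose k t := f (q (Num.max 0 t)).
have max_in t : t < s0 -> 0 <= Num.max 0 t < s0.
  by move=> ts; rewrite le_max lexx gt_max s00.
have klip s t : s < s0 -> t < s0 -> mdist (k s) (k t) <= `|s - t|.
  move=> ss ts; apply: le_trans (internal_embed_lip _ _) _.
  apply: le_trans (mdist_cvg_le (hq _ (max_in _ ss)) (hq _ (max_in _ ts))) _.
  wlog st : s t ss ts / s <= t.
    by move=> H; have [/H|/ltW/H] := leP s t; [exact|rewrite distrC [leRHS]distrC; exact].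
  rewrite distrC [leRHS]distrC !ger0_norm ?subr_ge0//; last first.
    by rewrite ge_max le_max lexx /= le_max st orbT.
  by have [h1|h1] := leP 0 s; have [h2|h2] := leP 0 t; lra.
have /cvg_ex[z hz] : cvg (k @ s0^'-).
  apply: cauchy_cvg; apply: cauchy_exP => e e0.
  exists (k (s0 - e / 2)).
  suff : \forall t \near s0^'-, ball (k (s0 - e / 2)) e (k t) by [].
  near=> t; rewrite ballEmdist /=.
  have ts : t < s0 by near: t; exact: nbhs_left_lt.
  have st : s0 - e / 2 < t.
    by near: t; apply: nbhs_left_gt; rewrite gtrBl divr_gt0.
  apply: le_lt_trans (klip _ _ _ ts) _; first by rewrite gtrBl divr_gt0.
  by rewrite distrC gtr0_norm ?subr_gt0//; lra.
have kz s : s < s0 -> mdist (k s) z <= s0 - s.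
  move=> ss; apply/ler_addgt0Pr => e e0.
  have /metricType_numDomainType.cvgrPdist_lt/(_ _ e0) hz' := hz.
  have hlt : \forall t \near s0^'-, s < t < s0.
    by near=> t; apply/andP; split; near: t; [exact: nbhs_left_gt|exact: nbhs_left_lt].
  have [t [h1 /andP[st ts]]] := filter_ex (filterI hz' hlt).
  have := metric_triangle (k s) (k t) z; have := klip s t ss ts.
  rewrite distrC gtr0_norm ?subr_gt0// [mdist (k t) z]metric_sym.
  by move: h1 => /=; lra.
have etaz : eta <= bdist z.
  apply/ler_addgt0Pr => e e0.
  pose s := s0 - e; have ss : s < s0 by rewrite gtrBl.
  have := bdist_triangle bOm (k s) z; have := kz s ss.
  have := bdist_cvg_ge (hq _ (max_in _ ss)); rewrite -/(k s) /s; lra.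
have Oz : Om z.
  apply: bdist_closure => //; last exact: lt_le_trans etaz.
  move=> B /nbhs_ballP[e /= e0 he]; exists (k (s0 - e / 2)); split.
    exact: internal_embed.
  apply: he; rewrite ballEmdist /= metric_sym.
  apply: le_lt_trans (kz _ _) _; first by rewrite gtrBl divr_gt0.
  by lra.
have [w wz] := internal_onto Oz.
pose h t := if t < s0 then k t else z.
have hl : lip1 h.
  move=> s t; wlog st : s t / s <= t.
    by move=> H; have [/H//|/ltW/H] := leP s t; rewrite metric_sym distrC.
  rewrite /h; case: (ltP s s0) => ss; case: (ltP t s0) => ts.
  - exact: klip.
  - apply: le_trans (kz _ ss) _.
    by rewrite distrC ger0_norm ?subr_ge0// lerD2r.
  - by move: (lt_le_trans ts ss); rewrite ltNge st.
  - by rewrite mdistxx.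
have hO t : Om (h t) by rewrite /h; case: ifPn => // _; exact: internal_embed.
have qw s : 0 <= s -> s < s0 -> mdist (q s) w <= s0 - s.
  move=> s0' ss; apply: (internal_lift_le hl hO (ltW ss)).
    by rewrite /h ss /k max_r.
  by rewrite /h ltxx.
exists w; apply/metricType_numDomainType.cvgrPdist_lt => e e0.
pose s := Num.max 0 (s0 - e / 3).
have ss : s < s0 by rewrite gt_max s00 gtrBl divr_gt0.
have s0' : 0 <= s by rewrite le_max lexx.
have se : s0 - s <= e / 3.
  have : s0 - e / 3 <= s by rewrite le_max lexx orbT.
  by lra.
have e30 : 0 < e / 3 by rewrite divr_gt0.
have hqs : P^~ s @ U --> q s by apply: hq; rewrite s0'.
have /metricType_numDomainType.cvgrPdist_lt/(_ _ e30) hs' := hqs.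
apply: filterS hs' => i hi.
have := metric_triangle w (q s) (P i s0); have := metric_triangle (q s) (P i s) (P i s0).
have := qw s s0' ss; have := Plip i s s0; rewrite [mdist (q s) w]metric_sym.
rewrite distrC gtr0_norm ?subr_gt0//.
by move: hi => /=; lra.
Unshelve. all: by end_near. Qed.

(** Continuous induction on time: the set of good initial times is open by local compactness and
    closed by completeness together with the depth bound. *)
Lemma ultra_cvg_all s : 0 <= s -> exists q : M, P^~ s @ U --> q.
Proof.
move=> s_ge0; apply: contrapT => ns.
pose A := [set t | 0 <= t /\ forall u, 0 <= u <= t -> exists q : M, P^~ u @ U --> q].
have A0 : A 0.
  split => // u u0; exists x0; have -> : u = 0 by apply/eqP; rewrite eq_le andbC.
  rewrite (_ : P^~ 0 = cst x0); first exact: cvg_cst.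
  by apply/funext => i; rewrite P0.
have As : ubound A s.
  move=> t [t0 ht]; rewrite leNgt; apply/negP => st.
  by apply: ns; apply: ht; rewrite s_ge0 ltW.
have hA : has_sup A by split; [exists 0|exists s].
pose s0 := sup A.
have s00 : 0 <= s0 by apply: ub_le_sup => //; exists s.
have lt_s0 u : 0 <= u < s0 -> exists q : M, P^~ u @ U --> q.
  move=> /andP[u0 us]; have [t [t0 ht] ut] := sup_gt hA.1 us.
  by apply: ht; rewrite u0 ltW.
have [q hq] : exists q : M, P^~ s0 @ U --> q.
  move: s00; rewrite le_eqVlt => /predU1P[<-|s00]; last exact: ultra_cvg_closed.
  by apply: A0.2; rewrite lexx.
have [e e0 he] := ultra_cvg_open hq.
suff : s0 + e / 2 <= s0 by rewrite gerDl leNgt divr_gt0.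
apply: ub_le_sup; first by exists s.
split; first by rewrite addr_ge0// ltW// divr_gt0.
move=> u /andP[u0 ue]; have [us|su] := ltP u s0; first by apply: lt_s0; rewrite u0.
by apply: he; rewrite distrC ger0_norm ?subr_ge0//; lra.
Qed.

Lemma ultra_limit : exists H : R -> M,
  [/\ lip1 H, forall s, 0 <= s -> P^~ s @ U --> H s, H 0 = x0 &
      forall s, eta <= bdist (f (H s))].
Proof.
have /choice[q hq] : forall s, exists q : M, 0 <= s -> P^~ s @ U --> q.
  move=> s; have [/ultra_cvg_all[q hq]|_] := boolP (0 <= s); first by exists q.
  by exists x0.
have max_ge t : 0 <= Num.max (0 : R) t by rewrite le_max lexx.
exists (fun s => q (Num.max 0 s)); split.
- move=> s t; apply: le_trans (mdist_cvg_le (hq _ (max_ge _)) (hq _ (max_ge _))) _.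
  wlog st : s t / s <= t.
    by move=> H; have [/H//|/ltW/H] := leP s t; rewrite distrC [leRHS]distrC.
  rewrite distrC [leRHS]distrC !ger0_norm ?subr_ge0//; last by rewrite ge_max le_max lexx /= le_max st orbT.
  by have [h1|h1] := leP 0 s; have [h2|h2] := leP 0 t; lra.
- by move=> s s0; rewrite max_r//; exact: hq.
- rewrite maxxx; have := hq 0 (lexx _).
  rewrite (_ : P^~ 0 = cst x0); last by apply/funext => i; rewrite P0.
  by move=> h; apply: (cvg_unique _ h (cvg_cst _)); exact: metric_hausdorff.
- by move=> s; apply: bdist_cvg_ge (hq _ (max_ge _)).
Qed.

End ultralimit.

End internal_space.

(** * Compact cores and existence of quasihyperbolic geodesics *)

Section qh_geodesics.
Context {R : realType} {X : completeMetricType R}.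
Variables (Om : set X) (M : metricType R) (f : M -> X).
Hypotheses (oOm : open Om) (bOm : boundary Om !=set0).
Hypothesis fbij : set_bij [set: M] Om f.
Hypothesis fdist : forall a b, internal_dist Om (f a) (f b) = (mdist a b)%:E.
Hypothesis lcM : locally_compact [set: M].
Local Notation bdist := (bdist Om).
Local Notation qho := (qhw Om).

Lemma internal_curve x y : Om x -> Om y ->
  exists c, [/\ rectifiable c, trace c `<=` Om & joins c x y].
Proof.
move=> /(internal_onto fbij)[a <-] /(internal_onto fbij)[b <-].
have : (internal_dist Om (f a) (f b) < +oo)%E by rewrite fdist ltey.
by move=> /ereal_inf_lt[_ [c [tc jc] <-] rc]; exists c.
Qed.

(** The whole path, and not only its end point, has to be deep. This gives compactness by passing to
    limits of paths, and later provides the deep curve against which ball separation is applied. *)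
Definition core (x0 : M) (T eta : R) : set M :=
  [set y | exists P : R -> M, [/\ lip1 P, P 0 = x0, P T = y &
    forall s, eta <= bdist (f (P s))]].

Lemma core_compact x0 T eta : 0 <= T -> 0 < eta -> compact (core x0 T eta).
Proof.
move=> T0 eta0; rewrite compact_ultra => U UU UK.
(* Some core point exists, so [x0] itself is deep and the constant path at [x0] is an admissible
   default for points outside the core. *)
have [y1 [P1 [_ P10 _ P1eta]]] := filter_ex UK.
have x0eta : eta <= bdist (f x0) by rewrite -P10.
have /choice[P hP] : forall y, exists P : R -> M, [/\ lip1 P, P 0 = x0,
    core x0 T eta y -> P T = y & forall s, eta <= bdist (f (P s))].
  move=> y; have [[P [? ? ? ?]]|ny] := pselect (core x0 T eta y); first by exists P.
  by exists (fun=> x0); split => //; exact: lip1_const.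
have [|||H [Hl Hcvg H0 Heta]] := @ultra_limit _ _ _ _ f bOm fbij fdist lcM
  M U P x0 eta UU _ _ eta0 _; try by move=> y; case: (hP y).
exists (H T); split; first by exists H.
have h := Hcvg T T0; move=> B /h /= hB.
have hB' : U ((P^~ T) @^-1` B) by [].
have FU : Filter U by exact: ultra_proper.
have h2 : U (core x0 T eta `&` (P^~ T) @^-1` B) by exact: filterI.
suff : U B by [].
apply: filterS h2 => y [Ky /=].
by case: (hP y) => _ _ /(_ Ky) ->.
Qed.

Lemma core_mono x0 T T' eta eta' : T <= T' -> 0 <= T -> eta' <= eta ->
  core x0 T eta `<=` core x0 T' eta'.
Proof.
move=> TT T0 ee y [P [Pl P0 PT Pe]]; exists (fun t => P (Num.min t T)); split.
- move=> s t; apply: le_trans (Pl _ _) _; wlog st : s t / s <= t.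
    by move=> H; have [/H//|/ltW/H] := leP s t; rewrite distrC [leRHS]distrC.
  rewrite distrC [leRHS]distrC !ger0_norm ?subr_ge0//.
    by have [h1|h1] := leP s T; have [h2|h2] := leP t T; lra.
  by rewrite le_min !ge_min st lexx orbT.
- by rewrite min_l.
- by rewrite min_r.
- by move=> s; apply: le_trans ee _.
Qed.

Lemma core_cover x0 y : exists n : nat, core x0 n%:R n.+1%:R^-1 y.
Proof.
have [c [rc tc [c0 c1]]] := internal_curve (internal_embed fbij x0) (internal_embed fbij y).
have ul := unit_param_lip rc.
have uO t : Om (unit_param c t) by apply/tc/unit_param_trace.
have [P fP Pl] := internal_lift fbij fdist ul uO.
have L0 : 0 <= fine (clength c) := fine_clength_ge0 _.
have [m m0 hm] := bdist_lower oOm bOm ul (fun t _ => uO t) L0.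
set L := fine (clength c) in L0 hm.
have hm' t : m <= bdist (unit_param c t).
  have /(unit_param_onto rc)[s hs <-] := unit_param_trace rc t; exact: hm.
pose n := (Num.Def.truncn (L + m^-1)).+1.
have hn : L + m^-1 < n%:R by rewrite truncnS_gt.
have mi0 : 0 < m^-1 by rewrite invr_gt0.
exists n; apply: (@core_mono x0 L n%:R m) => //.
- by lra.
- rewrite invf_ple ?posrE// -natr1; lra.
exists P; split => //.
- apply: (internal_embed_inj fbij); rewrite fP -c0; exact: unit_param0.
- apply: (internal_embed_inj fbij); rewrite fP -c1; exact: unit_paramL.
- by move=> s; rewrite fP.
Qed.

Lemma qh_dist_fin x y : Om x -> Om y -> qh_dist Om x y \is a fin_num.
Proof.
move=> Ox Oy; rewrite ge0_fin_numE.
  have [c [rc tc jc]] := internal_curve Ox Oy.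
  apply: (@le_lt_trans _ _ (qh_length Om c)).
    by apply: ereal_inf_lbound; exists c.
  rewrite qh_lengthE// -ge0_fin_numE; last by apply: itg_ge0 => t; exact: qhw_ge0.
  apply: itg_qhw_fin => //; first exact: unit_param_lip.
    by move=> t; apply/tc/unit_param_trace.
  exact: fine_clength_ge0.
apply: le_ereal_inf_tmp => _ [c [rc tc _] <-]; rewrite qh_lengthE//.
by apply: itg_ge0 => t; exact: qhw_ge0.
Qed.

Lemma qh_dist_le_itg (h : R -> X) a b : lip1 h -> (forall t, Om (h t)) -> a <= b ->
  (qh_dist Om (h a) (h b) <= itg (qho h) a b)%E.
Proof.
move=> hl hO ab; apply: le_trans (qh_length_lip_curve oOm bOm hl ab hO).
apply: ereal_inf_lbound; exists (lip_curve hl ab) => //; split => //.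
- exact: lip_curve_rectifiable.
- by move=> z /lip_curve_trace[t _ ->].
Qed.

Lemma qh_length_unit_speed (h : R -> X) (hl : lip1 h) s t (st : s <= t) :
  (forall t, Om (h t)) ->
  (forall u, s <= u <= t -> length_on h s u = (u - s)%:E) ->
  qh_length Om (lip_curve hl st) = itg (qho h) s t.
Proof.
move=> hO sp; have e u : ((edist_inf (boundary Om) (h u))^-1 = qho h u)%E.
  by rewrite bdistE// inver gt_eqF// bdist_gt0.
rewrite /qh_length line_integral_lip_curve//.
- by apply: eq_itg => u _; exact: e.
- by under eq_fun do rewrite e; exact: qhw_measurable.
- by move=> u; rewrite e qhw_ge0.
Qed.

(** Replacing the subarc by a competitor gives a curve from [x] to [y], which cannot be
    quasihyperbolically shorter than [G]; the two outer pieces are common to both and of finite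
    length, so they cancel. *)
Lemma qh_geodesic_subarc x y G (rc : rectifiable G) s t (st : s <= t) :
  qh_geodesic Om x y G -> 0 <= s -> t <= fine (clength G) ->
  qh_geodesic Om (unit_param G s) (unit_param G t)
    (lip_curve (unit_param_lip rc) st).
Proof.
move=> [_ tG [G0 G1] Gmin] s0 tL; set h := unit_param G.
have hl : lip1 h := unit_param_lip rc.
have hO u : Om (h u) by apply/tG/unit_param_trace.
set L := fine (clength G) in tL.
split => //; first exact: lip_curve_rectifiable.
  by move=> z /lip_curve_trace[u _ ->].
have sp u : s <= u <= t -> length_on h s u = (u - s)%:E.
  move=> /andP[su ut]; apply: unit_param_speed => //; exact: le_trans tL.
apply/eqP; rewrite eq_le; apply/andP; split; last first.
  apply: ereal_inf_lbound; exists (lip_curve (unit_param_lip rc) st) => //; split => //.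
    exact: lip_curve_rectifiable.
  by move=> z /lip_curve_trace[u _ ->].
rewrite qh_length_unit_speed//.
apply: le_ereal_inf_tmp => _ [c [rc' tc [c0 c1]] <-].
rewrite (qh_lengthE oOm bOm rc' tc).
set h' := unit_param c; set L' := fine (clength c).
have L'0 : 0 <= L' := fine_clength_ge0 _.
have hl' : lip1 h' := unit_param_lip rc'.
have hO' u : Om (h' u) by apply/tc/unit_param_trace.
have h'0 : h' 0 = h s by rewrite /h' unit_param0.
have h'L : h' L' = h t by rewrite /h' unit_paramL.
(* [k] follows the geodesic up to [s], then the competitor shifted to start at [s], then the rest of
   the geodesic shifted to start at [s + L']. *)
pose k1 := glue s h (fun u => h' (- s + u)).
have k1l : lip1 k1.
  by apply: lip1_glue; [|exact: lip1_shift|rewrite addNr h'0].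
have k1s u : s <= u -> k1 u = h' (- s + u).
  move=> su; rewrite /k1 /glue; case: (leP u s) => // us.
  by have -> : u = s; [apply/eqP; rewrite eq_le us|rewrite addNr].
pose k2 u := h ((t - (s + L')) + u).
pose k := glue (s + L') k1 k2.
have e12 : k1 (s + L') = k2 (s + L').
  rewrite k1s ?lerDl// (_ : - s + (s + L') = L'); last by ring.
  by rewrite h'L /k2; congr h; ring.
have kl : lip1 k by apply: lip1_glue => //; exact: lip1_shift.
have kO u : Om (k u).
  rewrite /k /glue; case: (u <= _); last exact: hO.
  by rewrite /k1 /glue; case: (u <= _); [exact: hO|exact: hO'].
have k_2 u : s + L' <= u -> k u = k2 u.
  move=> su; rewrite /k /glue; case: (leP u (s + L')) => // us.
  by have -> : u = s + L'; first by apply/eqP; rewrite eq_le us.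
pose T := s + L' + (L - t).
have sL : s <= s + L' by rewrite lerDl.
have LT : s + L' <= T by rewrite lerDl subr_ge0.
have := qh_dist_le_itg kl kO (le_trans s0 (le_trans sL LT)).
have -> : k 0 = x.
  rewrite /k /glue (le_trans s0 sL) /k1 /glue s0 /h unit_param0 //.
have -> : k T = y.
  by rewrite k_2// /k2 -G1 -unit_paramL// -/L; congr h; rewrite /T; ring.
rewrite -Gmin (qh_lengthE oOm bOm rc tG) -/h -/L.
have mh := qhw_measurable oOm bOm hl hO; have mk := qhw_measurable oOm bOm kl kO.
have h0 u : (0 <= qho h u)%E by exact: qhw_ge0.
have k0 u : (0 <= qho k u)%E by exact: qhw_ge0.
rewrite (itg_cat mh h0 s0 (le_trans st tL)) (itg_cat mh h0 st tL).
rewrite (itg_cat mk k0 s0 (le_trans sL LT)) (itg_cat mk k0 sL LT).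
have -> : itg (qho k) 0 s = itg (qho h) 0 s.
  apply: eq_itg => u /andP[_ us]; rewrite /qhw.
  by rewrite /k /glue (le_trans us sL) /k1 /glue us.
have mh' := qhw_measurable oOm bOm hl' hO'.
have h'_ge0 u : (0 <= qho h' u)%E by exact: qhw_ge0.
have -> : itg (qho k) s (s + L') = itg (qho h') 0 L'.
  have e : - s + (s + L') = L' by ring.
  rewrite -{2}e -(addNr s) -(itg_shift (- s) s (s + L') mh' h'_ge0).
  apply: eq_itg => u /andP[su us].
  by rewrite /qhw /k /glue us k1s.
have -> : itg (qho k) (s + L') T = itg (qho h) t L.
  have e1 : t - (s + L') + (s + L') = t by ring.
  have e2 : t - (s + L') + T = L by rewrite /T; ring.
  transitivity (itg (qho h) (t - (s + L') + (s + L')) (t - (s + L') + T)); last by rewrite e1 e2.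
  rewrite -(itg_shift _ _ _ mh h0); apply: eq_itg => u /andP[su us].
  by rewrite /qhw k_2.
have f1 : itg (qho h) 0 s \is a fin_num by exact: itg_qhw_fin.
have f3 : itg (qho h) t L \is a fin_num by exact: itg_qhw_fin.
by rewrite (leeD2lE _ _ f1) (leeD2rE _ _ f3).
Qed.

Hypothesis Dm : R.
Hypothesis hDm : forall x, Om x -> bdist x <= Dm.

(* Minimizing curves of bounded length, parametrized by arc length, converge
   pointwise along an ultrafilter; the accumulated quasihyperbolic lengths converge
   too and control the quasihyperbolic length of the limit. *)
Lemma qh_geodesic_exists x y : Om x -> Om y -> exists G, qh_geodesic Om x y G.
Proof.
move=> Ox Oy; have kfin := qh_dist_fin Ox Oy.
set k := qh_dist Om x y in kfin.
have Dm0 : 0 < Dm by apply: lt_le_trans (hDm Ox); exact: bdist_gt0.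
have /choice[c hc] : forall n : nat, exists c : curve X,
    [/\ rectifiable c, trace c `<=` Om, joins c x y &
        (qh_length Om c < k + n.+1%:R^-1%:E)%E].
  move=> n; have n0 : 0 < n.+1%:R^-1 :> R by rewrite invr_gt0.
  have [_ [c [rc tc jc] <-] hlt] := lb_ereal_inf_adherent n0 kfin.
  by exists c.
have rc n : rectifiable (c n) by case: (hc n).
pose h n := unit_param (c n); pose L n := fine (clength (c n)).
have hl n : lip1 (h n) := unit_param_lip (rc n).
have hO n t : Om (h n t) by case: (hc n) => ? tc _ _; apply/tc/unit_param_trace.
have L0 n : 0 <= L n by exact: fine_clength_ge0.
have hfin n s t : s <= t -> itg (qho (h n)) s t \is a fin_num by exact: itg_qhw_fin.
have htot n : fine (itg (qho (h n)) 0 (L n)) < fine k + n.+1%:R^-1.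
  case: (hc n) => ? tc _; rewrite qh_lengthE// -/(h n) -/(L n) -(fineK (hfin n _ _ (L0 n))).
  by rewrite -(fineK kfin) -EFinD lte_fin.
have hpos n s t : 0 <= fine (itg (qho (h n)) s t).
  by rewrite fine_ge0// itg_ge0// => u; exact: qhw_ge0.
have k0 : 0 <= fine k.
  by rewrite fine_ge0//; apply: le_ereal_inf_tmp => _ [? [? ? _] <-];
    rewrite qh_lengthE//; apply: itg_ge0 => u; exact: qhw_ge0.
have htot1 n : fine (itg (qho (h n)) 0 (L n)) <= fine k + 1.
  apply/ltW/(lt_le_trans (htot n)); rewrite lerD2l invf_le1// ler1n//.
have h0 n : h n 0 = x by case: (hc n) => ? ? [<- _] _; exact: unit_param0.
have hL n : h n (L n) = y by case: (hc n) => ? ? [_ <-] _; exact: unit_paramL.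
(* Depth of all points of all the curves, from the exponential decay bound and total quasihyperbolic
   length at most [fine k + 1]. *)
pose eta := bdist x * expR (- (fine k + 1)).
have eta0 : 0 < eta by rewrite mulr_gt0 ?expR_gt0// bdist_gt0.
have heta n t : eta <= bdist (h n t).
  have [s /andP[s0 sL] <-] : exists2 s, 0 <= s <= L n & h n s = h n t.
    exact/unit_param_onto/unit_param_trace.
  apply: le_trans (bdist_exp_lower oOm bOm (hl n) (hO n) s0).
  rewrite h0 ler_wpM2l ?bdist_ge0// ler_expR lerN2; apply: le_trans (htot1 n).
  by rewrite (itg_qhwD oOm bOm (hl n) (hO n) s0 sL) lerDl.
(* The weight is at least [1 / Dm] on [Om], so bounded quasihyperbolic length bounds the metric
   length. *)
have Lle n : 0 <= L n <= Dm * (fine k + 1).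
  rewrite L0/=.
  have [|h1 _] := @itg_qhw_bounds _ _ Om oOm bOm (h n) 0 (L n) Dm^-1 eta^-1 (hl n) (hO n) (L0 n).
    move=> u _; apply/andP; split; rewrite lef_pV2 ?posrE ?bdist_gt0//; exact: hDm.
  move: h1; rewrite subr0 -(fineK (hfin n _ _ (L0 n))) lee_fin mulrC ler_pdivrMr// => h1.
  by apply: le_trans h1 _; rewrite mulrC ler_wpM2l// ltW.
have /choice[P hP] : forall n, exists P : R -> M, (forall t, f (P t) = h n t) /\ lip1 P.
  by move=> n; have [P ? ?] := internal_lift fbij fdist (hl n) (hO n); exists P.
have [x' fx] := internal_onto fbij Ox; have [y' fy] := internal_onto fbij Oy.
have [U [UU Uoo]] := @ultraFilterLemma nat \oo _.
have FU : ProperFilter U by exact: ultra_proper.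
have [H [Hl Hcvg H0 Heta]] := @ultra_limit _ _ _ _ f bOm fbij fdist lcM
    nat U P x' eta UU (fun n => (hP n).2)
    (fun n => internal_embed_inj fbij (etrans ((hP n).1 0) (etrans (h0 n) (esym fx))))
    eta0 (fun n s => eq_ind_r (fun z => eta <= bdist z) (heta n s) ((hP n).1 s)).
have [Ls /andP[Ls0 _] Lcvg] := @ultra_bounded_cvg R nat U L 0 _ UU Lle.
have HLs : H Ls = y'.
  apply: mdist_positivity; apply/eqP; rewrite eq_le mdist_ge0 andbT.
  apply/ler_addgt0Pr => e e0; rewrite add0r.
  have e20 : 0 < e / 2 by rewrite divr_gt0.
  have /metricType_numDomainType.cvgrPdist_lt/(_ _ e20) h1 := Hcvg Ls Ls0.
  have h2 := near_ex_lt FU Lcvg e20.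
  have [n [/= h1n h2n]] := filter_ex (filterI h1 h2).
  have <- : P n (L n) = y' by apply: (internal_embed_inj fbij); rewrite (hP n).1 hL.
  have := metric_triangle (H Ls) (P n Ls) (P n (L n)); have := (hP n).2 Ls (L n).
  by lra.
pose hH t := f (H t).
have hHl : lip1 hH := internal_embed_lip1 fdist Hl.
have hHO t : Om (hH t) := internal_embed fbij _.
pose E n t := fine (itg (qho (h n)) 0 t).
have Ebound n t : 0 <= t -> 0 <= E n t <= eta^-1 * t.
  move=> t0; rewrite hpos/=.
  have [|_ h2] := @itg_qhw_bounds _ _ Om oOm bOm (h n) 0 t 0 eta^-1 (hl n) (hO n) t0.
    move=> u _; rewrite invr_ge0 bdist_ge0/= lef_pV2 ?posrE ?bdist_gt0//.
  by rewrite -lee_fin fineK ?hfin//; move: h2; rewrite subr0.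
have /choice[e he] : forall t : R, exists l : R, 0 <= t -> E^~ t @ U --> l.
  move=> t; have [t0|_] := boolP (0 <= t); last by exists 0.
  by have [l _ hlc] := @ultra_bounded_cvg R nat U (E^~ t) 0 _ UU (fun n => Ebound n t t0); exists l.
have key : (qh_length Om (lip_curve hHl Ls0) <= (e Ls - e 0)%:E)%E.
  apply: (@qh_length_lip_curve_le _ _ Om oOm bOm hH hHl 0 Ls Ls0 e (eta^-2)) => //.
  move=> s t s0 st _; apply/ler_addgt0Pr => d d0.
  have t0 : 0 <= t := le_trans s0 st.
  (* Chosen so that moving the base point by [d1] changes [(t - s) / bdist] by at most [d / 3]. *)
  pose d1 := d / 3 / (1 + eta^-2 * (t - s)).
  have den0 : 0 < 1 + eta^-2 * (t - s).
    by rewrite ltr_pwDl// mulr_ge0 ?subr_ge0// invr_ge0 sqr_ge0.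
  have d30 : 0 < d / 3 by rewrite divr_gt0.
  have d10 : 0 < d1 by rewrite divr_gt0.
  have /metricType_numDomainType.cvgrPdist_lt/(_ _ d10) a1 := Hcvg s s0.
  have a2 := near_ex_lt FU (he s s0) d30; have a3 := near_ex_lt FU (he t t0) d30.
  have [n [[/= b1 b2] b3]] := filter_ex (filterI (filterI a1 a2) a3).
  have := @itg_qhw_increment _ _ Om oOm bOm (h n) 0 t s t eta (hl n) (hO n) eta0
    (fun u _ => heta n u) s0 st (lexx _).
  have -> : fine (itg (qho (h n)) s t) = E n t - E n s.
    by rewrite /E (itg_qhwD oOm bOm (hl n) (hO n) s0 st) addrAC subrr add0r.
  have : (bdist (hH s))^-1 <= (bdist (h n s))^-1 + eta^-2 * d1.
    apply: inv_lip => //; first exact: Heta.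
    apply: le_trans (bdist_lip bOm _ _) _; rewrite -(hP n).1 metric_sym.
    by apply: le_trans (internal_embed_lip fdist _ _) _; exact: ltW.
  move=> c1 c2.
  have : (t - s) / bdist (hH s) <= (t - s) / bdist (h n s) + d / 3.
    apply: (@le_trans _ _ ((t - s) * ((bdist (h n s))^-1 + eta^-2 * d1))).
      by rewrite ler_wpM2l// subr_ge0.
    rewrite mulrDr lerD2l /d1.
    have -> : (t - s) * (eta^-2 * (d / 3 / (1 + eta^-2 * (t - s)))) =
       d / 3 * ((eta^-2 * (t - s)) / (1 + eta^-2 * (t - s))) by ring.
    rewrite ger_pMr// ler_pdivrMr// mul1r; lra.
  move: c2 b2 b3; rewrite !ltr_norml => c2 /andP[? ?] /andP[? ?].
  by move: c2; move: (_ / bdist _) (_ / bdist _) (eta^-2 * _) => *; lra.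
exists (lip_curve hHl Ls0); split.
- exact: lip_curve_rectifiable.
- by move=> z /lip_curve_trace[t _ ->].
- by split; rewrite /= /hH ?H0 ?HLs.
apply/eqP; rewrite eq_le; apply/andP; split; last first.
  apply: ereal_inf_lbound; exists (lip_curve hHl Ls0) => //; split.
  - exact: lip_curve_rectifiable.
  - by move=> z /lip_curve_trace[t _ ->].
  - by split; rewrite /= /hH ?H0 ?HLs.
apply: le_trans key _; rewrite -/k -(fineK kfin) lee_fin.
apply/ler_addgt0Pr => d d0.
have d40 : 0 < d / 4 by rewrite divr_gt0.
(* If [Ls] exceeds [L n], the surplus piece costs at most [(Ls - L n) / eta], which this threshold
   keeps below [d / 4]. *)
have de0 : 0 < d / 4 * eta by rewrite mulr_gt0.
have a1 := near_ex_lt FU (he Ls Ls0) d40; have a2 := near_ex_lt FU (he 0 (lexx _)) d40.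
have a3 := near_ex_lt FU Lcvg de0.
have a4 : \forall n \near U, n.+1%:R^-1 < d / 4.
  apply: Uoo; near=> n; rewrite invf_plt ?posrE//.
  apply: lt_trans (_ : n%:R < _); last by rewrite ltr_nat.
  by near: n; exact: nbhs_infty_gtr.
have [n [[[/= b1 b2] b3] b4]] := filter_ex (filterI (filterI (filterI a1 a2) a3) a4).
have E0 : E n 0 = 0 by rewrite /E itgxx.
have ELs : E n Ls <= fine (itg (qho (h n)) 0 (L n)) + d / 4.
  have [LsL|/ltW LLs] := leP Ls (L n).
    by rewrite (itg_qhwD oOm bOm (hl n) (hO n) Ls0 LsL) -/(E n Ls) -addrA lerDl addr_ge0// ltW.
  rewrite /E (itg_qhwD oOm bOm (hl n) (hO n) (L0 n) LLs) lerD2l.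
  have [|_ h2] := @itg_qhw_bounds _ _ Om oOm bOm (h n) (L n) Ls 0 eta^-1 (hl n) (hO n) LLs.
    move=> u _; rewrite invr_ge0 bdist_ge0/= lef_pV2 ?posrE ?bdist_gt0//.
  move: h2; rewrite -(fineK (hfin n _ _ LLs)) lee_fin => h2; apply: le_trans h2 _.
  rewrite mulrC ler_pdivrMr//; move: b3; rewrite ltr_norml => /andP[_]; lra.
have := htot n; move: b1 b2; rewrite E0 !ltr_norml => /andP[? ?] /andP[? ?].
by move: ELs b4; move: (fine (itg _ _ _)) (fine k) (n.+1%:R^-1) => *; lra.
Unshelve. all: by end_near. Qed.

End qh_geodesics.

(** * Chaining along a quasihyperbolic geodesic *)

Section layer_cake.
Local Open Scope ereal_scope.
Context {d} {T : measurableType d} {R : realType} (mu : {measure set T -> \bar R}).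
Variables (n : nat) (A : 'I_n -> set T) (r : 'I_n -> R) (K : R).
Hypotheses (mA : forall i, measurable (A i)) (A0 : forall i, A i !=set0).
Hypotheses (r0 : forall i, (0 <= r i)%R) (K0 : (0 <= K)%R).
Hypothesis overlap : forall j,
  (\sum_(i | `[< A i `&` A j !=set0 >] && (r i <= r j)) r i)%R%:E <= K%:E * mu (A j).

Let U (J : {set 'I_n}) : set T := \big[setU/set0]_(i in J) A i.

Let mU J : measurable (U J).
Proof. by apply: bigsetU_measurable. Qed.

Let UP J t : U J t <-> exists2 i, i \in J & A i t.
Proof.
rewrite /U big_mkcond; split.
  rewrite -bigcup_seq => -[i /= _]; case: ifPn => // iJ At.
  by exists i.
move=> [i iJ At]; rewrite -bigcup_seq; exists i => /=; first by rewrite mem_index_enum.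
by rewrite iJ.
Qed.

(** Greedy selection in the manner of Vitali: take an index of largest [r], charge all indices whose
    sets meet [A j] to [A j] by [overlap], and recurse on the remaining ones, whose sets are
    disjoint from [A j]. *)
Lemma sum_radii_le_union (J : {set 'I_n}) :
  (\sum_(i in J) r i)%R%:E <= K%:E * mu (U J).
Proof.
elim: {J}#|J| {-2}J (leqnn #|J|) => [|k IH] J Jk.
  have -> : J = finset.set0 by apply/eqP; rewrite -cards_eq0 -leqn0.
  by rewrite big_set0 mule_ge0.
have [->|/set0Pn[j0 j0J]] := eqVneq J finset.set0.
  by rewrite big_set0 mule_ge0.
pose j := [arg max_(i > j0 in J) r i]%O.
have [jJ jmax] : j \in J /\ (forall i, i \in J -> (r i <= r j)%R).
  by rewrite /j; case: arg_maxP => //.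
pose J' := [set i in J | ~~ `[< A i `&` A j !=set0 >]]%SET.
have J'J : J' \subset J by apply/fintype.subsetP => i; rewrite inE => /andP[].
have J'k : (#|J'| <= k)%N.
  rewrite -ltnS; apply: leq_trans Jk; apply: proper_card; apply/fintype.properP; split => //.
  exists j => //; rewrite inE jJ /= negbK; apply/asboolP; rewrite setIid; exact: A0.
rewrite (bigID (fun i => `[< A i `&` A j !=set0 >])) /= EFinD.
apply: (@le_trans _ _ (K%:E * mu (A j) + K%:E * mu (U J'))).
  apply: leeD.
    apply: le_trans (overlap j); rewrite lee_fin big_mkcond [leRHS]big_mkcond /=.
    apply: ler_sum => i _; case: (boolP (i \in J)) => iJ /=; last by case: ifP.
    by rewrite jmax// andbT.
  apply: le_trans (IH _ J'k); rewrite lee_fin le_eqVlt; apply/orP; left; apply/eqP.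
  by apply: eq_bigl => i; rewrite inE.
rewrite -ge0_muleDr// -measureU//; last first.
  apply/seteqP; split => // t [At] /UP[i]; rewrite inE => /andP[_ /asboolP h] Ait.
  by apply: h; exists t.
rewrite lee_wpmul2l ?lee_fin//; apply: le_measure; rewrite ?inE//; first exact: measurableU.
move=> t [At|/UP[i iJ' At]]; apply/UP; first by exists j.
by exists i => //; apply: (fintype.subsetP J'J).
Qed.

(* Layer cake: subtract the least positive height on the union of all the sets. *)
Lemma layer_cake_le (D : set T) (a : 'I_n -> R) (phi : T -> R) :
  measurable D -> (forall i, A i `<=` D) ->
  measurable_fun D phi -> (forall t, D t -> (0 <= phi t)%R) ->
  (forall i, (0 <= a i)%R) -> (forall i t, A i t -> (a i <= phi t)%R) ->
  (\sum_i r i * a i)%R%:E <= K%:E * \int[mu]_(t in D) (phi t)%:E.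
Proof.
move=> mD AD; elim: {a}#|[set i | (0 < a i)%R]%SET| {-2}a (leqnn #|[set i | (0 < a i)%R]%SET|) phi
  => [|k IH] a ak phi mphi phi0 a0 aphi.
  rewrite big1 ?mule_ge0 ?integral_ge0// => i _.
  have /eqP : [set i | (0 < a i)%R]%SET == finset.set0 by rewrite -cards_eq0 -leqn0.
  move/setP/(_ i); rewrite !inE lt_neqAle a0 andbT => /negbFE/eqP <-.
  by rewrite mulr0.
set J := [set i | (0 < a i)%R]%SET in ak.
have [J0|/set0Pn[j0 j0J]] := eqVneq J finset.set0.
  apply: IH => //; by rewrite -/J J0 cards0.
pose j := [arg min_(i < j0 in J) a i]%O.
have [jJ jmin] : j \in J /\ (forall i, i \in J -> (a j <= a i)%R).
  by rewrite /j; case: arg_minP.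
set t0 := a j.
have t00 : (0 < t0)%R by move: jJ; rewrite inE.
pose a' i := (a i - (if i \in J then t0 else 0))%R.
pose phi' t := (phi t - t0 * \1_(U J) t)%R.
have aE i : i \notin J -> a i = 0%R.
  by rewrite inE -leNgt => h; apply/eqP; rewrite eq_le h a0.
have a'0 i : (0 <= a' i)%R.
  by rewrite /a'; case: ifPn => iJ; rewrite ?subr0// subr_ge0 jmin.
have mphi' : measurable_fun D phi'.
  by apply: measurable_funB => //; apply: measurable_funM.
have phi'0 t : D t -> (0 <= phi' t)%R.
  move=> Dt; rewrite /phi' indicE; case: (boolP (t \in U J)) => h /=.
    rewrite mulr1 subr_ge0; move: h => /set_mem /UP[i iJ Ait].
    by apply: le_trans (jmin _ iJ) _; exact: aphi.
  by rewrite mulr0 subr0 phi0.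
have := IH a' _ phi' mphi' phi'0 a'0.
have -> : (\sum_i r i * a i = \sum_i r i * a' i + t0 * \sum_(i in J) r i)%R.
  rewrite mulr_sumr [in RHS](big_mkcond (mem J)) /= -big_split /=.
  by apply: eq_bigr => i _; rewrite /a'; case: ifPn => _; ring.
have -> : \int[mu]_(t in D) (phi t)%:E =
    \int[mu]_(t in D) (phi' t)%:E + t0%:E * mu (U J).
  have -> : \int[mu]_(t in D) (phi t)%:E =
      \int[mu]_(t in D) ((phi' t)%:E + (t0 * \1_(U J) t)%:E).
    by apply: eq_integral => t _; rewrite -EFinD /phi' subrK.
  rewrite ge0_integralD//=.
  - congr (_ + _); under eq_integral do rewrite EFinM.
    rewrite ge0_integralZl//=; last by rewrite lee_fin ltW.
    + rewrite integral_indic//=; congr (_ * mu _); apply: setIidl.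
      by move=> t /UP[i _ /AD].
    + exact/measurable_EFinP.
  - exact/measurable_EFinP.
  - by move=> t _; rewrite lee_fin mulr_ge0// ltW.
  - by apply/measurable_EFinP; exact: measurable_funM.
move=> h; rewrite EFinD EFinM ge0_muleDr; last 2 first.
- by apply: integral_ge0 => t Dt; rewrite lee_fin phi'0.
- by rewrite mule_ge0// lee_fin ltW.
apply: leeD.
  apply: h.
    rewrite -ltnS; apply: leq_trans ak; apply: proper_card; apply/fintype.properP; split.
      apply/fintype.subsetP => i; rewrite !inE /a'; case: ifPn => iJ; rewrite ?subr0// => _.
      by move: iJ; rewrite inE.
    by exists j => //; rewrite inE /a' jJ subrr ltxx.
  move=> i t Ait; rewrite /a' /phi' indicE.
  case: ifPn => iJ.
    have Ut : t \in U J by apply/mem_set/UP; exists i.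
    by rewrite Ut mulr1 lerD2r aphi.
  by rewrite subr0 aE// -indicE; apply: phi'0; exact: AD Ait.
rewrite muleCA lee_wpmul2l ?lee_fin ?(ltW t00)//; exact: sum_radii_le_union.
Qed.

End layer_cake.

(** Truncating [t] to the range from [t lo] to [t hi.+1] changes none of the selected increments,
    keeps the others nonnegative, and lets the full sum telescope. *)
Lemma sum_steps_le (R : realType) (t : nat -> R) (N lo hi : nat) (Q : pred 'I_N) :
  {homo t : i j / (i <= j)%N >-> i <= j} ->
  (forall i, Q i -> (lo <= i <= hi)%N) -> (lo <= hi)%N ->
  \sum_(i | Q i) (t i.+1 - t i) <= t hi.+1 - t lo.
Proof.
move=> tm hQ lohi; pose u i := Num.max (t lo) (Num.min (t i) (t hi.+1)).
have ulo i : t lo <= u i by rewrite le_max lexx.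
have uhi i : u i <= t hi.+1 by rewrite ge_max ge_min lexx orbT andbT tm// leqW.
apply: (@le_trans _ _ (\sum_(i < N) (u i.+1 - u i))).
  rewrite big_mkcond; apply: ler_sum => i _; case: ifPn => [/hQ/andP[li ih]|_].
    rewrite /u !min_l ?tm// ?ltnS// ?(leq_trans ih)// !max_r ?tm//.
    exact: leqW.
  rewrite subr_ge0 /u ge_max le_max lexx /= le_max le_min !ge_min lexx orbT.
  by rewrite (tm _ _ (leqnSn i)) /= orbT.
rewrite -(big_mkord predT (fun i => u i.+1 - u i)) telescope_sumr//.
by have := ulo 0%N; have := uhi N; lra.
Qed.

Section chain.
Context {R : realType} {X : completeMetricType R}.
Variables (Om : set X) (M : metricType R) (f : M -> X) (C : R).
Hypotheses (oOm : open Om) (bOm : boundary Om !=set0).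
Hypothesis fbij : set_bij [set: M] Om f.
Hypothesis fdist : forall a b, internal_dist Om (f a) (f b) = (mdist a b)%:E.
Hypothesis geo : forall x y, Om x -> Om y -> exists G, qh_geodesic Om x y G.
Hypotheses (C1 : 1 <= C) (sepOm : ball_separation C Om) (ghOm : gehring_hayman C Om).
Local Notation bdist := (bdist Om).

Lemma ball_separation_lip x y G z (h : R -> X) a b : qh_geodesic Om x y G ->
  Om x -> Om y -> trace G z -> lip1 h -> (forall t, Om (h t)) -> a <= b ->
  h a = x -> h b = y ->
  exists2 s, a <= s <= b & (internal_dist Om z (h s) < (C * bdist z)%:E)%E.
Proof.
move=> hG Ox Oy Gz hl hO ab ha hb.
have [||w [[Ow]]] := sepOm Ox Oy hG Gz (c := lip_curve hl ab).
- by move=> v /lip_curve_trace[t _ ->].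
- by [].
rewrite bdistE// -EFinM => hw /lip_curve_trace[s hs e].
by exists s => //; rewrite -e.
Qed.

Variables (c3 eta tau : R) (y y' : X) (h k : R -> X) (a b : R) (A m : X -> R) (rho : R -> R).
Hypotheses (c30 : 0 < c3) (c31 : c3 <= 1) (eta0 : 0 < eta) (tau0 : 0 <= tau).
Hypotheses (hl : lip1 h) (hO : forall t, Om (h t)) (h0 : h 0 = y) (htau : h tau = y').
Hypotheses (kl : lip1 k) (kO : forall t, Om (k t)) (ka : k a = y) (kb : k b = y').
Hypotheses (ab : a <= b) (keta : forall t, eta <= bdist (k t)).
Hypothesis far : c3 * bdist y < mdist y y'.
Hypothesis A0 : forall z, 0 <= A z.
Hypothesis Arho : forall z t, Om z -> eta / (1 + C) <= bdist z ->
  mdist (h t) z < 2 * C * bdist z -> A z <= rho t.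
Hypotheses (mrho : measurable_fun setT rho) (rho0 : forall t, 0 <= rho t).
Hypothesis mA : forall z z', Om z -> Om z' -> mdist z z' <= c3 * bdist z ->
  `|m z - m z'| <= bdist z * A z.

(** Small enough that an interval of length [kap * r i] is at most half of [[0, tau]], given that
    every chain radius is at most [(c3^-1 + C) * tau]. *)
Let kap := (2 * (c3^-1 + C))^-1.

(** Chain points whose intervals meet the [j]-th one, with smaller radius, lie on an arc of length
    at most [C * (6 * C * r j)]; the last step adds [c3 * r j]. Dividing by [c3] passes from steps
    to radii, dividing by [kap] from [r j] to the length of the [j]-th interval. *)
Definition chain_constant := (6 * C ^+ 2 + c3) / c3 / kap.

Lemma chain_estimate :
  (`|m y - m y'|%:E <= chain_constant%:E * itg (EFin \o rho) 0 tau)%E.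
Proof.
have Oy : Om y by rewrite -h0. have Oy' : Om y' by rewrite -htau.
have [G hG] := geo Oy Oy'; have [rc tG [G0 G1] _] := hG.
have C0 : 0 < C := lt_le_trans ltr01 C1.
have := C1 => C1'; have := c31 => c31'; have := c30 => c30'; have := far => far'.
have := tau0 => tau0'; have := eta0 => eta0'.
pose g := unit_param G; pose L := fine (clength G).
have gl : lip1 g := unit_param_lip rc.
have gO t : Om (g t) by apply/tG/unit_param_trace.
have g0 : g 0 = y by rewrite /g unit_param0.
have gL t : L <= t -> g t = y'.
  by move=> Lt; rewrite -G1 -(unit_paramL rc) /g /unit_param min_r// minxx.
have L0 : 0 <= L := fine_clength_ge0 _.
(* Ball separation against the deep curve [k]: some point of depth at least [eta] lies within
   [C * bdist (g t)] of [g t]. *)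
have geta t : eta / (1 + C) <= bdist (g t).
  have [s _ hs] := ball_separation_lip hG Oy Oy' (unit_param_trace rc t) kl kO ab ka kb.
  have : mdist (g t) (k s) < C * bdist (g t).
    by rewrite -lte_fin; apply: le_lt_trans hs; exact: mdist_le_internal_dist.
  have := bdist_triangle bOm (k s) (g t); rewrite metric_sym; have := keta s.
  by rewrite ler_pdivrMr ?mulrDr ?mulr1 1?[_ * C]mulrC; lra.
have [P fP Pl] := internal_lift fbij fdist hl hO.
have [W fW _] := internal_lift fbij fdist gl gO.
have /choice[s hs] : forall t, exists s, 0 <= s <= tau /\ mdist (W t) (P s) < C * bdist (g t).
  move=> t; have [s hs1 hs2] :=
    ball_separation_lip hG Oy Oy' (unit_param_trace rc t) hl hO tau0 h0 htau.
  exists s; split => //; move: hs2; rewrite -[unit_param G t]/(g t) -fW -fP fdist.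
  by rewrite lte_fin.
have GH u v : 0 <= u -> u <= v -> v <= L -> v - u <= C * mdist (W u) (W v).
  move=> u0 uv vL; have := ghOm (gO u) (gO v) (qh_geodesic_subarc oOm bOm rc uv hG u0 vL).
  by rewrite /clength /= unit_param_speed// -(fW u) -(fW v) fdist -EFinM lee_fin.
(* Steps along the geodesic proportional to the current boundary distance. The map [g] is constant
   beyond [L], so overshooting in the last step is harmless. *)
pose t_ i := iter i (fun t => t + c3 * bdist (g t)) 0.
pose r i := bdist (g (t_ i)).
have tS i : t_ i.+1 = t_ i + c3 * r i by [].
pose e1 := c3 * (eta / (1 + C)).
have e10 : 0 < e1 by rewrite mulr_gt0// divr_gt0//; lra.
have step i : e1 <= c3 * r i by rewrite /e1 ler_pM2l// /r geta.
have tm : {homo t_ : i j / (i <= j)%N >-> i <= j}.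
  by apply: homo_leq => // [x u v|i]; [exact: le_trans|rewrite tS lerDl; have := step i; lra].
have tlarge i : i%:R * e1 <= t_ i.
  elim: i => [|i IH]; first by rewrite mul0r.
  by rewrite tS -natr1 mulrDl mul1r lerD.
have exN : exists N, L <= t_ N.
  exists (Num.Def.truncn (L / e1)).+1; apply: le_trans (tlarge _).
  by rewrite -ler_pdivrMr//; apply/ltW/truncnS_gt.
pose N := ex_minn exN.
have [tN tmin] : L <= t_ N /\ forall n, L <= t_ n -> (N <= n)%N.
  by rewrite /N; case: (ex_minnP exN).
have tltL i : (i < N)%N -> t_ i < L.
  by move=> iN; rewrite ltNge; apply/negP => /tmin; rewrite leqNgt iN.
have t0 i : 0 <= t_ i by apply: (tm 0%N i).
have tel : `|m y - m y'| <= \sum_(i < N) r i * A (g (t_ i)).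
  have -> : y' = g (t_ N) by rewrite gL.
  rewrite -{1}g0 -[0]/(t_ 0%N) => {tN tmin tltL}.
  elim: (N) => [|n IH]; first by rewrite subrr normr0 big_ord0.
  rewrite big_ord_recr /=.
  have -> : m (g (t_ 0%N)) - m (g (t_ n.+1)) =
    (m (g (t_ 0%N)) - m (g (t_ n))) + (m (g (t_ n)) - m (g (t_ n.+1))) by ring.
  apply: le_trans (ler_normD _ _) _; rewrite lerD//; apply: mA => //.
  apply: le_trans (gl _ _) _; rewrite tS opprD addrA subrr add0r normrN ger0_norm//.
  by have := step n; lra.
have taudist : mdist y y' <= tau.
  by rewrite -h0 -htau; apply: le_trans (hl _ _) _; rewrite sub0r normrN ger0_norm.
have Ltau : L <= C * tau.
  have := GH 0 L (lexx _) L0 (lexx _); rewrite subr0 => hh; apply: le_trans hh _.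
  rewrite ler_pM2l//.
  have := internal_lift_le fdist hl hO tau0 (m := W 0) (m' := W L).
  by rewrite subr0; apply; rewrite fW ?g0 ?gL.
have kap0 : 0 < kap by rewrite invr_gt0 mulr_gt0// addr_gt0// invr_gt0.
have c3i : 1 <= c3^-1 by rewrite invf_ge1.
have kap2 : kap <= 1 / 2.
  by rewrite /kap invfM mul1r ler_piMr// invf_le1; lra.
(* Here [far] enters: it bounds [bdist y] by [tau / c3], and the position along the geodesic is at
   most [L <= C * tau]. *)
have rkap i : (i < N)%N -> kap * r i <= tau / 2.
  move=> iN; rewrite /kap invfM -mulrA mulrC ler_pM2r// ler_pdivrMl; last by lra.
  have : r i <= bdist y + t_ i.
    have := bdist_triangle bOm (g (t_ i)) y; have := gl (t_ i) 0.
    by rewrite g0 subr0 ger0_norm// /r; lra.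
  have := ltW (tltL _ iN).
  have : bdist y <= c3^-1 * tau.
    by rewrite mulrC ler_pdivlMr// mulrC; lra.
  by rewrite mulrDl; lra.
(* The interval assigned to the [i]-th chain point has [s (t_ i)] as an end point and extends to the
   side where at least half of [[0, tau]] remains. *)
pose p i := if s (t_ i) <= tau / 2 then s (t_ i) else s (t_ i) - kap * r i.
pose T (i : 'I_N) : set R := `[p i, p i + kap * r i]%classic.
have r_gt0 i : 0 < r i by rewrite bdist_gt0.
have Ts i t : T i t -> `|t - s (t_ i)| <= kap * r i.
  rewrite /T /p /= in_itv /=; have := r_gt0 i => ri.
  have kr : 0 < kap * r i by rewrite mulr_gt0.
  by case: ifPn => _ /andP[h1 h2]; rewrite ler_norml; apply/andP; split; lra.
have TD i : T i `<=` `[0, tau].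
  move=> t; rewrite /T /p /= !in_itv /=; have := rkap i (ltn_ord i).
  have [/andP[s0 st] _] := hs (t_ i).
  have kr : 0 < kap * r i by rewrite mulr_gt0.
  case: ifPn => [h1|]; last (rewrite -ltNge => h1);
    by move=> hk /andP[h2 h3]; apply/andP; split; lra.
have Tmu i : lebesgue_measure (T i) = (kap * r i)%:E.
  rewrite /T lebesgue_measure_itv /= lte_fin ltrDl mulr_gt0// -EFinD.
  by congr EFin; ring.
have Tdist (i j : 'I_N) : T i `&` T j !=set0 -> r i <= r j ->
    mdist (W (t_ i)) (W (t_ j)) <= 3 * C * r j.
  move=> [t [/Ts ti /Ts tj]] rij.
  have [_ hi] := hs (t_ i); have [_ hj] := hs (t_ j); rewrite -!/(r _) in hi hj.
  have := metric_triangle (W (t_ i)) (P (s (t_ i))) (W (t_ j)).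
  have := metric_triangle (P (s (t_ i))) (P (s (t_ j))) (W (t_ j)).
  have := Pl (s (t_ i)) (s (t_ j)); rewrite [mdist (P (s (t_ j))) _]metric_sym.
  have : `|s (t_ i) - s (t_ j)| <= r j.
    have -> : s (t_ i) - s (t_ j) = - (t - s (t_ i)) + (t - s (t_ j)) by ring.
    apply: le_trans (ler_normD _ _) _; rewrite normrN.
    have : kap * r i <= 1 / 2 * r j by rewrite ler_pM// ltW.
    have : kap * r j <= 1 / 2 * r j by rewrite ler_pM2r.
    by lra.
  have : C * r i <= C * r j by rewrite ler_pM2l.
  have : 1 * r j <= C * r j by rewrite ler_pM2r.
  by move: hi hj; lra.
have overlap j : ((\sum_(i | `[< T i `&` T j !=set0 >] && (r i <= r j)) r i)%:E <=
    chain_constant%:E * lebesgue_measure (T j))%E.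
  rewrite Tmu -EFinM lee_fin /chain_constant mulrA divfK ?gt_eqF// mulrAC ler_pdivlMr//.
  pose Q (i : 'I_N) := `[< T i `&` T j !=set0 >] && (r i <= r j).
  rewrite -/(\sum_(i | Q i) r i).
  have Qj : Q j.
    rewrite /Q lexx andbT; apply/asboolP; exists (p j); split; rewrite /T /= in_itv /= lexx /=;
    by rewrite lerDl ltW// mulr_gt0.
  (* All overlapping indices lie between [lo] and [hi], so their steps sum to at most one arc of the
     geodesic; Gehring-Hayman compares this arc with the internal distance of its ends, and [Tdist]
     bounds that through the [j]-th point. *)
  pose lo : 'I_N := [arg min_(i < j | Q i) (i : nat)]%N.
  pose hi : 'I_N := [arg max_(i > j | Q i) (i : nat)]%N.
  have [Qlo lomin] : Q lo /\ forall i, Q i -> (lo <= i)%N by rewrite /lo; case: arg_minnP.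
  have [Qhi himax] : Q hi /\ forall i, Q i -> (i <= hi)%N by rewrite /hi; case: arg_maxnP.
  have lohi := himax _ Qlo.
  have := @sum_steps_le R t_ N lo hi Q tm _ (himax _ Qlo).
  have -> : \sum_(i | Q i) (t_ i.+1 - t_ i) = (\sum_(i | Q i) r i) * c3.
    by rewrite mulr_suml; apply: eq_bigr => i _; rewrite tS; ring.
  move=> H; apply: le_trans (H _) _; first by move=> i Qi; rewrite lomin// himax.
  move: Qlo Qhi => /andP[/asboolP lo1 lo2] /andP[/asboolP hi1 hi2].
  have gh := GH (t_ lo) (t_ hi) (t0 _) (tm _ _ lohi) (ltW (tltL _ (ltn_ord _))).
  have d1 := Tdist _ _ lo1 lo2; have d2 := Tdist _ _ hi1 hi2.
  have d3 := metric_triangle (W (t_ lo)) (W (t_ j)) (W (t_ hi)).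
  rewrite [mdist (W (t_ j)) _]metric_sym in d3.
  have : C * mdist (W (t_ lo)) (W (t_ hi)) <= C * (6 * C * r j).
    by rewrite ler_pM2l//; lra.
  have : c3 * r hi <= c3 * r j by rewrite ler_pM2l.
  have -> : (6 * C ^+ 2 + c3) * r j = C * (6 * C * r j) + c3 * r j by ring.
  by rewrite tS; lra.
have cc0 : 0 <= chain_constant.
  by rewrite !divr_ge0 ?(ltW c30) ?(ltW kap0)// addr_ge0 ?(ltW c30)// mulr_ge0// sqr_ge0.
rewrite /itg; apply: le_trans (_ : (\sum_(i < N) r i * A (g (t_ i)))%:E <= _)%E.
  by rewrite lee_fin.
apply: (@layer_cake_le _ _ R lebesgue_measure N T (fun i => r i) chain_constant) => //.
- by move=> i; exact: measurable_itv.
- move=> i; exists (p i); rewrite /T /= in_itv /= lexx /= lerDl ltW// mulr_gt0//.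
- by move=> i; exact: ltW.
- exact: measurable_funTS.
move=> i t Tit; apply: Arho => //.
have [_ hi] := hs (t_ i); rewrite -/(r i) in hi.
have := hl t (s (t_ i)); have := Ts _ _ Tit.
have := metric_triangle (h t) (h (s (t_ i))) (g (t_ i)).
have : mdist (h (s (t_ i))) (g (t_ i)) < C * r i.
  apply: le_lt_trans hi; rewrite -fP -fW metric_sym; exact: internal_embed_lip.
have : kap * r i < C * r i by rewrite ltr_pM2r//; lra.
by rewrite -mulrA -/(r i); lra.
Qed.

End chain.

(** * Modulus and upper gradients *)

Section integral_off_null.
Import HBNNSimple.
Local Open Scope ereal_scope.
Context {d} {T : measurableType d} {R : realType} (mu : {measure set T -> \bar R}).
Implicit Types (f g : T -> \bar R) (D N : set T).

(** A simple function below [f], set to 0 on [N], lies below [g] and has the same integral. *)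
Lemma ge0_integral_le_off_null N f g : measurable N -> mu N = 0 ->
  (forall x, 0 <= f x) -> (forall x, 0 <= g x) ->
  (forall x, ~ N x -> f x <= g x) -> \int[mu]_x f x <= \int[mu]_x g x.
Proof.
move=> mN N0 f0 g0 fg; rewrite (ge0_integralTE mu f0) (ge0_integralTE mu g0).
apply: ge_ereal_sup => _ [h /= hf <-].
pose h1 := mul_nnsfun h (indic_nnsfun R (measurableC mN)).
have -> : sintegral mu h = sintegral mu h1.
  rewrite -!integralT_nnsfun; apply: ge0_ae_eq_integral => //=.
  - exact/measurable_EFinP.
  - by apply/measurable_EFinP; apply: measurable_funM => //; exact: measurable_indic.
  - by move=> x _; rewrite lee_fin; exact: fun_ge0.
  - by move=> x _; rewrite lee_fin mulr_ge0//; exact: fun_ge0.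
  exists N; split => // x /=; apply: contra_notP => nN _.
  by rewrite mindicE mem_set//= mulr1.
apply: ereal_sup_ubound; exists h1 => //= x.
rewrite mindicE; case: (pselect (N x)) => Nx.
  by rewrite memNset ?mulr0//=; apply.
by rewrite mem_set//= mulr1; apply: le_trans (hf x) _; exact: fg.
Qed.

(* No measurability is required, since the integral of a nonnegative function is
   defined as a supremum over the simple functions below it. *)
Lemma integral_eq_off_null N D f g : measurable N -> mu N = 0 ->
  (forall x, D x -> ~ N x -> f x = g x) ->
  \int[mu]_(x in D) f x = \int[mu]_(x in D) g x.
Proof.
move=> mN N0 fg.
have fg' x : ~ N x -> (f \_ D) x = (g \_ D) x.
  by move=> Nx; rewrite !patchE; case: ifPn => // /set_mem Dx; exact: fg.
rewrite integral_mkcond [RHS]integral_mkcond integralE [RHS]integralE.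
congr (_ - _); apply/eqP; rewrite eq_le; apply/andP; split;
  apply: (ge0_integral_le_off_null mN N0) => //= x Nx;
  by rewrite ?funeposE ?funenegE fg'.
Qed.

End integral_off_null.

Lemma poweRK (R : realType) (x : \bar R) (p : R) : p != 0 -> (0 <= x)%E ->
  ((x `^ p) `^ p^-1)%E = x.
Proof. by move=> p0 x0; rewrite -poweRrM divff// poweRe1. Qed.

Lemma poweRVK (R : realType) (x : \bar R) (p : R) : p != 0 -> (0 <= x)%E ->
  ((x `^ p^-1) `^ p)%E = x.
Proof. by move=> p0 x0; rewrite -poweRrM mulVf// poweRe1. Qed.

Lemma le_poweR (R : realType) (x y : \bar R) (p : R) : 0 <= p -> (0 <= x)%E ->
  (x <= y)%E -> (x `^ p <= y `^ p)%E.
Proof.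
move=> p0 x0 xy; apply: gt0_ler_poweR => //; rewrite in_itv /= leey andbT//.
exact: le_trans xy.
Qed.

Lemma poweRD_le (R : realType) (x y : \bar R) (p : R) : 0 <= p -> (0 <= x)%E ->
  (0 <= y)%E -> ((x + y) `^ p <= (2 `^ p)%:E * (x `^ p + y `^ p))%E.
Proof.
move=> p0; wlog xy : x y / (x <= y)%E.
  move=> H x0 y0; have [/H|/ltW/H] := leP x y; first exact.
  by move=> h; rewrite addeC [in leRHS]addeC; exact: h.
move=> x0 y0; apply: (@le_trans _ _ ((2%:E * y) `^ p)%E).
  apply: le_poweR => //; first exact: adde_ge0.
  have -> : (2%:E * y = y + y)%E.
    have -> : 2%:E = (1 + 1)%E :> \bar R by rewrite -EFinD.
    by rewrite ge0_muleDl// mul1e.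
  by rewrite leeD2r.
rewrite poweRM// poweR_EFin lee_wpmul2l ?lee_fin ?powR_ge0//.
by rewrite leeDr// poweR_ge0.
Qed.

Lemma nneseries_le_bound (R : realType) (f : nat -> \bar R) (M : \bar R) :
  (forall n, (0 <= f n)%E) -> (forall n, (\sum_(0 <= k < n) f k <= M)%E) ->
  (\sum_(0 <= k <oo) f k <= M)%E.
Proof.
move=> f0 h; apply: lime_le; first exact: is_cvg_nneseries.
by apply: nearW => n; exact: h.
Qed.

Lemma nneseries_ge_term (R : realType) (f : nat -> \bar R) n :
  (forall n, (0 <= f n)%E) -> (f n <= \sum_(0 <= k <oo) f k)%E.
Proof.
move=> f0; apply: le_trans (nneseries_lim_ge n.+1 _) => //.
by rewrite big_nat_recr//= leeDr// sume_ge0.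
Qed.

Lemma measurable_fun_poweR d (T : measurableType d) (R : realType) (D : set T)
    (f : T -> \bar R) (p : R) : measurable_fun D f ->
  measurable_fun D (fun x => (f x `^ p)%E).
Proof. by move=> mf; apply: (measurableT_comp (measurable_poweR p) mf). Qed.

Section borel_measure.
Context {R : realType} {X : completeMetricType R}.
Variable mu : {measure set (borel X) -> \bar R}.
Local Open Scope ereal_scope.

Lemma open_borel (D : set X) : open D -> measurable (D : set (borel X)).
Proof. by move=> oD; apply: sub_sigma_algebra. Qed.

Lemma closed_borel (D : set X) : closed D -> measurable (D : set (borel X)).
Proof.
move=> cD; rewrite -[D]setCK; apply: measurableC; apply: open_borel.
exact: closed_openC.
Qed.

Lemma ball_open (x : X) (r : R) : open (ball x r).
Proof.
rewrite openE => y; rewrite ballEmdist /= => xy; apply/nbhs_ballP.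
exists (r - mdist x y)%R => /=; first by rewrite subr_gt0.
move=> z; rewrite !ballEmdist /= => yz.
by apply: le_lt_trans (metric_triangle _ y _) _; rewrite -ltrBrDl.
Qed.

Lemma ball_borel (x : X) (r : R) : measurable (ball x r : set (borel X)).
Proof. by apply: open_borel; exact: ball_open. Qed.

Lemma Lnorm_onE (D : set X) (p : R) (f : X -> \bar R) : p != 0%R ->
  Lnorm_on mu D p%:E f =
  (\int[mu]_(x in (D : set (borel X))) (`|f x| `^ p)) `^ p^-1.
Proof.
move=> p0; rewrite /Lnorm_on unlock [in RHS]integral_mkcond; congr (_ `^ _).
apply: eq_integral => x _; rewrite !patchE; case: ifPn => //.
by rewrite abse0 poweR0r.
Qed.

Lemma Lnorm_on_lty (D : set X) (p : R) (f : X -> \bar R) : (0 < p)%R ->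
  (Lnorm_on mu D p%:E f < +oo) =
  (\int[mu]_(x in (D : set (borel X))) (`|f x| `^ p) < +oo).
Proof.
move=> p0; rewrite Lnorm_onE ?gt_eqF//; apply/idP/idP => [|h]; last exact: poweR_lty.
by apply: lty_poweRy; rewrite invr_eq0 gt_eqF.
Qed.

Lemma line_integral_ge0 (c : curve X) (g : X -> \bar R) : rectifiable c ->
  (forall x, trace c x -> 0 <= g x) -> 0 <= line_integral c g.
Proof.
move=> rc g0; rewrite line_integralE//; apply: itg_ge0 => t.
by apply/g0/unit_param_trace.
Qed.

Lemma line_integral_measurable (c : curve X) (D : set X) (g : X -> \bar R) :
  rectifiable c -> trace c `<=` D -> measurable (D : set (borel X)) ->
  measurable_fun (D : set (borel X)) g ->
  measurable_fun setT (fun t => g (unit_param c t)).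
Proof.
move=> rc tc mD mg; apply: (@lip1_measurable_comp _ _ _ D) => //.
  exact: unit_param_lip.
by move=> t; apply/tc/unit_param_trace.
Qed.

Lemma le_line_integral (c : curve X) (D : set X) (g g' : X -> \bar R) :
  rectifiable c -> trace c `<=` D -> measurable (D : set (borel X)) ->
  measurable_fun (D : set (borel X)) g -> measurable_fun (D : set (borel X)) g' ->
  (forall x, trace c x -> 0 <= g x) -> (forall x, trace c x -> g x <= g' x) ->
  line_integral c g <= line_integral c g'.
Proof.
move=> rc tc mD mg mg' g0 gg; rewrite !line_integralE//; apply: le_itg.
- exact: line_integral_measurable mg.
- by move=> t; apply/g0/unit_param_trace.
- exact: line_integral_measurable mg'.
- by move=> t _; apply/gg/unit_param_trace.
Qed.

(* If Mod_p Gamma = 0, choose admissible rho_n with small p-norms; then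
   H = (sum_n ((n+1) rho_n)^p)^(1/p) is p-integrable and dominates every
   (n+1) rho_n, so its integral along each curve of Gamma is infinite. *)
Lemma Mod0_infinite (p : R) (Gamma : set (curve X)) : (0 < p)%R ->
  Mod mu p%:E Gamma = 0 ->
  exists H : X -> \bar R, [/\ nonneg_borel [set: X] H,
    \int[mu]_(x in [set: borel X]) (H x `^ p) < +oo &
    forall c, Gamma c -> rectifiable c -> line_integral c H = +oo].
Proof.
move=> p0 Mod0; have pn0 : p != 0%R by rewrite gt_eqF.
have /choice[rho hrho] : forall n : nat, exists rho, admissible Gamma rho /\
    \int[mu]_(x in [set: borel X]) ((n.+1%:R%:E * rho x) `^ p) <= ((1 / 2) ^+ n)%:E.
  (* With this bound the function [((n+1) rho_n)^p] has integral at most [2^-n], so the series below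
     is integrable. *)
  move=> n; pose e := ((1 / 2) ^+ n / n.+1%:R `^ p)%R : R.
  have np0 : (0 < n.+1%:R `^ p :> R)%R by rewrite powR_gt0.
  have e0 : (0 < e)%R by rewrite divr_gt0// exprn_gt0.
  have : Mod mu p%:E Gamma < e%:E by rewrite Mod0 lte_fin.
  rewrite /Mod => /ereal_inf_lt[_ [rho arho <-] hlt]; exists rho; split => //.
  have [[mrho rho0] _] := arho.
  have rho0' x : 0 <= rho x by exact: rho0.
  under eq_integral do rewrite poweRM// poweR_EFin.
  have np0' : 0 <= (n.+1%:R `^ p)%:E by rewrite lee_fin ltW.
  rewrite (@ge0_integralZl _ _ _ mu setT measurableT (fun x => rho x `^ p)
    (measurable_fun_poweR p mrho) _ (fun x _ => poweR_ge0 _ _) np0').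
  move: hlt; rewrite Lnorm_onE// poweRVK//; last first.
    by apply: integral_ge0 => x _; exact: poweR_ge0.
  have -> : \int[mu]_(x in [set: borel X]) (`|rho x| `^ p) =
            \int[mu]_(x in [set: borel X]) (rho x `^ p).
    by apply: eq_integral => x _; rewrite gee0_abs.
  rewrite /e => /ltW; rewrite -(@lee_pmul2l _ (n.+1%:R `^ p)%:E)// => h.
  by apply: le_trans h _; rewrite -EFinM lee_fin mulrC divfK ?gt_eqF.
pose F n x := (n.+1%:R%:E * rho n x) `^ p.
have F0 n x : 0 <= F n x by exact: poweR_ge0.
have rho0 n x : 0 <= rho n x by have [[[_ h] _] _] := hrho n; exact: h.
have mrho n : measurable_fun [set: borel X] (rho n) by have [[[h _] _] _] := hrho n.
have mF n : measurable_fun [set: borel X] (F n).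
  by apply: measurable_fun_poweR; apply: emeasurable_funM.
pose S x := \sum_(0 <= n <oo) F n x.
have mS : measurable_fun [set: borel X] S.
  by apply: ge0_emeasurable_sum.
have S0 x : 0 <= S x by apply: nneseries_ge0.
exists (fun x => S x `^ p^-1); split.
- split; last by move=> x _; exact: poweR_ge0.
  exact: measurable_fun_poweR.
- under eq_integral do rewrite poweRVK//.
  rewrite /S integral_nneseries//.
  apply: (@le_lt_trans _ _ (\sum_(0 <= n <oo) ((1 / 2) ^+ n)%:E)).
    apply: lee_nneseries => n _; first by move=> *; apply: integral_ge0.
    by have [_] := hrho n.
  apply: (@le_lt_trans _ _ 2%:E); last by rewrite ltey.
  apply: nneseries_le_bound => n; first by rewrite lee_fin exprn_ge0//; lra.
  suff -> : \sum_(0 <= k < n) ((1 / 2 : R) ^+ k)%:E = (2 - 2 * (1 / 2) ^+ n)%:E.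
    by rewrite lee_fin gerBl mulr_ge0// exprn_ge0//; lra.
  elim: n => [|n IH]; first by rewrite big_geq// expr0 mulr1 subrr.
  by rewrite big_nat_recr//= IH -EFinD; congr EFin; rewrite exprS; field.
move=> c Gc rc; apply/eqyP => A A0.
have [n hn] : exists n : nat, (A <= n.+1%:R)%R.
  by exists (Num.Def.truncn A); apply/ltW/truncnS_gt.
apply: (@le_trans _ _ (n.+1%:R%:E * line_integral c (rho n))).
  have [[_ /(_ c Gc rc) h] _] := hrho n.
  apply: (@le_trans _ _ (n.+1%:R%:E * 1)); first by rewrite mule1 lee_fin.
  by rewrite lee_wpmul2l// lee_fin.
rewrite !line_integralE//.
have mc n' : measurable_fun setT (fun t => rho n' (unit_param c t)).
  exact: (@line_integral_measurable c [set: X]).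
rewrite -ge0_integralZl//=; last by apply: measurable_funTS; exact: mc.
have := @le_itg R (fun t => n.+1%:R%:E * rho n (unit_param c t))
  (fun t => S (unit_param c t) `^ p^-1) 0%R (fine (clength c)); apply.
- by apply: emeasurable_funM.
- by move=> t; rewrite mule_ge0.
- apply: (@line_integral_measurable c [set: X] (fun x => S x `^ p^-1)) => //.
  exact: measurable_fun_poweR.
- move=> t _; set x := unit_param c t.
  rewrite -[leLHS](@poweRK _ _ p)//; last by rewrite mule_ge0.
  apply: le_poweR; rewrite ?invr_ge0 ?(ltW p0) ?poweR_ge0//.
  exact: (@nneseries_ge_term R (F^~ x) n).
Qed.

End borel_measure.

Section upper_gradients.
Context {R : realType} {X : completeMetricType R}.
Variable mu : {measure set (borel X) -> \bar R}.
Local Open Scope ereal_scope.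

Lemma measurable_patch (D : set X) (g : X -> \bar R) :
  measurable (D : set (borel X)) -> measurable_fun (D : set (borel X)) g ->
  measurable_fun [set: borel X] (g \_ D : borel X -> \bar R).
Proof. by move=> mD mg; apply/(measurable_restrictT _ mD). Qed.

(** Adding a p-integrable function with infinite integral along every exceptional curve makes the
    inequality trivial on those curves. The result is Borel on all of [X], as the Poincare
    inequality requires. *)
Lemma weak_upper_gradient_upper (Om : set X) (p : R) (u : X -> R) (g : X -> \bar R) :
  (0 < p)%R -> open Om -> weak_upper_gradient mu Om p%:E u g ->
  Lnorm_on mu Om p%:E g < +oo ->
  exists g' : X -> \bar R, [/\ measurable_fun [set: borel X] g',
    forall x, 0 <= g' x, \int[mu]_(x in [set: borel X]) (g' x `^ p) < +oo &
    forall c, rectifiable c -> trace c `<=` Om -> upper_gradient_along u g' c].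
Proof.
move=> p0 oOm [[mg g0] [Gamma Mod0 hG]] gfin.
have [H [[mH H0] Hfin HG]] := Mod0_infinite p0 Mod0.
have mOm := open_borel oOm; have pn0 : p != 0%R by rewrite gt_eqF.
have mgO := measurable_patch mOm mg.
have gO0 x : 0 <= (g \_ Om) x by rewrite patchE; case: ifPn => // /set_mem; exact: g0.
have H0' x : 0 <= H x by exact: H0.
have mH' : measurable_fun [set: borel X] H by [].
pose g' x := (g \_ Om) x + H x.
have mg' : measurable_fun [set: borel X] g' by exact: emeasurable_funD.
have g'0 x : 0 <= g' x by rewrite adde_ge0.
exists g'; split => //.
  apply: (@le_lt_trans _ _ (\int[mu]_(x in [set: borel X])
      ((2 `^ p)%:E * ((g \_ Om) x `^ p + H x `^ p)))).
    apply: ge0_le_integral => //.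
    - by move=> x _; exact: poweR_ge0.
    - exact: measurable_fun_poweR.
    - apply: emeasurable_funM => //; apply: emeasurable_funD; exact: measurable_fun_poweR.
    - by move=> x _; apply: poweRD_le => //; exact: ltW.
  have P0 : 0 <= (2 `^ p)%:E :> \bar R by rewrite lee_fin powR_ge0.
  rewrite ge0_integralZl//; last 2 first.
  - by apply: emeasurable_funD; exact: measurable_fun_poweR.
  - by move=> x _; rewrite adde_ge0// poweR_ge0.
  rewrite lte_mul_pinfty// ge0_integralD//; last 4 first.
  - by move=> x _; exact: poweR_ge0.
  - exact: measurable_fun_poweR.
  - by move=> x _; exact: poweR_ge0.
  - exact: measurable_fun_poweR.
  apply: lte_add_pinfty => //.
  move: gfin; rewrite Lnorm_on_lty// [X in X < _ -> _]integral_mkcond.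
  congr (_ < _); apply: eq_integral => x _; rewrite !patchE; case: ifPn => [/set_mem Ox|_].
    by rewrite gee0_abs// g0.
  by rewrite poweR0r.
move=> c rc tc; rewrite /upper_gradient_along.
have [Gc|nGc] := pselect (Gamma c).
  suff -> : line_integral c g' = +oo by rewrite leey.
  apply/eqP; rewrite eq_le leey /= -(HG c Gc rc).
  apply: (@le_line_integral _ _ c [set: X]) => //.
  by move=> x _; rewrite /g' leeDr.
apply: le_trans (hG c rc tc nGc) _.
apply: (@le_line_integral _ _ c Om) => //.
- exact: measurable_funTS.
- by move=> x /tc; exact: g0.
- by move=> x /tc Ox; rewrite /g' patchE mem_set// leeDl.
Qed.

(** A unit-speed path with a point at distance more than [rr] from [x] spends a nondegenerate time
    interval there; when that point is the end of the path, the interval is taken to its left. *)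
Lemma line_integral_infinite (c : curve X) (x : X) (rr : R) (g : X -> \bar R) :
  rectifiable c -> (0 < fine (clength c))%R ->
  measurable_fun [set: borel X] g -> (forall z, 0 <= g z) ->
  (forall z, (rr < mdist x z)%R -> g z = +oo) ->
  ~ (trace c `<=` [set z | (mdist x z <= rr)%R]) -> line_integral c g = +oo.
Proof.
move=> rc L0 mg g0 goo /existsNP[z /not_implyP[tz /negP]]; rewrite -ltNge => hz.
have [t0 /andP[t00 t0L] tz0] := unit_param_onto rc tz.
set L := fine (clength c) in L0 t0L.
pose dl := (mdist x z - rr)%R; have dl0 : (0 < dl)%R by rewrite subr_gt0.
have far t : (`|t - t0| <= dl / 2)%R -> g (unit_param c t) = +oo.
  move=> ht; apply: goo; have := metric_triangle x (unit_param c t) z.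
  have := unit_param_lip rc t t0; rewrite tz0.
  by move: ht; rewrite /dl; lra.
have [a [b [a0 ab bL hab]]] : exists a b, [/\ (0 <= a)%R, (a < b)%R, (b <= L)%R &
    forall t, (a <= t <= b)%R -> (`|t - t0| <= dl / 2)%R].
  have [t0L'|Lt0] := ltP t0 L.
    exists t0, (Num.min L (t0 + dl / 2))%R; split => //.
    - by rewrite lt_min t0L' ltrDl divr_gt0.
    - by rewrite ge_min lexx.
    - move=> t /andP[h1]; rewrite le_min => /andP[_ h2].
      by rewrite ger0_norm ?subr_ge0//; lra.
  exists (Num.max 0 (t0 - dl / 2))%R, t0; split => //.
  - by rewrite le_max lexx.
  - by rewrite gt_max (lt_le_trans L0 Lt0) gtrBl divr_gt0.
  - move=> t /andP[]; rewrite ge_max => /andP[_ h1] h2.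
    by rewrite ler0_norm ?subr_le0//; lra.
have mc : measurable_fun setT (fun t => g (unit_param c t)).
  exact: (@line_integral_measurable _ _ c [set: X]).
have gc0 t : 0 <= g (unit_param c t) by exact: g0.
rewrite line_integralE// -/L -/(itg (fun t => g (unit_param c t)) 0 L).
have aL : (a <= L)%R by rewrite (le_trans (ltW ab)).
rewrite (itg_cat mc gc0 a0 aL) (itg_cat mc gc0 (ltW ab) bL).
have -> : itg (fun t => g (unit_param c t)) a b = +oo.
  rewrite (@eq_itg _ _ (cst +oo)); last by move=> t /hab; exact: far.
  by rewrite itg_cst ?(ltW ab)// gt0_mulye// lte_fin subr_gt0.
rewrite addye ?addey//.
- by rewrite gt_eqF// (lt_le_trans _ (itg_ge0 _ _ gc0))// ltNy0.
- by rewrite gt_eqF// (lt_le_trans _ (itg_ge0 _ _ gc0))// ltNy0.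
Qed.

Section local_poincare.
Variables (p cP sigma : R).
Hypothesis hP : forall u g, L1loc mu u -> upper_gradient [set: X] u g ->
  forall (x : X) (r : R), (0 < r)%R ->
    let B := ball x r in
    let uB := fine (mean mu B (EFin \o u)) in
    mean mu B (fun y => (`|u y - uB| `^ 1)%R%:E) `^ 1^-1 <=
    cP%:E * diam B * mean mu (ball x (5 * sigma * r)%R) (fun y => g y `^ p) `^ p^-1.

(** Setting the gradient to [+oo] off the dilated ball leaves the right-hand side unchanged and
    makes the condition void along curves leaving the closed ball, so only the curves inside it have
    to be controlled. *)
Lemma local_poincare u g x r : L1loc mu u -> measurable_fun [set: borel X] g ->
  (forall z, 0 <= g z) -> (0 < r)%R ->
  (forall c, rectifiable c -> trace c `<=` [set z | (mdist x z <= 5 * sigma * r)%R] ->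
    upper_gradient_along u g c) ->
  mean mu (ball x r) (fun y => (`|u y - fine (mean mu (ball x r) (EFin \o u))|)%:E) <=
  cP%:E * diam (ball x r) *
    mean mu (ball x (5 * sigma * r)%R) (fun y => g y `^ p) `^ p^-1.
Proof.
move=> uL mg g0 r0 hc; set B' := ball x (5 * sigma * r)%R.
have mB' : measurable (B' : set (borel X)) := ball_borel _ _.
pose gt y := (g \_ B') y + ((cst +oo) \_ (~` B')) y.
have mgt : measurable_fun [set: borel X] gt.
  apply: emeasurable_funD; first by apply: measurable_patch => //; exact: measurable_funTS.
  apply: measurable_patch => //; exact: measurableC.
have gt_out z : ~ B' z -> gt z = +oo.
  by move=> nz; rewrite /gt !patchE memNset// mem_set//= add0e.
have gt_in z : B' z -> gt z = g z.
  move=> Bz; rewrite /gt !patchE mem_set// memNset ?adde0//.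
have gt0 z : 0 <= gt z.
  by have [Bz|nB] := pselect (B' z); [rewrite gt_in|rewrite gt_out// leey].
have ug : upper_gradient [set: X] u gt.
  split; first by split.
  move=> c rc _; rewrite /upper_gradient_along.
  (* Curves of length zero need a separate argument, since their integrals vanish whatever the
     gradient is. *)
  have [L0|L0] := leP (fine (clength c)) 0%R.
    have -> : c (cstart c) = c (cend c).
      apply: mdist_positivity; apply/eqP; rewrite eq_le mdist_ge0 andbT.
      apply: le_trans L0; rewrite -lee_fin clength_fineK//.
      by apply: mdist_le_length_on; exact: cstart_le_end.
    by rewrite subrr normr0; exact: line_integral_ge0.
  have [tc|ntc] := pselect (trace c `<=` [set z | (mdist x z <= 5 * sigma * r)%R]); last first.
    rewrite (@line_integral_infinite c x (5 * sigma * r)%R)// ?leey// => z hz.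
    by apply: gt_out; rewrite /B' ballEmdist /=; apply/negP; rewrite -leNgt ltW.
  apply: le_trans (hc c rc tc) _; apply: (@le_line_integral _ _ c [set: X]) => //.
  move=> z _; have [Bz|nB] := pselect (B' z); first by rewrite gt_in.
  by rewrite gt_out// leey.
have := hP uL ug x r0; rewrite /= invr1 poweRe1; last first.
  rewrite /mean mule_ge0 ?inve_ge0 ?measure_ge0//; apply: integral_ge0 => y _.
  by rewrite lee_fin powR_ge0.
have -> : mean mu (ball x (5 * sigma * r)%R) (fun y => gt y `^ p) =
          mean mu (ball x (5 * sigma * r)%R) (fun y => g y `^ p).
  by rewrite /mean; congr (_ * _); apply: eq_integral => y /set_mem /gt_in ->.
apply: le_trans; rewrite le_eqVlt; apply/orP; left; apply/eqP.
rewrite /mean; congr (_ * _); apply: eq_integral => y _.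
by rewrite powRr1.
Qed.

End local_poincare.
End upper_gradients.

(** * Doubling measures and the Poincare inequality *)

Section doubling_measure.
Context {R : realType} {X : completeMetricType R}.
Variable mu : {measure set (borel X) -> \bar R}.
Hypotheses (hmu : locally_finite mu) (hd : doubling mu).

Definition vol (x : X) (r : R) : R := fine (mu (ball x r)).

Lemma ball_subset (x y : X) (r s : R) : mdist x y + s <= r -> ball y s `<=` ball x r.
Proof.
move=> h z; rewrite !ballEmdist /= => yz.
by apply: le_lt_trans (metric_triangle _ y _) _; lra.
Qed.

Lemma doubling_iter : exists2 K : R, 1 <= K & forall n (x : X) (r : R), 0 < r ->
  (mu (ball x (2 ^+ n * r)) <= (K ^+ n)%:E * mu (ball x r))%E.
Proof.
case: hd => _ [C C0 hC]; exists (Num.max 1 C); first by rewrite le_max lexx.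
elim=> [|n IH] x r r0; first by rewrite !expr0 mul1r mul1e.
rewrite exprS -mulrA; apply: le_trans (hC x _ _) _; first by rewrite mulr_gt0// exprn_gt0.
rewrite exprS EFinM -muleA; apply: lee_pmul => //.
- by rewrite lee_fin ltW.
- by rewrite lee_fin le_max lexx orbT.
- exact: IH.
Qed.

Lemma pow2_large (a : R) : exists n, a <= 2 ^+ n.
Proof.
exists (Num.Def.truncn a).+1; apply: le_trans (ltW (truncnS_gt a)) _.
elim: _.+1 => [|n IH]; first by rewrite expr0 ler01.
rewrite exprS -natr1; have : 1 <= 2 ^+ n :> R by rewrite exprn_ege1// ler1n.
by lra.
Qed.

(** By doubling, all dilates of a null ball are null, and they exhaust [X], whose measure is not
    zero. *)
Lemma mu_ball_gt0 (x : X) (r : R) : 0 < r -> (0 < mu (ball x r))%E.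
Proof.
move=> r0; rewrite lt0e measure_ge0 andbT; apply/eqP => m0.
have [K K1 hK] := doubling_iter.
case: hd => + _; apply; apply/eqP; rewrite eq_le measure_ge0 andbT.
have mb n : measurable (ball x (2 ^+ n * r) : set (borel X)) := ball_borel _ _.
have b0 n : mu (ball x (2 ^+ n * r)) = 0%E.
  apply/eqP; rewrite eq_le measure_ge0 andbT; apply: le_trans (hK n x r r0) _.
  by rewrite m0 mule0.
have -> : [set: X] = \bigcup_n (ball x (2 ^+ n * r)).
  apply/seteqP; split => // y _; have [n hn] := pow2_large ((mdist x y + 1) / r).
  exists n => //; rewrite ballEmdist /=; move: hn; rewrite ler_pdivrMr//; lra.
apply: le_trans (measure_sigma_subadditive mu mb _ (@subset_refl _ _)) _.
  exact: bigcupT_measurable.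
by rewrite eseries0.
Qed.

Lemma mu_ball_lty (x : X) (r : R) : (mu (ball x r) < +oo)%E.
Proof.
have [K K1 hK] := doubling_iter; have [s s0 hs] := hmu x.
have [n hn] := pow2_large (r / s).
apply: (@le_lt_trans _ _ ((K ^+ n)%:E * mu (ball x s))%E); last first.
  by rewrite lte_mul_pinfty// lee_fin exprn_ge0//; lra.
apply: le_trans (hK n x s s0); apply: le_measure; rewrite ?inE; try exact: ball_borel.
by apply: ball_subset; rewrite mdistxx add0r -ler_pdivrMr.
Qed.

Lemma vol_fin x r : mu (ball x r) = (vol x r)%:E.
Proof. by rewrite /vol fineK// ge0_fin_numE// mu_ball_lty. Qed.

Lemma vol_gt0 x r : 0 < r -> 0 < vol x r.
Proof. by move=> r0; rewrite -lte_fin -vol_fin mu_ball_gt0. Qed.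

Lemma ball_le0 (x : X) (r : R) : r <= 0 -> ball x r = set0.
Proof.
move=> r0; apply/seteqP; split => // w; rewrite ballEmdist /= => h.
by have := lt_le_trans h r0; rewrite ltNge mdist_ge0.
Qed.

Lemma vol_le0 x r : r <= 0 -> vol x r = 0.
Proof. by move=> r0; rewrite /vol ball_le0// measure0. Qed.

Lemma vol_ge0 x r : 0 <= vol x r.
Proof. by rewrite fine_ge0. Qed.

Lemma vol_subset x y r s : ball y s `<=` ball x r -> vol y s <= vol x r.
Proof.
by move=> h; rewrite -lee_fin -!vol_fin; apply: le_measure;
  rewrite ?inE; try exact: ball_borel.
Qed.

Lemma vol_compare (lam : R) : exists2 K : R, 1 <= K &
  forall x y (r s : R), 0 < r -> mdist x y + s <= lam * r -> vol y s <= K * vol x r.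
Proof.
have [K K1 hK] := doubling_iter; have [n hn] := pow2_large lam.
exists (K ^+ n); first by rewrite exprn_ege1.
move=> x y r s r0 h; apply: (@le_trans _ _ (vol x (2 ^+ n * r))).
  apply: vol_subset; apply: ball_subset; apply: le_trans h _; by rewrite ler_pM2r.
by rewrite -lee_fin EFinM -!vol_fin; exact: hK.
Qed.

Lemma mu_bounded_lty (Om : set X) (k : R) : open Om ->
  (forall x y, Om x -> Om y -> mdist x y <= k) -> (mu (Om : set (borel X)) < +oo)%E.
Proof.
move=> oOm hk; have [[x Ox]|nO] := pselect (exists x, Om x); last first.
  have -> : Om = set0 by apply/seteqP; split => // y Oy; apply: nO; exists y.
  by rewrite measure0.
apply: le_lt_trans (mu_ball_lty x (k + 1)); apply: le_measure; rewrite ?inE.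
- exact: open_borel.
- exact: ball_borel.
by move=> y Oy; rewrite ballEmdist /=; have := hk x y Ox Oy; lra.
Qed.

Section averages.
Variable U : X -> R.
Hypothesis mU : measurable_fun [set: borel X] (U : borel X -> R).
Hypothesis iU : mu.-integrable [set: borel X] (EFin \o (U : borel X -> R)).

Definition avg (x : X) (r : R) : R :=
  fine (\int[mu]_(y in (ball x r : set (borel X))) (U y)%:E) / vol x r.

Definition osc (x : X) (r : R) : R :=
  fine (\int[mu]_(y in (ball x r : set (borel X))) `|U y - avg x r|%:E) / vol x r.

Let iUB x r : mu.-integrable (ball x r : set (borel X)) (EFin \o (U : borel X -> R)).
Proof. by apply: integrableS iU => //; exact: ball_borel. Qed.

Let icst x r (a : R) : mu.-integrable (ball x r : set (borel X)) (cst a%:E).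
Proof.
apply/integrableP; split; first exact: measurable_cst.
rewrite integral_cst; last exact: ball_borel.
by rewrite vol_fin /= -EFinM ltey.
Qed.

Let iUa x r (a : R) : mu.-integrable (ball x r : set (borel X)) (fun y => (U y - a)%:E).
Proof. by apply: (integrableB _ (iUB x r) (icst x r a)); exact: ball_borel. Qed.

Lemma integral_dist_fin x r a :
  (\int[mu]_(y in (ball x r : set (borel X))) `|U y - a|%:E)%E \is a fin_num.
Proof.
have /integrableP[_] := iUa x r a; rewrite ge0_fin_numE//.
by apply: integral_ge0 => y _; rewrite lee_fin.
Qed.

Lemma osc_ge0 x r : 0 <= osc x r.
Proof.
rewrite divr_ge0 ?vol_ge0// fine_ge0//; apply: integral_ge0 => y _.
by rewrite lee_fin.
Qed.

Lemma integral_osc x r : 0 < r ->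
  (\int[mu]_(y in (ball x r : set (borel X))) `|U y - avg x r|%:E)%E =
  (vol x r * osc x r)%:E.
Proof.
move=> r0; rewrite /osc mulrC divfK ?gt_eqF ?vol_gt0// fineK//.
exact: integral_dist_fin.
Qed.

Lemma mean_avg x r : 0 < r -> mean mu (ball x r) (EFin \o U) = (avg x r)%:E.
Proof.
move=> r0; rewrite /mean /avg vol_fin inver gt_eqF ?vol_gt0// mulrC EFinM fineK//.
exact: (integrable_fin_num (ball_borel _ _) (iUB x r)).
Qed.

Lemma mean_osc x r : 0 < r ->
  mean mu (ball x r) (fun y => `|U y - avg x r|%:E) = (osc x r)%:E.
Proof.
move=> r0; rewrite /mean integral_osc// vol_fin inver gt_eqF ?vol_gt0// -EFinM.
by rewrite mulKf// gt_eqF// vol_gt0.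
Qed.

Lemma avg_diff_le x y r s a : 0 < s -> ball y s `<=` ball x r ->
  vol y s * `|avg y s - a| <=
  fine (\int[mu]_(z in (ball x r : set (borel X))) `|U z - a|%:E).
Proof.
move=> s0 sub; have vs := vol_gt0 y s0.
rewrite -lee_fin fineK ?integral_dist_fin//.
apply: (@le_trans _ _ (\int[mu]_(z in (ball y s : set (borel X))) `|U z - a|%:E)%E);
  last first.
  apply: ge0_subset_integral => //; try exact: ball_borel.
  - by apply/measurable_EFinP; apply: measurableT_comp => //;
      apply: measurable_funB => //; exact: measurable_funTS.
have -> : (vol y s * `|avg y s - a|)%:E =
    `|\int[mu]_(z in (ball y s : set (borel X))) (U z - a)%:E|%E.
  have -> : (\int[mu]_(z in (ball y s : set (borel X))) (U z - a)%:E)%E =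
            (vol y s * (avg y s - a))%:E.
    transitivity (\int[mu]_(z in (ball y s : set (borel X))) ((U z)%:E - a%:E))%E => //.
    rewrite (integralB (ball_borel _ _) (iUB y s) (icst y s a)).
    rewrite integral_cst; last exact: ball_borel.
    rewrite vol_fin -EFinM mulrBr /avg [vol y s * (_ / _)]mulrC divfK ?gt_eqF//.
    rewrite EFinB fineK; last exact: (integrable_fin_num (ball_borel _ _) (iUB y s)).
    by rewrite [vol y s * a]mulrC.
  by rewrite /= normrM ger0_norm// ltW.
by apply: le_abse_integral; [exact: ball_borel|case/integrableP: (iUa y s a)].
Qed.

Lemma avg_avg_le x y r s : 0 < s -> 0 < r -> ball y s `<=` ball x r ->
  `|avg y s - avg x r| <= vol x r / vol y s * osc x r.
Proof.
move=> s0 r0 sub; have := avg_diff_le (avg x r) s0 sub.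
rewrite integral_osc//= => h; rewrite mulrAC ler_pdivlMr ?vol_gt0// mulrC.
exact: h.
Qed.

Lemma avg_avg_compare (lam : R) : exists2 K : R, 1 <= K &
  forall x y r s, 0 < s -> mdist x y + s <= r -> r <= lam * s ->
    `|avg y s - avg x r| <= K * osc x r.
Proof.
have [K K1 hK] := vol_compare (2 * lam); exists K => // x y r s s0 h hr.
have r0 : 0 < r by have := mdist_ge0 x y; lra.
apply: le_trans (avg_avg_le s0 r0 (ball_subset h)) _.
rewrite ler_wpM2r ?osc_ge0// ler_pdivrMr ?vol_gt0//; apply: hK => //.
by rewrite metric_sym; lra.
Qed.

End averages.

End doubling_measure.

(** * The Poincare inequality inside the domain *)

Section domain.
Context {R : realType} {X : completeMetricType R}.
Variable mu : {measure set (borel X) -> \bar R}.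
Hypotheses (hmu : locally_finite mu) (hd : doubling mu).
Variables (p cP sigma : R).
Hypotheses (p1 : 1 < p) (cP0 : 0 < cP) (sigma0 : 0 < sigma).
Hypothesis hP : forall u g, L1loc mu u -> upper_gradient [set: X] u g ->
  forall (x : X) (r : R), 0 < r ->
    let B := ball x r in
    let uB := fine (mean mu B (EFin \o u)) in
    (mean mu B (fun y => (`|u y - uB| `^ 1)%R%:E) `^ 1^-1 <=
    cP%:E * diam B * mean mu (ball x (5 * sigma * r)%R) (fun y => g y `^ p) `^ p^-1)%E.
Local Notation vol := (vol mu).

(** The factor [5 * sigma] may be smaller than 1; the maximum ensures that the dilated ball contains
    the original one. *)
Definition dilation := Num.max 1 (5 * sigma).
Local Notation S := dilation.

Lemma dilation_ge1 : 1 <= S. Proof. by rewrite le_max lexx. Qed.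
Lemma dilation_ge : 5 * sigma <= S. Proof. by rewrite le_max lexx orbT. Qed.

Lemma diam_ball (x : X) (r : R) : (diam (ball x r) <= (2 * r)%:E)%E.
Proof.
apply: ge_ereal_sup => _ [y [z [+ + ->]]]; rewrite !ballEmdist /= => xy xz.
have := metric_triangle y x z; rewrite [mdist y x]metric_sym lee_fin; lra.
Qed.

Section ball_in_domain.
Variable Om : set X.
Hypothesis oOm : open Om.
Local Notation bdist := (bdist Om).

Lemma trace_clopen (c : curve X) : rectifiable c -> trace c `&` boundary Om = set0 ->
  Om (c (cstart c)) <-> Om (c (cend c)).
Proof.
move=> rc h; have ab := @cstart_le_end _ _ c.
have ta : trace c (c (cstart c)) by exists (cstart c) => //=; rewrite in_itv /= lexx.
have tb : trace c (c (cend c)) by exists (cend c) => //=; rewrite in_itv /= lexx ab.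
have con : connected (trace c).
  apply: connected_continuous_connected; last exact: cfun_continuous.
  exact: segment_connected.
suff all : (exists2 z, trace c z & Om z) -> trace c `<=` Om.
  by split=> h'; apply: all => //; [exists (c (cstart c))|exists (c (cend c))].
move=> [z tz Oz].
have <- : trace c `&` Om = trace c; last by move=> w [].
apply: con; first by exists z.
  by exists Om.
exists (closure Om); first exact: closed_closure.
apply/seteqP; split => w [tw Ow]; split => //; first exact: subset_closure.
apply: contrapT => nw; have : (trace c `&` boundary Om) w.
  by split => //; split => // /nbhs_singleton.
by rewrite h.
Qed.

Lemma indic_L1loc : L1loc mu (\1_Om : X -> R).
Proof.
move=> x; exists 1 => //; split.
  exists (\1_Om : borel X -> R); first by apply: measurable_indic; exact: open_borel.
  by apply: nearW.
rewrite (@Lnorm_on_lty _ _ mu _ 1)//; apply: le_lt_trans (mu_ball_lty hmu hd x 1).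
rewrite -[leRHS]mul1e -integral_cst; last exact: ball_borel.
apply: ge0_le_integral => //; first exact: ball_borel.
- by move=> y _; exact: poweR_ge0.
- apply: measurable_fun_poweR; apply/measurable_EFinP; apply: measurableT_comp => //.
  by apply: measurable_funTS; apply: measurable_indic; exact: open_borel.
- move=> y _; rewrite poweRe1//= lee_fin indicE ger0_norm//.
  by case: (_ \in _).
Qed.

(* Otherwise the indicator function of Om, which has upper gradient 0 along the
   curves avoiding the boundary, would violate the Poincare inequality. *)
Lemma ball_off_boundary x r : Om x -> 0 < r ->
  (forall z, boundary Om z -> S * r < mdist x z) -> ball x r `<=` Om.
Proof.
move=> Ox r0 hr y xy; apply: contrapT => nOy.
pose u : X -> R := \1_Om.
have Mball : measurable (ball x r : set (borel X)) := ball_borel _ _.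
have hu := indic_L1loc.
have mu_u : measurable_fun [set: borel X] (u : borel X -> R).
  by apply: measurable_indic; exact: open_borel.
have ug0 c : rectifiable c -> trace c `<=` [set z | mdist x z <= 5 * sigma * r] ->
    upper_gradient_along u (cst 0%E) c.
  move=> rc tc; rewrite /upper_gradient_along.
  have hc : trace c `&` boundary Om = set0.
    apply/seteqP; split => // z [/tc /= xz /hr].
    apply/negP; rewrite -leNgt; apply: le_trans xz _.
    by rewrite ler_wpM2r ?dilation_ge// ltW.
  have [h1 h2] := trace_clopen rc hc.
  have -> : u (c (cstart c)) = u (c (cend c)).
    rewrite /u !indicE; congr (_%:R); congr nat_of_bool.
    by apply/idP/idP => /set_mem h; apply/mem_set; [exact: h1|exact: h2].
  by rewrite subrr normr0; exact: line_integral_ge0.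
have := @local_poincare _ _ mu p cP sigma hP u (cst 0%E) x r hu
  (measurable_cst _) (fun=> lexx _) r0 ug0.
set a := fine _.
have p0 : p != 0 by rewrite gt_eqF//; apply: lt_trans p1.
have pi0 : p^-1 != 0 by rewrite invr_eq0.
rewrite {2}/mean.
have -> : (\int[mu]_(y in (ball x (5 * sigma * r) : set (borel X))) (0%E : \bar R) `^ p = 0)%E.
  by apply: integral0_eq => z _; rewrite poweR0r.
rewrite mule0 poweR0r// mule0 /mean vol_fin// inver gt_eqF ?vol_gt0// => h.
have I0 : (\int[mu]_(z in (ball x r : set (borel X))) `|u z - a|%:E = 0)%E.
  apply/eqP; rewrite eq_le integral_ge0// andbT.
  move: h; rewrite pmule_rle0// lte_fin invr_gt0 vol_gt0//.
(* Zero oscillation forces [u] to equal the mean [a] on every small ball where it is constant. A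
   ball about [x] gives [a = 1] and one about [y] gives [a = 0]. *)
have key z e (b : R) : 0 < e -> ball z e `<=` ball x r -> (forall w, ball z e w -> u w = b) ->
    b = a.
  move=> e0 sub hb; apply/eqP; rewrite -subr_eq0 -normr_eq0; apply/eqP.
  have : (\int[mu]_(w in (ball z e : set (borel X))) `|u w - a|%:E <= 0)%E.
    rewrite -I0; apply: ge0_subset_integral => //; first exact: ball_borel.
    apply/measurable_EFinP; apply: measurableT_comp => //.
    by apply: measurable_funB => //; exact: measurable_funTS.
  have -> : (\int[mu]_(w in (ball z e : set (borel X))) `|u w - a|%:E =
             `|b - a|%:E * (vol z e)%:E)%E.
    rewrite -vol_fin// -integral_cst; last exact: ball_borel.
    by apply: eq_integral => w /set_mem /hb ->.
  rewrite -EFinM lee_fin pmulr_lle0 ?vol_gt0// => hh.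
  by apply/eqP; rewrite eq_le hh normr_ge0.
have [e1 e10 he1] : exists2 e, 0 < e & ball x e `<=` Om.
  by have /nbhs_ballP[e /= e0 he] : nbhs x Om by [exact: open_nbhs_nbhs]; exists e.
have a1 : 1 = a.
  apply: (key x (Num.min e1 r)); first by rewrite lt_min e10.
    by apply: ball_subset; rewrite mdistxx add0r ge_min lexx orbT.
  move=> w hw; rewrite /u indicE mem_set//; apply: he1.
  by apply: ball_subset hw; rewrite mdistxx add0r ge_min lexx.
(* The boundary avoids the ball, so a point of the ball outside [Om] is even outside its closure and
   has a neighbourhood on which the indicator vanishes. *)
have ncl : ~ closure Om y.
  move=> cy; have /hr : boundary Om y by split => // /nbhs_singleton.
  apply/negP; rewrite -leNgt; move: xy; rewrite ballEmdist /= => /ltW/le_trans; apply.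
  by rewrite ler_peMl ?dilation_ge1// ltW.
have [e2 e20 he2] : exists2 e, 0 < e & ball y e `<=` ~` Om.
  have /nbhs_ballP[e /= e0 he] : nbhs y (~` closure Om).
    by apply: open_nbhs_nbhs; split => //; apply: closed_openC; exact: closed_closure.
  by exists e => // w /he hw Ow; apply: hw; exact: subset_closure.
move: xy; rewrite ballEmdist /= => xy.
have a0 : 0 = a.
  apply: (key y (Num.min e2 (r - mdist x y))); first by rewrite lt_min e20 subr_gt0.
    by apply: ball_subset; rewrite -lerBrDl ge_min lexx orbT.
  move=> w hw; rewrite /u indicE memNset//; apply: he2.
  by apply: ball_subset hw; rewrite mdistxx add0r ge_min lexx.
by have := oner_neq0 R; rewrite a1 -a0 eqxx.
Qed.

Lemma boundary_nonempty : Om !=set0 -> Om <> [set: X] -> boundary Om !=set0.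
Proof.
move=> [x Ox] nT; apply: contrapT => h; apply: nT; apply/seteqP; split => // y _.
have r0 : 0 < mdist x y + 1 by rewrite ltr_wpDl// mdist_ge0.
apply: (@ball_off_boundary x (mdist x y + 1)) => //.
  by move=> z bz; exfalso; apply: h; exists z.
by rewrite ballEmdist /= ltrDl.
Qed.

Hypothesis bOm : boundary Om !=set0.

Lemma ball_in_domain x r : Om x -> 0 < r -> S * r < bdist x -> ball x r `<=` Om.
Proof.
move=> Ox r0 hr; apply: ball_off_boundary => // z bz.
exact: lt_le_trans hr (bdist_le_mdist bOm x bz).
Qed.

End ball_in_domain.

Section poincare_in_domain.
Variables (Om : set X) (u U : X -> R) (N : set X) (g : X -> \bar R).
Hypotheses (oOm : open Om) (bOm : boundary Om !=set0).
Hypothesis mU : measurable_fun [set: borel X] (U : borel X -> R).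
Hypothesis iU : mu.-integrable [set: borel X] (EFin \o (U : borel X -> R)).
Hypotheses (mN : measurable (N : set (borel X))) (N0 : mu (N : set (borel X)) = 0%E).
Hypothesis uU : forall x, Om x -> ~ N x -> u x = U x.
Hypothesis U0 : forall x, ~ Om x -> U x = 0.
Hypotheses (mg : measurable_fun [set: borel X] g) (g0 : forall x, (0 <= g x)%E).
Hypothesis gp : (\int[mu]_(x in [set: borel X]) (g x `^ p) < +oo)%E.
Hypothesis ug : forall c, rectifiable c -> trace c `<=` Om -> upper_gradient_along u g c.
Local Notation bdist := (bdist Om).

Definition gmass (x : X) (r : R) : R :=
  fine (\int[mu]_(y in (ball x r : set (borel X))) (g y `^ p)).

Lemma measurable_gp (D : set X) : measurable_fun (D : set (borel X)) (fun y => (g y `^ p)%E).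
Proof. by apply: measurable_funTS; exact: measurable_fun_poweR. Qed.

Lemma gmass_fin x r :
  (\int[mu]_(y in (ball x r : set (borel X))) (g y `^ p))%E = (gmass x r)%:E.
Proof.
rewrite /gmass fineK// ge0_fin_numE; last by apply: integral_ge0 => y _; exact: poweR_ge0.
apply: le_lt_trans gp; apply: ge0_subset_integral => //; first exact: ball_borel.
  exact: measurable_gp.
by move=> y _; exact: poweR_ge0.
Qed.

Lemma gmass_ge0 x r : 0 <= gmass x r.
Proof. by rewrite fine_ge0//; apply: integral_ge0 => y _; exact: poweR_ge0. Qed.

Lemma gmass_subset x y r s : ball y s `<=` ball x r -> gmass y s <= gmass x r.
Proof.
move=> sub; rewrite -lee_fin -!gmass_fin; apply: ge0_subset_integral => //;
  try exact: ball_borel; first exact: measurable_gp.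
by move=> z _; exact: poweR_ge0.
Qed.

Definition gavg (x : X) (r : R) : R := gmass x r / vol x r.

Lemma gavg_ge0 x r : 0 <= gavg x r.
Proof. by rewrite divr_ge0 ?gmass_ge0 ?vol_ge0. Qed.

(** The values of [u] off [Om] are arbitrary; extension by zero makes it locally integrable on [X]
    and equal to [U] off a null set. *)
Let u1 (x : X) : R := if x \in Om then u x else 0.

Let u1U x : ~ N x -> u1 x = U x.
Proof.
move=> nN; rewrite /u1; case: ifPn => [/set_mem Ox|/negP nOx]; first exact: uU.
by rewrite U0// => Ox; apply: nOx; exact/mem_set.
Qed.

Let u1_L1loc : L1loc mu u1.
Proof.
move=> x; exists 1 => //; split.
  by exists U => //; exists N; split => // y /= hy; apply: contrapT => nN; apply: hy => _; exact: u1U.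
rewrite (@Lnorm_on_lty _ _ mu _ 1)//.
rewrite (@integral_eq_off_null _ _ _ mu N (ball x 1) _ (fun y => `|(U y)%:E|%E))//; last first.
  by move=> y _ nN; rewrite poweRe1//= u1U.
have /integrableP[_] := @integrableS _ _ _ mu _ (ball x 1) _ measurableT (ball_borel x 1) (@subsetT _ _) iU.
by [].
Qed.

(** The radius condition puts the ball of radius [2 * S * r] inside [Om] by [ball_in_domain]. It
    contains the closed ball of radius [5 * sigma * r], so the curves that the localized inequality
    tests lie in [Om], where [g] is an upper gradient. *)
Lemma domain_poincare x r : Om x -> 0 < r -> 2 * S * S * r < bdist x ->
  osc mu U x r <= 2 * cP * r * (gavg x (5 * sigma * r)) `^ p^-1.
Proof.
move=> Ox r0 hr.
have S1 := dilation_ge1; have S5 := dilation_ge; have S0 : 0 < S by lra.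
have sr0 : 0 < 5 * sigma * r by rewrite !mulr_gt0.
have sub : ball x (2 * S * r) `<=` Om.
  apply: (@ball_in_domain Om) => //; first by rewrite !mulr_gt0.
  by apply: le_lt_trans hr; rewrite le_eqVlt; apply/orP; left; apply/eqP; ring.
have := @local_poincare _ _ mu p cP sigma hP u1 g x r u1_L1loc mg g0 r0.
have avgE : fine (mean mu (ball x r) (EFin \o u1)) = avg mu U x r.
  rewrite -[RHS]/(fine (avg mu U x r)%:E) -(mean_avg hmu hd iU)// /mean; congr (fine (_ * _)%E).
  by apply: (integral_eq_off_null _ N0) => // y _ nN /=; rewrite u1U.
rewrite avgE.
have -> : mean mu (ball x r) (fun y => `|u1 y - avg mu U x r|%:E) = (osc mu U x r)%:E.
  rewrite -(mean_osc hmu hd iU)// /mean; congr (_ * _)%E.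
  by apply: (integral_eq_off_null _ N0) => // y _ nN /=; rewrite u1U.
have -> : mean mu (ball x (5 * sigma * r)) (fun y => (g y `^ p)%E) =
    (gavg x (5 * sigma * r))%:E.
  rewrite /mean gmass_fin vol_fin// inver gt_eqF ?vol_gt0// -EFinM.
  by rewrite /gavg mulrC.
rewrite poweR_EFin => h; rewrite -lee_fin; apply: le_trans (h _) _.
  move=> c rc tc.
  have tcO : trace c `<=` Om.
    move=> z /tc /= hz; apply: sub; rewrite ballEmdist /=; apply: le_lt_trans hz _.
    have : 5 * sigma * r <= S * r by rewrite ler_pM2r.
    have : 0 < S * r by rewrite mulr_gt0.
    by rewrite -mulrA; lra.
  have hug := ug rc tcO; rewrite /upper_gradient_along /u1 !mem_set//.
  - by apply: tcO; exists (cend c) => //=; rewrite in_itv /= lexx cstart_le_end.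
  - by apply: tcO; exists (cstart c) => //=; rewrite in_itv /= lexx cstart_le_end.
have -> : (2 * cP * r * gavg x (5 * sigma * r) `^ p^-1)%:E =
    (cP%:E * (2 * r)%:E * (gavg x (5 * sigma * r) `^ p^-1)%:E)%E.
  by rewrite -!EFinM; congr EFin; ring.
rewrite lee_wpmul2r ?lee_fin ?powR_ge0// lee_wpmul2l ?lee_fin ?(ltW cP0)//.
exact: diam_ball.
Qed.

End poincare_in_domain.
End domain.

(** * Coverings, maximal functions and Lebesgue points *)

Section vitali.
Context {R : realType} {X : completeMetricType R}.
Hypothesis sepX : separable X.
Variables (A : set X) (rad : X -> R) (Rm : R).
Hypothesis rad0 : forall x, A x -> 0 < rad x <= Rm.

Let meets (x y : X) := ball x (rad x) `&` ball y (rad y) !=set0.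

(** The last clause, that a ball meeting the family meets a member of at least half its radius,
    survives unions of chains; this makes Zorn's lemma applicable, and maximality extends the clause
    to all of [A]. *)
Let P (D : set X) := [/\ D `<=` A,
  forall x y, D x -> D y -> meets x y -> x = y &
  forall x, A x -> (exists2 y, D y & meets x y) ->
    exists y, [/\ D y, meets x y & rad x <= 2 * rad y]].

Lemma vitali_maximal : exists D, P D /\
  forall x, A x -> exists y, [/\ D y, meets x y & rad x <= 2 * rad y].
Proof.
have [D [PD Dmax]] : exists D, P D /\ forall B, D `<` B -> ~ P B.
  apply: Zorn_bigcup => F FP Ftot; split.
  - by move=> x [D FD Dx]; case: (FP _ FD) => DA _ _; exact: DA.
  - move=> x y [D FD Dx] [D' FD' D'y] m.
    have [DD|DD] := Ftot _ _ FD FD'.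
      by case: (FP _ FD') => _ h _; apply: h => //; exact: DD.
    by case: (FP _ FD) => _ h _; apply: h => //; exact: DD.
  - move=> x Ax [y [D FD Dy] m]; case: (FP _ FD) => _ _ /(_ x Ax)[|z [Dz mz rz]].
      by exists y.
    by exists z; split => //; exists D.
exists D; split => // x Ax; case: PD => DA Ddis Dmeet; apply: (Dmeet x Ax).
apply: contrapT => nm.
(* If some ball met no member, one of the unmet balls with radius more than half of their supremum
   could be added. *)
pose E := [set rad z | z in [set z | A z /\ ~ exists2 y, D y & meets z y]].
have Ex : E (rad x) by exists x.
have hE : has_sup E.
  by split; [exists (rad x)|exists Rm => _ [z [Az _] <-]; case/andP: (rad0 Az)].
have rx0 : 0 < rad x by case/andP: (rad0 Ax).
have s0 : 0 < sup E.
  by apply: lt_le_trans rx0 _; apply: ub_le_sup => //; case: hE.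
have [_ [z [Az nz] <-] hz] : exists2 r, E r & sup E / 2 < r.
  by apply: sup_gt; [exists (rad x)|rewrite ltr_pdivrMr// ltr_pMr// ltr1n].
have zz : meets z z.
  by exists z; split; rewrite ballEmdist /= mdistxx; case/andP: (rad0 Az).
apply: (Dmax (D `|` [set z])).
  split; first by move=> y Dy; left.
  by move=> /(_ z) h; apply: nz; exists z => //; apply: h; right.
split.
- by move=> y [/DA//|->].
- move=> y y' [Dy|->] [Dy'|->] m //; first exact: Ddis.
    by exfalso; apply: nz; exists y => //; case: m => w []; exists w.
  by exfalso; apply: nz; exists y'.
- move=> w Aw hw; have [[y Dy my]|nw] := pselect (exists2 y, D y & meets w y).
    have [|v [Dv mv rv]] := Dmeet w Aw; first by exists y.
    by exists v; split => //; left.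
  exists z; split; first by right.
    case: hw => y [Dy|->] my //.
    by exfalso; apply: nw; exists y.
  have : rad w <= sup E by apply: ub_le_sup; [case: hE|exists w].
  by lra.
Qed.

Lemma vitali_covering : exists (z : nat -> X) (s : nat -> R),
  [/\ forall n, s n = 0 \/ A (z n) /\ s n = rad (z n),
      trivIset [set: nat] (fun n => ball (z n) (s n)) &
      forall x, A x -> exists n, [/\ A (z n), s n = rad (z n), rad x <= 2 * s n &
        mdist x (z n) < rad x + s n]].
Proof.
have [D [[DA Ddis _] Dcov]] := vitali_maximal.
have meetsxx y : A y -> meets y y.
  by move=> Ay; exists y; split; rewrite ballEmdist /= mdistxx; case/andP: (rad0 Ay).
have [Q cQ dQ] := sepX.
have /choice[q hq] : forall y, exists q, D y -> Q q /\ ball y (rad y) q.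
  move=> y; have [Dy|nD] := pselect (D y); last by exists y.
  have [||q [bq Qq]] := dQ (ball y (rad y)).
  - by have [w [hw _]] := meetsxx y (DA _ Dy); exists w.
  - rewrite openE => w; rewrite ballEmdist /= => yw; apply/nbhs_ballP.
    exists (rad y - mdist y w) => /=; first by rewrite subr_gt0.
    move=> v; rewrite !ballEmdist /= => wv.
    by apply: le_lt_trans (metric_triangle _ w _) _; rewrite -ltrBrDl.
  by exists q.
have [f finj] : exists f : X -> nat, {in Q &, injective f} by exact/countable_injP.
pose code y := f (q y).
have code_inj y y' : D y -> D y' -> code y = code y' -> y = y'.
  move=> Dy Dy' e; have [Qy by_] := hq _ Dy; have [Qy' by'] := hq _ Dy'.
  have eq : q y = q y' by apply: finj => //; rewrite inE.
  by apply: Ddis => //; exists (q y); split => //; rewrite eq.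
have /choice[zs hzs] : forall n : nat, exists zs : X * R,
    (D zs.1 /\ code zs.1 = n /\ zs.2 = rad zs.1) \/
    (zs.2 = 0 /\ forall y, D y -> code y <> n).
  move=> n; have [[y [Dy cy]]|h] := pselect (exists y, D y /\ code y = n).
    by exists (y, rad y); left.
  exists (point, 0); right; split => // y Dy cy; apply: h; by exists y.
exists (fun n => (zs n).1), (fun n => (zs n).2); split.
- move=> n; case: (hzs n) => [[Dz [_ sz]]|[-> _]]; last by left.
  by right; split => //; exact: DA.
- move=> i j _ _ [w [wi wj]].
  case: (hzs i) => [[Di [ci si]]|[si _]]; last first.
    by move: wi; rewrite /= si ballEmdist /= ltNge mdist_ge0.
  case: (hzs j) => [[Dj [cj sj]]|[sj _]]; last first.
    by move: wj; rewrite /= sj ballEmdist /= ltNge mdist_ge0.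
  rewrite -ci -cj; congr code; apply: Ddis => //; exists w; split.
    by move: wi; rewrite /= si.
  by move: wj; rewrite /= sj.
- move=> x Ax; have [y [Dy [w [xw yw]] rxy]] := Dcov x Ax.
  exists (code y); case: (hzs (code y)) => [[Dz [cz sz]]|[_ /(_ y Dy)//]].
  have e := code_inj _ _ Dz Dy cz; rewrite sz e; split => //; first exact: DA.
  move: xw yw; rewrite !ballEmdist /= => xw yw.
  by have := metric_triangle x w y; rewrite [mdist w y]metric_sym; lra.
Qed.

End vitali.

Section small_sets.
Local Open Scope ereal_scope.
Context {d} {T : measurableType d} {R : realType} (mu : {measure set T -> \bar R}).
Variable f : T -> \bar R.
Hypotheses (mf : measurable_fun setT f) (f0 : forall x, 0 <= f x).
Hypothesis fint : \int[mu]_x f x < +oo.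

Lemma superlevel_measurable (a : R) : measurable [set x | a%:E < f x].
Proof.
rewrite -[X in measurable X]setTI.
by apply: (emeasurable_fun_o_infty measurableT mf).
Qed.

Lemma tail_integral_small (e : R) : (0 < e)%R ->
  exists n : nat, \int[mu]_(x in [set x | n%:R%:E < f x]) f x < e%:E.
Proof.
move=> e0; have fi : mu.-integrable setT f.
  by apply/integrableP; split => //; under eq_integral do rewrite gee0_abs//.
pose F n x := (f \_ [set x | n%:R%:E < f x]) x.
have mF n : measurable_fun setT (F n).
  by apply/(measurable_restrictT _ (superlevel_measurable _)); exact: measurable_funTS.
have cvF : {ae mu, forall x, setT x -> F n x @[n --> \oo] --> (cst 0 x : \bar R)}.
  have := integrable_ae measurableT fi; apply: filterS => x /(_ I) fx _.
  apply: cvg_near_cst; near=> n; rewrite /F patchE memNset//=; apply/negP.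
  rewrite -leNgt -(fineK fx) lee_fin.
  by near: n; exact: nbhs_infty_ger.
have dom : {ae mu, forall x n, setT x -> `|F n x| <= f x}.
  apply: nearW => x n _; rewrite /F patchE; case: ifPn => _; first by rewrite gee0_abs.
  by rewrite abse0.
have [_ _] := dominated_convergence measurableT mF (measurable_cst 0) cvF fi dom.
rewrite integral_cst// mul0e => h.
have [|n hn] := @filter_ex _ \oo _ [set n | \int[mu]_x F n x < e%:E].
  have nb : nbhs (0 : \bar R) [set y | y < e%:E].
    by apply: open_nbhs_nbhs; split; [exact: open_ereal_lt_ereal|rewrite /= lte_fin].
  exact: h nb.
by exists n; rewrite integral_mkcond.
Unshelve. all: by end_near. Qed.

Lemma integral_abs_continuous (e : R) : (0 < e)%R -> exists2 dl : R, (0 < dl)%R &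
  forall G, measurable G -> mu G <= dl%:E -> \int[mu]_(x in G) f x <= e%:E.
Proof.
move=> e0; have e20 : (0 < e / 2)%R by rewrite divr_gt0.
have [n hn] := tail_integral_small e20.
exists (e / 2 / n.+1%:R)%R; first by rewrite divr_gt0.
move=> G mG Gd; pose E := [set x | n%:R%:E < f x].
have mE := superlevel_measurable n%:R.
have mfE : measurable_fun setT (f \_ E).
  by apply/(measurable_restrictT _ mE); exact: measurable_funTS.
have fE0 x : 0 <= (f \_ E) x by rewrite patchE; case: ifPn.
apply: (@le_trans _ _ (\int[mu]_(x in G) ((f \_ E) x + n%:R%:E))).
  apply: ge0_le_integral => //.
  - exact: measurable_funTS.
  - by apply: emeasurable_funD => //; apply: measurable_funTS.
  - move=> x _; rewrite patchE; case: ifPn => h; first by rewrite leeDl// lee_fin.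
    rewrite add0e leNgt; apply/negP => h'; move/negP: h; apply; exact/mem_set.
rewrite ge0_integralD//; last exact: measurable_funTS.
have -> : e%:E = (e / 2)%:E + (e / 2)%:E by rewrite -EFinD -splitr.
apply: leeD.
  apply: le_trans (ltW hn); rewrite [leRHS]integral_mkcond.
  by apply: ge0_subset_integral.
rewrite integral_cst//; apply: (@le_trans _ _ (n%:R%:E * (e / 2 / n.+1%:R)%:E)).
  by rewrite lee_wpmul2l// lee_fin.
rewrite -EFinM lee_fin mulrCA ger_pMr// ler_pdivrMr// mul1r ler_nat//.
Qed.

End small_sets.

Section weak_type.
Context {R : realType} {X : completeMetricType R}.
Hypothesis sepX : separable X.
Variable mu : {measure set (borel X) -> \bar R}.
Hypotheses (hmu : locally_finite mu) (hd : doubling mu).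
Variables (p : R) (g : X -> \bar R).
Hypotheses (mg : measurable_fun [set: borel X] g) (g0 : forall x, (0 <= g x)%E).
Hypothesis gp : (\int[mu]_(x in [set: borel X]) (g x `^ p) < +oo)%E.
Local Notation vol := (vol mu).
Local Notation gmass := (gmass mu p g).

Let mgp : measurable_fun [set: borel X] (fun x => g x `^ p)%E.
Proof. exact: measurable_fun_poweR. Qed.

(** On a selected ball the part of [g^p] not exceeding [lam / 2] accounts for at most half of the
    required mass, so the integral may be restricted to the superlevel set. The set [B] need not be
    Borel; [G] is a union of enlarged Vitali balls. *)
Lemma weak_type : exists2 K : R, 0 <= K &
  forall (B : set X) (rad : X -> R) (Rm lam : R), 0 < lam ->
    (forall x, B x -> 0 < rad x <= Rm) ->
    (forall x, B x -> lam * vol x (rad x) < gmass x (rad x)) ->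
    exists G : set X, [/\ measurable (G : set (borel X)), B `<=` G &
      (lam%:E * mu (G : set (borel X)) <=
       K%:E * \int[mu]_(x in ([set x | (lam / 2)%:E < g x `^ p]%E : set (borel X))) (g x `^ p))%E].
Proof.
have [K K1 hK] := vol_compare hmu hd 5.
exists (2 * K); first by lra.
move=> B rad Rm lam lam0 hrad hB.
have [z [s [zs tz cov]]] := vitali_covering sepX hrad.
pose E := [set x | (lam / 2)%:E < g x `^ p]%E.
have mE : measurable (E : set (borel X)) by exact: superlevel_measurable.
pose k x := (((fun y => (g y `^ p)%E) \_ E) : X -> \bar R) x.
have mk : measurable_fun [set: borel X] k by apply: measurable_patch => //; exact: measurable_funTS.
have k0 x : (0 <= k x)%E by rewrite /k patchE; case: ifPn => // _; exact: poweR_ge0.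
have s0 n : 0 <= s n.
  by case: (zs n) => [->//|[Bz ->]]; apply/ltW; case/andP: (hrad _ Bz).
have mball r n : measurable (ball (z n) r : set (borel X)) := ball_borel _ _.
exists (\bigcup_n ball (z n) (5 * s n)); split.
- by apply: bigcupT_measurable.
- move=> x Bx; have [n [Bz sz rx xz]] := cov x Bx; exists n => //.
  rewrite ballEmdist /= metric_sym; apply: lt_le_trans xz _.
  by have := s0 n; lra.
have single n : ((lam * vol (z n) (5 * s n))%:E <=
    (2 * K)%:E * \int[mu]_(x in (ball (z n) (s n) : set (borel X))) k x)%E.
  case: (zs n) => [->|[Bz sz]].
    rewrite mulr0 vol_le0// mulr0 mule_ge0 ?lee_fin ?integral_ge0//; lra.
  have sn0 : 0 < s n by rewrite sz; case/andP: (hrad _ Bz).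
  have h1 : vol (z n) (5 * s n) <= K * vol (z n) (s n).
    by apply: hK => //; rewrite mdistxx add0r.
  have h2 : ((lam * vol (z n) (s n))%:E <=
      \int[mu]_(x in (ball (z n) (s n) : set (borel X))) k x +
      (lam / 2 * vol (z n) (s n))%:E)%E.
    apply: (@le_trans _ _ (gmass (z n) (s n))%:E).
      by rewrite lee_fin ltW// sz; exact: hB.
    rewrite -(gmass_fin mg gp) EFinM -(vol_fin hmu hd) -integral_cst//.
    rewrite -ge0_integralD//.
    - apply: ge0_le_integral => //.
      + by move=> x _; exact: poweR_ge0.
      + exact: measurable_funTS.
      + by apply: emeasurable_funD => //; exact: measurable_funTS.
      + move=> x _; rewrite /k patchE; case: ifPn => h.
          by rewrite leeDl// lee_fin divr_ge0// ltW.
        rewrite add0e leNgt; apply/negP => h'; move/negP: h; apply; exact/mem_set.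
    - exact: measurable_funTS.
    - by move=> x _; rewrite lee_fin divr_ge0// ltW.
  have [->|fin] := eqVneq (\int[mu]_(x in (ball (z n) (s n) : set (borel X))) k x)%E +oo%E.
    by rewrite gt0_muley ?leey// lte_fin; lra.
  have Ifin : (\int[mu]_(x in (ball (z n) (s n) : set (borel X))) k x)%E \is a fin_num.
    by rewrite ge0_fin_numE ?ltey//; apply: integral_ge0.
  move: h2; rewrite -(fineK Ifin) -EFinD -EFinM !lee_fin; set I := fine _ => h2.
  have : lam * vol (z n) (5 * s n) <= lam * (K * vol (z n) (s n)) by rewrite ler_pM2l.
  have h3 : lam * vol (z n) (s n) <= 2 * I by lra.
  move=> h4; apply: le_trans h4 _.
  have -> : lam * (K * vol (z n) (s n)) = K * (lam * vol (z n) (s n)) by ring.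
  have -> : 2 * K * I = K * (2 * I) by ring.
  by rewrite ler_wpM2l//; lra.
have l0 : (0 <= lam%:E)%E by rewrite lee_fin ltW.
apply: (@le_trans _ _ (lam%:E * \sum_(0 <= n <oo) mu (ball (z n) (5 * s n)))%E).
  rewrite lee_wpmul2l//; apply: (measure_sigma_subadditive mu (fun n => mball _ n)).
    by apply: bigcupT_measurable.
  exact: subset_refl.
rewrite -nneseriesZl//.
apply: (@le_trans _ _ (\sum_(0 <= n <oo)
    ((2 * K)%:E * \int[mu]_(x in (ball (z n) (s n) : set (borel X))) k x))%E).
  apply: lee_nneseries => n _; first by move=> *; rewrite mule_ge0.
  by rewrite vol_fin// -EFinM; exact: single.
rewrite nneseriesZl//; last by move=> n _; apply: integral_ge0.
rewrite lee_wpmul2l//; first by rewrite lee_fin; lra.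
rewrite -(@ge0_integral_bigcup _ _ _ mu (fun n => ball (z n) (s n)) k)//; last first.
  exact: measurable_funTS.
rewrite [leRHS]integral_mkcond; apply: ge0_subset_integral => //.
by apply: bigcupT_measurable.
Qed.

End weak_type.

(** * Convergence of averages at good points *)

Section good_points.
Context {R : realType} {X : completeMetricType R}.
Hypothesis sepX : separable X.
Variable mu : {measure set (borel X) -> \bar R}.
Hypotheses (hmu : locally_finite mu) (hd : doubling mu).
Variables (p cP sigma S : R) (g : X -> \bar R) (U : X -> R) (Om : set X).
Hypotheses (p0 : 0 < p) (cP0 : 0 < cP) (sigma0 : 0 < sigma) (S1 : 1 <= S).
Hypothesis sigmaS : 5 * sigma <= S.
Hypotheses (mg : measurable_fun [set: borel X] g) (g0 : forall x, (0 <= g x)%E).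
Hypothesis gp : (\int[mu]_(x in [set: borel X]) (g x `^ p) < +oo)%E.
Hypothesis mU : measurable_fun [set: borel X] (U : borel X -> R).
Hypothesis iU : mu.-integrable [set: borel X] (EFin \o (U : borel X -> R)).
Hypotheses (oOm : open Om) (bOm : boundary Om !=set0).
Hypothesis muOm : (mu (Om : set (borel X)) < +oo)%E.
Local Notation bdist := (bdist Om).
Hypothesis ball_in : forall x r, Om x -> 0 < r -> S * r < bdist x -> ball x r `<=` Om.
Hypothesis PI : forall x r, Om x -> 0 < r -> 2 * S * S * r < bdist x ->
  osc mu U x r <= 2 * cP * r * (gavg mu p g x (5 * sigma * r)) `^ p^-1.

Definition good (Lam : R) (y : X) :=
  forall s, 0 < s -> s <= bdist y -> gmass mu p g y s <= Lam `^ p * vol mu y s.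

Let r_le_SS (r b : R) : 0 < r -> 2 * S * S * r < b -> [/\ 5 * sigma * r <= b, r <= b & S * r < b].
Proof.
move=> r0 h; have := S1 => S1'; have S0 : 0 < S by lra.
have Sr : r <= S * r by rewrite ler_peMl// ltW.
have SSr : S * r <= S * S * r by rewrite -mulrA ler_peMl// mulr_ge0// ltW.
have sr : 5 * sigma * r <= S * r by rewrite ler_pM2r.
have hb : S * r < b.
  move: h; have -> : 2 * S * S * r = 2 * (S * S * r) by ring.
  have SS0 : 0 < S * S * r by rewrite !mulr_gt0.
  by lra.
by split => //; lra.
Qed.

Lemma osc_good Lam y r : 0 <= Lam -> Om y -> good Lam y -> 0 < r ->
  2 * S * S * r < bdist y -> osc mu U y r <= 2 * cP * r * Lam.
Proof.
move=> L0 Oy gy r0 hr; apply: le_trans (PI Oy r0 hr) _.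
have [h1 _ _] := r_le_SS r0 hr.
have sr0 : 0 < 5 * sigma * r by rewrite !mulr_gt0.
rewrite ler_wpM2l//; first by rewrite !mulr_ge0// ltW.
have -> : Lam = (Lam `^ p) `^ p^-1 by rewrite -powRrM divff ?gt_eqF// powRr1.
apply: ge0_ler_powR; rewrite ?nnegrE ?gavg_ge0 ?powR_ge0 ?invr_ge0 ?(ltW p0)//.
by rewrite ler_pdivrMr ?vol_gt0//; exact: gy.
Qed.

(** The radius is halved until it falls below [2 * s]. The oscillation at scale [r'] is of order
    [r' * Lam], so the differences form a geometric series; this doubles the one-step constant 2 to
    4. *)
Lemma telescope : exists2 K : R, 0 <= K & forall Lam y s r, 0 <= Lam -> Om y ->
  good Lam y -> 0 < s -> s <= r -> 2 * S * S * r < bdist y ->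
  `|avg mu U y s - avg mu U y r| <= K * r * Lam.
Proof.
have [K K1 hK] := avg_avg_compare hmu hd mU iU 2.
exists (4 * K * cP); first by rewrite !mulr_ge0 ?(ltW cP0)//; lra.
move=> Lam y s r L0 Oy gy s0 sr hr; have [n hn] := pow2_large (r / s).
have := S1 => S1'.
have step r' t : 0 < t -> t <= r' -> r' <= 2 * t -> r' <= r ->
    `|avg mu U y t - avg mu U y r'| <= 2 * K * cP * r' * Lam.
  move=> t0 tr rt rr; apply: le_trans (hK y y r' t t0 _ rt) _; first by rewrite mdistxx add0r.
  have -> : 2 * K * cP * r' * Lam = K * (2 * cP * r' * Lam) by ring.
  rewrite ler_wpM2l//; first by lra.
  apply: osc_good => //; first exact: lt_le_trans tr.
  by apply: le_lt_trans hr; rewrite ler_wpM2l// !mulr_ge0//; lra.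
move: hn; rewrite ler_pdivrMr// => hn.
elim: n r sr hr step hn => [|n IH] r sr hr step hn.
  have -> : r = s by apply/eqP; rewrite eq_le sr andbT; rewrite expr0 mul1r in hn.
  rewrite subrr normr0 !mulr_ge0 ?(ltW cP0) ?(ltW s0)//; lra.
have r0 : 0 < r := lt_le_trans s0 sr.
have nn : 0 <= K * cP * r * Lam by rewrite !mulr_ge0 ?(ltW cP0) ?(ltW r0)//; lra.
have -> : 4 * K * cP * r * Lam = 4 * (K * cP * r * Lam) by ring.
have [r2s|sr2] := leP r (2 * s).
  apply: le_trans (step r s s0 sr r2s (lexx _)) _.
  have -> : 2 * K * cP * r * Lam = 2 * (K * cP * r * Lam) by ring.
  by lra.
have r2 : r / 2 <= r by lra.
have := IH (r / 2); have := step r (r / 2).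
move=> /(_ _ _ _ _) h1 /(_ _ _ _ _) h2.
have {}h1 : `|avg mu U y (r / 2) - avg mu U y r| <= 2 * (K * cP * r * Lam).
  have -> : 2 * (K * cP * r * Lam) = 2 * K * cP * r * Lam by ring.
  by apply: h1 => //; lra.
have {}h2 : `|avg mu U y s - avg mu U y (r / 2)| <= 2 * (K * cP * r * Lam).
  have -> : 2 * (K * cP * r * Lam) = 4 * K * cP * (r / 2) * Lam by field.
  apply: h2 => //; first by lra.
  - by apply: le_lt_trans hr; rewrite ler_wpM2l// !mulr_ge0//; lra.
  - by move=> r' t t0 tr rt rr; apply: step => //; lra.
  - by move: hn; rewrite exprS -mulrA; lra.
have -> : avg mu U y s - avg mu U y r =
  (avg mu U y s - avg mu U y (r / 2)) + (avg mu U y (r / 2) - avg mu U y r) by ring.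
by apply: le_trans (ler_normD _ _) _; lra.
Qed.

Section lebesgue_points.
Variables (Lam eps b0 : R).
Hypotheses (L0 : 0 < Lam) (e0 : 0 < eps) (b00 : 0 < b0).

Let E := [set y | [/\ Om y, good Lam y, b0 <= bdist y &
  exists2 r, 0 < r & forall s, 0 < s -> s <= r -> eps < `|U y - avg mu U y s|]].

(** Cover [E] at scale [d]. At a covered point the small-scale average differs from the average
    [a n] over the enlarged Vitali ball by at most [eps / 2], so [U] deviates from [a n] by more
    than [eps / 2]. Chebyshev's inequality and an oscillation of order [d * Lam] bound the measure
    by a multiple of [d] times that of the Vitali ball, and these balls are disjoint subsets of
    [Om]. *)
Lemma oscillating_small : exists2 d0 : R, 0 < d0 & exists2 K : R, 0 <= K &
  forall d, 0 < d -> d <= d0 -> exists W : set X, [/\ measurable (W : set (borel X)),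
    E `<=` W & (mu (W : set (borel X)) <= (K * d)%:E)%E].
Proof.
have [KT KT0 hT] := telescope.
have [K3 K31 hK3] := avg_avg_compare hmu hd mU iU (5 / 2).
have [K5 K51 hK5] := vol_compare hmu hd 5.
have := S1 => S1'; have S0 : 0 < S by lra. have := cP0 => cP0'. have := L0 => L0'.
have := e0 => e0'; have := b00 => b00'.
pose A1 := (2 * KT + 10 * K3 * cP) * Lam.
have A10 : 0 <= A1.
  by rewrite mulr_ge0 ?(ltW L0)// addr_ge0 ?mulr_ge0//; lra.
(* The first bound keeps radii up to [5 * d] in the range of the Poincare inequality; the second
   makes the total drift of the averages at most [eps / 2]. *)
pose d0 := Num.min (b0 / (20 * S * S)) (eps / 2 / (A1 + 1)).
have d00 : 0 < d0.
  by rewrite lt_min !divr_gt0 ?mulr_gt0//; lra.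
exists d0 => //; exists (20 * cP * Lam / eps * K5 * fine (mu (Om : set (borel X)))).
  rewrite !mulr_ge0 ?fine_ge0 ?invr_ge0//; lra.
move=> d dpos dd0.
have /choice[ry hry] : forall y, exists r, E y -> 0 < r /\
    forall s, 0 < s -> s <= r -> eps < `|U y - avg mu U y s|.
  move=> y; have [[_ _ _ [r r0 hr]]|nE] := pselect (E y); last by exists 0.
  by exists r.
pose rad y := Num.min (ry y) d.
have hrad y : E y -> 0 < rad y <= d.
  by move=> Ey; have [r0 _] := hry y Ey; rewrite lt_min r0 dpos ge_min lexx orbT.
have [z [s [zs tz cov]]] := vitali_covering sepX hrad.
have sle n : 0 <= s n <= d.
  case: (zs n) => [->|[Ez ->]]; first by rewrite lexx ltW.
  by have /andP[h1 h2] := hrad _ Ez; rewrite (ltW h1).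
have small y r : E y -> 0 < r -> r <= 5 * d -> 2 * S * S * r < bdist y.
  move=> [_ _ hb _] r0 rd; apply: lt_le_trans hb.
  apply: le_lt_trans (_ : 2 * S * S * (5 * d) < b0).
    by rewrite ler_wpM2l// !mulr_ge0//; lra.
  have : d <= b0 / (20 * S * S) by apply: le_trans dd0 _; rewrite ge_min lexx.
  rewrite ler_pdivlMr; last by rewrite !mulr_gt0.
  have -> : 2 * S * S * (5 * d) = d * (20 * S * S) / 2 by field.
  by lra.
pose a n := avg mu U (z n) (5 * s n).
pose W n : set X := ball (z n) (5 * s n) `&` [set x | eps / 2 < `|U x - a n|].
have mV n : measurable ([set x | eps / 2 < `|U x - a n|] : set (borel X)).
  have mf : measurable_fun [set: borel X] (fun x => `|U x - a n|%:E).
    by apply/measurable_EFinP; apply: measurableT_comp => //; exact: measurable_funB.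
  rewrite (_ : [set x | _] = [set x | ((eps / 2)%:E < `|U x - a n|%:E)%E]).
    exact: (superlevel_measurable mf (eps / 2)).
  by apply/seteqP; split => x /=; rewrite lte_fin.
have mW n : measurable (W n : set (borel X)).
  by apply: measurableI => //; exact: ball_borel.
exists (\bigcup_n W n); split.
- by apply: bigcupT_measurable.
- move=> x Ex; have [n [Ez sz rx xz]] := cov x Ex; exists n => //.
  have /andP[sn0' snd] := sle n.
  have sn0 : 0 < s n by rewrite sz; case/andP: (hrad _ Ez).
  split.
    by rewrite ballEmdist /= metric_sym; apply: lt_le_trans xz _; lra.
  have [Ox gx _ _] := Ex; have [Oz gz _ _] := Ez.
  have /andP[rx0 _] := hrad _ Ex.
  have h1 : eps < `|U x - avg mu U x (rad x)|.
    by have [_ hh] := hry x Ex; apply: hh => //; rewrite ge_min lexx.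
  have h2 : `|avg mu U x (rad x) - avg mu U x (2 * s n)| <= KT * (2 * s n) * Lam.
    by apply: hT => //; [exact: ltW|apply: small => //; lra].
  have h3 : `|avg mu U x (2 * s n) - a n| <= K3 * (2 * cP * (5 * s n) * Lam).
    apply: (@le_trans _ _ (K3 * osc mu U (z n) (5 * s n))).
      by apply: hK3; rewrite ?[mdist (z n) x]metric_sym; lra.
    rewrite ler_wpM2l//; first by lra.
    by apply: osc_good => //; [exact: ltW|lra|apply: small => //; lra].
  have h4 : KT * (2 * s n) * Lam + K3 * (2 * cP * (5 * s n) * Lam) <= eps / 2.
    have -> : KT * (2 * s n) * Lam + K3 * (2 * cP * (5 * s n) * Lam) = A1 * s n.
      by rewrite /A1; ring.
    apply: (@le_trans _ _ ((A1 + 1) * d)); first by rewrite ler_pM//; lra.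
    have : d <= eps / 2 / (A1 + 1) by apply: le_trans dd0 _; rewrite ge_min lexx orbT.
    by rewrite ler_pdivlMr 1?mulrC//; lra.
  rewrite /=; have := ler_normD (U x - a n) (a n - avg mu U x (rad x)).
  have -> : U x - a n + (a n - avg mu U x (rad x)) = U x - avg mu U x (rad x) by ring.
  have : `|a n - avg mu U x (rad x)| <= KT * (2 * s n) * Lam + K3 * (2 * cP * (5 * s n) * Lam).
    rewrite distrC; have -> : avg mu U x (rad x) - a n =
      (avg mu U x (rad x) - avg mu U x (2 * s n)) + (avg mu U x (2 * s n) - a n) by ring.
    by apply: le_trans (ler_normD _ _) _; exact: lerD.
  by move: h1 h4; move: (KT * _ * _ + _) => *; lra.
have single n : (mu (W n : set (borel X)) <=
    (20 * cP * Lam / eps * K5 * d)%:E * mu (ball (z n) (s n)))%E.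
  case: (zs n) => [s0|[Ez sz]].
    rewrite /W s0 mulr0 ball_le0// set0I measure0 mule_ge0// lee_fin.
    by rewrite !mulr_ge0 ?invr_ge0//; lra.
  have /andP[sn0' snd] := sle n; have [Oz gz _ _] := Ez.
  have sn0 : 0 < s n by rewrite sz; case/andP: (hrad _ Ez).
  have s50 : 0 < 5 * s n by lra.
  have h1 : ((eps / 2)%:E * mu (W n : set (borel X)) <=
      (vol mu (z n) (5 * s n) * osc mu U (z n) (5 * s n))%:E)%E.
    rewrite -integral_osc// -integral_cst//.
    have mf (D : set X) : measurable_fun (D : set (borel X)) (fun y => `|U y - a n|%:E).
      apply/measurable_EFinP; apply: measurableT_comp => //.
      by apply: measurable_funB => //; exact: measurable_funTS.
    apply: (@le_trans _ _ (\int[mu]_(x in (W n : set (borel X))) `|U x - a n|%:E)%E).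
      apply: ge0_le_integral => //=; first by move=> x _; rewrite lee_fin; lra.
      by move=> x [_ /= /ltW]; rewrite lee_fin.
    apply: ge0_subset_integral => //; first exact: ball_borel.
    exact: subIsetl.
  have h2 : osc mu U (z n) (5 * s n) <= 2 * cP * (5 * s n) * Lam.
    by apply: osc_good => //; [exact: ltW|apply: small => //; lra].
  have h3 : vol mu (z n) (5 * s n) <= K5 * vol mu (z n) (s n).
    by apply: hK5 => //; rewrite mdistxx add0r.
  have h4 : vol mu (z n) (5 * s n) * osc mu U (z n) (5 * s n) <=
      K5 * vol mu (z n) (s n) * (2 * cP * (5 * d) * Lam).
    apply: ler_pM => //; [exact: vol_ge0|exact: osc_ge0|].
    apply: le_trans h2 _; rewrite ler_wpM2r ?(ltW L0)// ler_wpM2l//; last by lra.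
    by rewrite mulr_ge0//; lra.
  have eh : (0 < (eps / 2)%:E)%E by rewrite lte_fin; lra.
  rewrite -(@lee_pmul2l _ (eps / 2)%:E)//; apply: le_trans h1 _.
  rewrite vol_fin// -!EFinM lee_fin; apply: le_trans h4 _.
  by rewrite le_eqVlt; apply/orP; left; apply/eqP; field; rewrite gt_eqF.
have c0 : (0 <= (20 * cP * Lam / eps * K5 * d)%:E)%E.
  by rewrite lee_fin !mulr_ge0 ?invr_ge0//; lra.
have mball n : measurable (ball (z n) (s n) : set (borel X)) := ball_borel _ _.
apply: (@le_trans _ _ (\sum_(0 <= n <oo) mu (W n : set (borel X)))%E).
  apply: (measure_sigma_subadditive mu mW); last exact: subset_refl.
  exact: bigcupT_measurable.
apply: (@le_trans _ _ (\sum_(0 <= n <oo)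
    ((20 * cP * Lam / eps * K5 * d)%:E * mu (ball (z n) (s n))))%E).
  by apply: lee_nneseries => n _.
rewrite nneseriesZl//.
have -> : (20 * cP * Lam / eps * K5 * fine (mu (Om : set (borel X))) * d)%:E =
   ((20 * cP * Lam / eps * K5 * d)%:E * mu (Om : set (borel X)))%E.
  rewrite -[in RHS](@fineK _ (mu _)); last by rewrite ge0_fin_numE.
  by rewrite -EFinM; congr EFin; ring.
rewrite lee_wpmul2l//.
have := @measure_semi_bigcup _ _ _ mu (fun n => ball (z n) (s n)) mball tz.
move=> <-; last exact: bigcupT_measurable.
apply: le_measure; rewrite ?inE; [exact: bigcupT_measurable|exact: open_borel|].
move=> x [n _]; case: (zs n) => [->|[Ez sz]]; first by rewrite ball_le0.
have sn0 : 0 < s n by rewrite sz; case/andP: (hrad _ Ez).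
have [Oz _ _ _] := Ez; apply: ball_in => //.
have /andP[_ snd] := sle n.
have [] // := @r_le_SS (s n) (bdist (z n)) sn0; apply: small => //; lra.
Qed.

Lemma oscillating_null : exists2 W : set X, measurable (W : set (borel X)) &
  E `<=` W /\ mu (W : set (borel X)) = 0%E.
Proof.
have [d0 d00 [K K0 hK]] := oscillating_small.
have hn (n : nat) : 0 < d0 / n.+1%:R <= d0.
  by rewrite divr_gt0//= ler_pdivrMr// ler_peMr ?ler1n// ltW.
have /choice[W hW] : forall n : nat, exists W : set X, [/\ measurable (W : set (borel X)),
    E `<=` W & (mu (W : set (borel X)) <= (K * (d0 / n.+1%:R))%:E)%E].
  by move=> n; have /andP[h1 h2] := hn n; exact: hK.
exists (\bigcap_n W n).
  by apply: bigcapT_measurable => n; case: (hW n).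
split; first by move=> y Ey n _; case: (hW n) => _ h _; exact: h.
apply/eqP; rewrite eq_le measure_ge0 andbT; apply/lee_addgt0Pr => e e_gt0; rewrite add0e.
pose n := Num.Def.truncn (K * d0 / e).
have [mWn _ h] := hW n; apply: (@le_trans _ _ (mu (W n : set (borel X)))).
  apply: le_measure; rewrite ?inE//; last by move=> y; exact.
  by apply: bigcapT_measurable => m; case: (hW m).
apply: le_trans h _; rewrite lee_fin mulrA ler_pdivrMr// [e * _]mulrC -ler_pdivrMr//.
by apply/ltW/truncnS_gt.
Qed.

End lebesgue_points.

(* Points where the averages of U fail to converge to U at the rate given by the
   telescoping estimate oscillate by a fixed amount at all small scales. *)
Lemma good_lebesgue : exists2 K : R, 0 <= K & forall Lam, 0 < Lam ->
  exists2 N : set X, measurable (N : set (borel X)) /\ mu (N : set (borel X)) = 0%E &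
  forall y, Om y -> good Lam y -> ~ N y -> forall r, 0 < r -> 2 * S * S * r < bdist y ->
    `|U y - avg mu U y r| <= K * r * Lam.
Proof.
have [K K0 hT] := telescope; exists K => // Lam L0.
have en (n : nat) : 0 < n.+1%:R^-1 :> R by rewrite invr_gt0.
have /choice[W hW] : forall n : nat, exists W : set X, measurable (W : set (borel X)) /\
    ([set y | [/\ Om y, good Lam y, n.+1%:R^-1 <= bdist y &
       exists2 r, 0 < r & forall s, 0 < s -> s <= r ->
         n.+1%:R^-1 < `|U y - avg mu U y s|]] `<=` W /\ mu (W : set (borel X)) = 0%E).
  by move=> n; have [W ? ?] := oscillating_null L0 (en n) (en n); exists W.
exists (\bigcup_n W n); first split.
- by apply: bigcupT_measurable => n; case: (hW n).
- apply/eqP; rewrite eq_le measure_ge0 andbT.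
  apply: le_trans (measure_sigma_subadditive mu (fun n => (hW n).1) _ (@subset_refl _ _)) _.
    by apply: bigcupT_measurable => n; case: (hW n).
  by rewrite eseries0// => n _ _; case: (hW n) => _ [].
move=> y Oy gy nN r r0 hr; rewrite leNgt; apply/negP => hlt.
(* The excess [e] over the telescoping error persists at every smaller radius; [n] is such that
   [1 / (n + 1)] is below both [e] and [bdist y]. *)
apply: nN; pose e := `|U y - avg mu U y r| - K * r * Lam.
have e0 : 0 < e by rewrite subr_gt0.
have bd0 : 0 < bdist y by exact: bdist_gt0.
pose n := Num.Def.truncn (e^-1 + (bdist y)^-1).
have hn : e^-1 + (bdist y)^-1 < n.+1%:R by exact: truncnS_gt.
have ei0 : 0 < e^-1 by rewrite invr_gt0. have bi0 : 0 < (bdist y)^-1 by rewrite invr_gt0.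
exists n => //; have [_ [sub _]] := hW n; apply: sub; split => //.
  by rewrite invf_ple ?posrE//; lra.
exists r => // s s0 sr; apply: (@lt_le_trans _ _ e); first by rewrite invf_plt ?posrE//; lra.
have := hT Lam y s r (ltW L0) Oy gy s0 sr hr.
have := ler_normD (U y - avg mu U y s) (avg mu U y s - avg mu U y r).
have -> : U y - avg mu U y s + (avg mu U y s - avg mu U y r) = U y - avg mu U y r by ring.
by rewrite /e; move: (K * r * Lam) => *; lra.
Qed.

End good_points.

(** * The Whitney maximal function *)

Section whitney.
Context {R : realType} {X : completeMetricType R}.
Hypothesis sepX : separable X.
Variable mu : {measure set (borel X) -> \bar R}.
Hypotheses (hmu : locally_finite mu) (hd : doubling mu).
Variables (p q C Dm : R) (g : X -> \bar R) (Om : set X).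
Hypotheses (p0 : 0 < p) (q0 : 0 < q) (q8 : q <= 1 / 8) (C1 : 1 <= C).
Hypotheses (mg : measurable_fun [set: borel X] g) (g0 : forall x, (0 <= g x)%E).
Hypothesis gp : (\int[mu]_(x in [set: borel X]) (g x `^ p) < +oo)%E.
Hypotheses (oOm : open Om) (bOm : boundary Om !=set0).
Local Notation bdist := (bdist Om).
Hypothesis hDm : forall x, Om x -> bdist x <= Dm.

Let mgp : measurable_fun [set: borel X] (fun x => g x `^ p)%E.
Proof. exact: measurable_fun_poweR. Qed.

Let rad x := bdist x / 16.

Let hrad x : Om x -> 0 < rad x <= Dm / 16.
Proof.
by move=> Ox; rewrite divr_gt0 ?bdist_gt0//= ler_pdivrMr// divfK// hDm.
Qed.

Section cover.
Variables (z : nat -> X) (s : nat -> R).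
Hypothesis zs : forall n, s n = 0 \/ Om (z n) /\ s n = rad (z n).
Hypothesis tz : trivIset [set: nat] (fun n => ball (z n) (s n)).
Let d n := 16 * s n.

Let dE n x r : ball (z n) (r * d n) x -> Om (z n) /\ d n = bdist (z n).
Proof.
case: (zs n) => [e|[Oz e]]; first by rewrite /d e !mulr0 ball_le0.
by move=> _; split => //; rewrite /d e /rad mulrC divfK.
Qed.

(** If [x] lies in a half-size Whitney ball, the radius of that ball is comparable to [bdist x]. The
    corresponding Vitali balls are disjoint, lie in one ball about [x], and each has a fixed
    fraction of its volume. *)
Lemma whitney_overlap : exists2 K : R, 0 <= K & forall n x,
  \sum_(0 <= k < n) (\1_(ball (z k) (1 / 2 * d k)) x : R) <= K.
Proof.
have [K K1 hK] := vol_compare hmu hd 128; exists K; first by lra.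
move=> n x; set b := bdist x.
have inb k : ball (z k) (1 / 2 * d k) x ->
    [/\ 0 < d k, d k <= 2 * b, b <= 2 * d k & mdist (z k) x < 1 / 2 * d k].
  move=> h; have [Oz dz] := dE h.
  move: h; rewrite ballEmdist /= => h.
  have dk0 : 0 < d k by rewrite dz bdist_gt0.
  have := bdist_triangle bOm x (z k); have := bdist_triangle bOm (z k) x.
  by rewrite [mdist x (z k)]metric_sym -dz -/b => h1 h2; split => //; lra.
have [b0|b0] := leP b 0.
  rewrite big1; first by lra.
  move=> k _; rewrite indicE memNset// => /inb[h1 h2 _ _]; lra.
pose Ck k : set X := if x \in (ball (z k) (1 / 2 * d k) : set X) then ball (z k) (s k) else set0.
have mC k : measurable (Ck k : set (borel X)).
  by rewrite /Ck; case: ifP => // _; exact: ball_borel.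
have tC : trivIset [set: nat] Ck.
  move=> i j _ _ [w []]; rewrite /Ck; case: ifP => // _; case: ifP => // _ wj wi.
  by apply: tz => //; exists w.
have Csub : \bigcup_k Ck k `<=` ball x (2 * b).
  move=> w [k _]; rewrite /Ck; case: ifPn => // /set_mem /inb[h1 h2 h3 h4].
  by apply: ball_subset; rewrite metric_sym; move: h1 h2 h3 h4; rewrite /d; lra.
have v0 : 0 < vol mu x (2 * b) by apply: vol_gt0 => //; lra.
have h : \sum_(0 <= k < n) (\1_(ball (z k) (1 / 2 * d k)) x : R) * vol mu x (2 * b) <=
    K * \sum_(0 <= k < n) fine (mu (Ck k : set (borel X))).
  rewrite mulr_sumr; apply: ler_sum => k _; rewrite indicE /Ck.
  case: ifPn => [/[dup] xin /set_mem /inb[h1 h2 h3 h4]|xin]; last first.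
    by rewrite mul0r measure0 mulr0.
  rewrite mul1r; apply: hK; first by move: h1; rewrite /d; lra.
  by move: h1 h2 h3 h4; rewrite /d; lra.
have h' : \sum_(0 <= k < n) fine (mu (Ck k : set (borel X))) <= vol mu x (2 * b).
  rewrite -lee_fin -sumEFin -(vol_fin hmu hd).
  have -> : (\sum_(0 <= k < n) (fine (mu (Ck k : set (borel X))))%:E =
             \sum_(0 <= k < n) mu (Ck k : set (borel X)))%E.
    apply: eq_bigr => k _; rewrite fineK// ge0_fin_numE// /Ck.
    by case: ifP => _; [exact: mu_ball_lty|rewrite measure0].
  apply: le_trans (nneseries_lim_ge n _) _ => //.
  have := @measure_semi_bigcup _ _ _ mu Ck mC tC => <-; last exact: bigcupT_measurable.
  apply: le_measure; rewrite ?inE//; first exact: bigcupT_measurable.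
  exact: ball_borel.
rewrite -(ler_pM2r v0) mulr_suml; apply: le_trans h _.
by rewrite ler_wpM2l//; lra.
Qed.

Let mball n r : measurable (ball (z n) r : set (borel X)). Proof. exact: ball_borel. Qed.

(** Doubling compares the volume of the large ball with the denominator of the average, leaving the
    integrals of [g^p] over the half-size balls, whose overlap is bounded. *)
Lemma whitney_sum_lty : (\sum_(0 <= n <oo)
  ((gavg mu p g (z n) (1 / 2 * d n))%:E * mu (ball (z n) ((4 * C + 1) * d n)))%E < +oo)%E.
Proof.
have [K K0 hov] := whitney_overlap.
have [K' K'1 hK'] := vol_compare hmu hd (2 * (4 * C + 1)).
have := C1 => C1'.
apply: (@le_lt_trans _ _ (\sum_(0 <= n <oo) (K'%:E *
  \int[mu]_(x in [set: borel X]) ((g x `^ p) * (\1_(ball (z n) (1 / 2 * d n)) x : R)%:E)))%E).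
  apply: lee_nneseries => n _.
    by move=> _; rewrite mule_ge0// lee_fin gavg_ge0.
  have -> : (\int[mu]_(x in [set: borel X]) ((g x `^ p) * (\1_(ball (z n) (1 / 2 * d n)) x : R)%:E) =
     (gmass mu p g (z n) (1 / 2 * d n))%:E)%E.
    rewrite -gmass_fin// [RHS]integral_mkcond; apply: eq_integral => x _.
    by rewrite patchE indicE; case: ifP => _; rewrite ?mule1 ?mule0.
  rewrite vol_fin// -!EFinM lee_fin.
  case: (zs n) => [e|[Oz e]].
    rewrite /d e !mulr0 [vol _ _ _]vol_le0// mulr0 mulr_ge0 ?gmass_ge0//; lra.
  have dn0 : 0 < 1 / 2 * d n.
    by rewrite /d e /rad; have := bdist_gt0 oOm bOm Oz; lra.
  have v0 := vol_gt0 hmu hd (z n) dn0.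
  rewrite /gavg [leLHS]mulrAC ler_pdivrMr// [leRHS]mulrAC [leLHS]mulrC.
  apply: ler_wpM2r; first exact: gmass_ge0.
  by apply: hK' => //; rewrite mdistxx add0r; lra.
rewrite nneseriesZl; last first.
  by move=> n _; apply: integral_ge0 => x _; rewrite mule_ge0 ?poweR_ge0// lee_fin.
rewrite lte_mul_pinfty ?lee_fin//; first by lra.
rewrite -integral_nneseries//; last 2 first.
- move=> n; apply: emeasurable_funM => //; apply/measurable_EFinP.
  by apply: measurable_indic.
- by move=> n x _; rewrite mule_ge0 ?poweR_ge0// lee_fin.
apply: (@le_lt_trans _ _ (\int[mu]_(x in [set: borel X]) (K%:E * g x `^ p))%E).
  apply: ge0_le_integral => //.
  - by move=> x _; apply: nneseries_ge0 => n _ _; rewrite mule_ge0 ?poweR_ge0// lee_fin.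
  - apply: ge0_emeasurable_sum => n.
    + by move=> x _ _; rewrite mule_ge0 ?poweR_ge0// lee_fin.
    + move=> _; apply: emeasurable_funM => //; apply/measurable_EFinP.
      exact: measurable_indic.
  - exact: emeasurable_funM.
  - move=> x _; apply: nneseries_le_bound => n.
      by rewrite mule_ge0 ?poweR_ge0// lee_fin.
    rewrite -ge0_sume_distrr; last by move=> k _; rewrite lee_fin.
    by rewrite sumEFin muleC lee_wpmul2r ?poweR_ge0// lee_fin.
rewrite ge0_integralZl//; last by move=> x _; exact: poweR_ge0.
by rewrite lte_mul_pinfty// lee_fin.
Qed.

End cover.

(** [F] is a fixed sum over a Whitney cover. The centre of a cover ball near [y] has comparable
    depth, so the average about [y] is bounded by the average about that centre. Nothing here
    depends on a lower bound for the depth of [y]. *)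
Lemma whitney_dominant : exists F : X -> \bar R,
  [/\ measurable_fun [set: borel X] F, forall x, (0 <= F x)%E,
      (\int[mu]_(x in [set: borel X]) F x < +oo)%E &
      forall y x, Om y -> mdist x y < 2 * C * bdist y ->
        ((gavg mu p g y (q * bdist y))%:E <= F x)%E].
Proof.
have [z [s [zs tz cov]]] := vitali_covering sepX hrad.
have := C1 => C1'; have := q0 => q0'; have := q8 => q8'.
pose d n := 16 * s n.
have [K K1 hK] := vol_compare hmu hd (3 / q).
have mball n r : measurable (ball (z n) r : set (borel X)) := ball_borel _ _.
pose T n x := ((gavg mu p g (z n) (1 / 2 * d n))%:E *
  (\1_(ball (z n) ((4 * C + 1) * d n)) x : R)%:E)%E.
have T0 n x : (0 <= T n x)%E by rewrite mule_ge0// lee_fin// gavg_ge0.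
have mT n : measurable_fun [set: borel X] (T n).
  by apply: emeasurable_funM => //; apply/measurable_EFinP; exact: measurable_indic.
have mS : measurable_fun [set: borel X] (fun x => \sum_(0 <= n <oo) T n x)%E.
  by apply: ge0_emeasurable_sum.
have S0 x : (0 <= \sum_(0 <= n <oo) T n x)%E by apply: nneseries_ge0.
have K0 : (0 <= K%:E)%E by rewrite lee_fin; lra.
exists (fun x => K%:E * \sum_(0 <= n <oo) T n x)%E; split.
- exact: emeasurable_funM.
- by move=> x; rewrite mule_ge0.
- rewrite ge0_integralZl// lte_mul_pinfty//.
  rewrite integral_nneseries//.
  have -> : (\sum_(0 <= n <oo) \int[mu]_(x in [set: borel X]) T n x =
     \sum_(0 <= n <oo) ((gavg mu p g (z n) (1 / 2 * d n))%:E *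
        mu (ball (z n) ((4 * C + 1) * d n))))%E.
    apply: eq_eseriesr => n _; rewrite ge0_integralZl//=.
    + by rewrite integral_indic// setIT.
    + by apply/measurable_EFinP; exact: measurable_indic.
    + by rewrite lee_fin gavg_ge0.
  exact: (whitney_sum_lty zs tz).
move=> y x Oy xy; have [n [Oz sz ry yz]] := cov y Oy.
have dz : d n = bdist (z n) by rewrite /d sz /rad mulrC divfK.
have dn0 : 0 < d n by rewrite dz bdist_gt0.
have by0 : 0 < bdist y by exact: bdist_gt0.
rewrite /rad in yz; have snd : s n = d n / 16 by rewrite /d mulrC mulKf.
have t1 := bdist_triangle bOm y (z n); have t2 := bdist_triangle bOm (z n) y.
rewrite [mdist (z n) y]metric_sym -dz in t2; rewrite -dz in t1.
have b1 : bdist y <= 2 * d n by rewrite snd in yz; lra.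
have b2 : d n <= 2 * bdist y by rewrite snd in yz; lra.
apply: (@le_trans _ _ (K%:E * T n x)%E); last first.
  by rewrite lee_wpmul2l//; exact: (@nneseries_ge_term R (T^~ x) n).
(* The factor [4 * C + 1] arises from [mdist x y < 2 * C * bdist y <= 4 * C * d n] and [y] being
   within [d n] of the centre. *)
have xin : ball (z n) ((4 * C + 1) * d n) x.
  rewrite ballEmdist /= metric_sym; have := metric_triangle x y (z n).
  have : 2 * C * bdist y <= 2 * C * (2 * d n) by rewrite ler_wpM2l//; lra.
  have -> : (4 * C + 1) * d n = 2 * C * (2 * d n) + d n by ring.
  by rewrite snd in yz; lra.
rewrite /T indicE mem_set// mule1 -EFinM lee_fin.
have qb0 : 0 < q * bdist y by rewrite mulr_gt0.
have qb : q * bdist y <= bdist y / 8.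
  by rewrite [leRHS]mulrC; apply: ler_wpM2r; [exact: ltW|lra].
rewrite /gavg ler_pdivrMr ?vol_gt0//.
have v0 : 0 < vol mu (z n) (1 / 2 * d n) by apply: vol_gt0 => //; lra.
have hsub : gmass mu p g y (q * bdist y) <= gmass mu p g (z n) (1 / 2 * d n).
  apply: gmass_subset => //; apply: ball_subset; rewrite metric_sym.
  by rewrite snd in yz; lra.
have hv : vol mu (z n) (1 / 2 * d n) <= K * vol mu y (q * bdist y).
  apply: hK => //; rewrite mulrA divfK ?gt_eqF//.
  by rewrite snd in yz; lra.
apply: le_trans hsub _.
rewrite -{1}(@divfK _ (vol mu (z n) (1 / 2 * d n)) _ (gmass _ _ _ _ _)) ?gt_eqF//.
rewrite [leRHS]mulrAC [leRHS]mulrC; apply: ler_wpM2l => //.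
by rewrite divr_ge0 ?gmass_ge0 ?vol_ge0.
Qed.

Variables (x0 : X) (k eta : R).
Hypotheses (Ox0 : Om x0) (hk : forall x y, Om x -> Om y -> mdist x y <= k) (eta0 : 0 < eta).

(** Adjoining 0 keeps the supremum meaningful and nonnegative when no ball qualifies; the lower
    bound [eta] on the depth makes the set bounded. *)
Definition whitney_set (x : X) : set R :=
  [set 0] `|` [set (gavg mu p g y (q * bdist y)) `^ p^-1 | y in
     [set y | [/\ Om y, eta <= bdist y & mdist x y < 2 * C * bdist y]]].

Definition whitney_max (x : X) : R := sup (whitney_set x).

Lemma whitney_bounded : exists2 B : R, 0 <= B & forall x, ubound (whitney_set x) B.
Proof.
have k0 : 0 <= k by have := hk Ox0 Ox0; rewrite mdistxx.
have [K K1 hK] := vol_compare hmu hd ((k + 1) / (q * eta)).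
have qe0 : 0 < q * eta by rewrite mulr_gt0.
pose I := fine (\int[mu]_(x in [set: borel X]) (g x `^ p))%E.
have v1 : 0 < vol mu x0 1 by exact: vol_gt0.
have I0 : 0 <= I by rewrite fine_ge0// integral_ge0// => x _; exact: poweR_ge0.
pose B := ((I * K / vol mu x0 1) `^ p^-1); exists B; first exact: powR_ge0.
move=> x _ [->|[y [Oy ey _] <-]]; first exact: powR_ge0.
apply: ge0_ler_powR; rewrite ?nnegrE ?gavg_ge0 ?invr_ge0 ?(ltW p0)//.
  by rewrite divr_ge0 ?(ltW v1)// mulr_ge0//; lra.
have qy0 : 0 < q * bdist y by rewrite mulr_gt0// bdist_gt0.
rewrite /gavg ler_pdivrMr ?vol_gt0// mulrAC ler_pdivlMr//.
have h1 : gmass mu p g y (q * bdist y) <= I.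
  rewrite -lee_fin -gmass_fin// fineK; last first.
    by rewrite ge0_fin_numE// integral_ge0// => w _; exact: poweR_ge0.
  apply: ge0_subset_integral => //; first exact: ball_borel.
  by move=> w _; exact: poweR_ge0.
have h2 : vol mu x0 1 <= K * vol mu y (q * bdist y).
  apply: hK => //; apply: (@le_trans _ _ (k + 1)); first by rewrite lerD2r hk.
  by rewrite mulrAC ler_pdivlMr// ler_wpM2l ?ler_pM2l//; lra.
have -> : I * K * vol mu y (q * bdist y) = I * (K * vol mu y (q * bdist y)) by ring.
by apply: ler_pM => //; [exact: gmass_ge0|exact: ltW].
Qed.

Lemma whitney_max_ge0 x : 0 <= whitney_max x.
Proof.
by have [B _ hB] := whitney_bounded; apply: ub_le_sup; [exists B; exact: hB|left].
Qed.

Lemma whitney_max_ge x y : Om y -> eta <= bdist y -> mdist x y < 2 * C * bdist y ->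
  (gavg mu p g y (q * bdist y)) `^ p^-1 <= whitney_max x.
Proof.
move=> Oy ey xy; have [B _ hB] := whitney_bounded.
by apply: ub_le_sup; [exists B; exact: hB|right; exists y].
Qed.

Lemma whitney_max_bounded : exists2 B : R, 0 <= B & forall x, whitney_max x <= B.
Proof.
have [B B0 hB] := whitney_bounded; exists B => // x.
by apply: ge_sup; [exists 0; left|exact: hB].
Qed.

(** Superlevel sets at nonnegative heights are unions of open balls about the admissible centres, so
    the function is lower semicontinuous. *)
Lemma whitney_max_measurable :
  measurable_fun [set: borel X] (whitney_max : borel X -> R).
Proof.
have [B _ hB] := whitney_bounded.
apply: (measurability _ (RGenOInfty.measurableE R)) => _ [_ [t ->] <-].
rewrite setTI; apply: open_borel.
have [t0|t0] := ltP t 0.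
  rewrite (_ : _ @^-1` _ = [set: X]); first exact: openT.
  apply/seteqP; split => // x _; rewrite /= in_itv /= andbT.
  exact: lt_le_trans (whitney_max_ge0 x).
rewrite (_ : _ @^-1` _ = \bigcup_(y in [set y | [/\ Om y, eta <= bdist y &
    t < (gavg mu p g y (q * bdist y)) `^ p^-1]]) ball y (2 * C * bdist y)).
  by apply: bigcup_open => y _; exact: ball_open.
apply/seteqP; split => x /=; rewrite in_itv /= andbT.
  move=> /(sup_gt (ex_intro _ 0 (or_introl erefl)))[_ [->|[y [Oy ey xy] <-]] ty].
    by rewrite ltNge t0 in ty.
  by exists y => //; rewrite ballEmdist /= metric_sym.
move=> [y [Oy ey ty]]; rewrite ballEmdist /= metric_sym => xy.
exact: lt_le_trans ty (whitney_max_ge Oy ey xy).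
Qed.

Lemma whitney_max_dominated (F : X -> \bar R) x : (0 <= F x)%E ->
  (forall y, Om y -> mdist x y < 2 * C * bdist y ->
    ((gavg mu p g y (q * bdist y))%:E <= F x)%E) ->
  ((whitney_max x `^ p)%:E <= F x)%E.
Proof.
move=> F0 hF; have [->|Fy] := eqVneq (F x) +oo%E; first by rewrite leey.
have Ff : F x \is a fin_num by rewrite ge0_fin_numE// ltey.
have f0 : 0 <= fine (F x) by rewrite fine_ge0.
rewrite -(fineK Ff) lee_fin.
have -> : fine (F x) = (fine (F x) `^ p^-1) `^ p.
  by rewrite -powRrM mulVf ?gt_eqF// powRr1.
apply: ge0_ler_powR; rewrite ?nnegrE ?whitney_max_ge0 ?powR_ge0 ?(ltW p0)//.
apply: ge_sup; first by exists 0; left.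
move=> _ [->|[y [Oy ey xy] <-]]; first exact: powR_ge0.
apply: ge0_ler_powR; rewrite ?nnegrE ?gavg_ge0 ?invr_ge0 ?(ltW p0)//.
by rewrite -lee_fin fineK//; exact: hF.
Qed.

End whitney.

Lemma itg_affine (R : realType) (a c s t : R) (W : R -> R) : 0 <= a -> 0 <= c ->
  measurable_fun setT W -> (forall x, 0 <= W x) -> s <= t ->
  itg (fun x => (a + c * W x)%:E) s t =
  ((a * (t - s))%:E + c%:E * itg (EFin \o W) s t)%E.
Proof.
move=> a0 c0 mW W0 st.
have mE : measurable_fun `[s, t] (EFin \o W).
  by apply: measurable_funTS; exact/measurable_EFinP.
rewrite EFinM -itg_cst// /itg -ge0_integralZl//=; last by move=> x _; rewrite lee_fin.
rewrite -ge0_integralD//=; first by move=> x _; rewrite -EFinM lee_fin mulr_ge0.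
by apply: emeasurable_funM.
Qed.

(** * Differences of the representative between good points *)

Section oscillation_along_curves.
Context {R : realType} {X : completeMetricType R}.
Variable mu : {measure set (borel X) -> \bar R}.
Hypotheses (hmu : locally_finite mu) (hd : doubling mu).
Variables (p cP sigma S : R) (g : X -> \bar R) (U : X -> R) (Om : set X).
Hypotheses (p0 : 0 < p) (cP0 : 0 < cP) (sigma0 : 0 < sigma) (S1 : 1 <= S).
Hypothesis sigmaS : 5 * sigma <= S.
Hypotheses (mg : measurable_fun [set: borel X] g) (g0 : forall x, (0 <= g x)%E).
Hypothesis gp : (\int[mu]_(x in [set: borel X]) (g x `^ p) < +oo)%E.
Hypothesis mU : measurable_fun [set: borel X] (U : borel X -> R).
Hypothesis iU : mu.-integrable [set: borel X] (EFin \o (U : borel X -> R)).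
Hypotheses (oOm : open Om) (bOm : boundary Om !=set0).
Local Notation bdist := (bdist Om).
Hypothesis PI : forall x r, Om x -> 0 < r -> 2 * S * S * r < bdist x ->
  osc mu U x r <= 2 * cP * r * (gavg mu p g x (5 * sigma * r)) `^ p^-1.
Variables (M : metricType R) (f : M -> X) (C : R).
Hypothesis fbij : set_bij [set: M] Om f.
Hypothesis fdist : forall a b, internal_dist Om (f a) (f b) = (mdist a b)%:E.
Hypothesis geo : forall x y, Om x -> Om y -> exists G, qh_geodesic Om x y G.
Hypotheses (C1 : 1 <= C) (sepOm : ball_separation C Om) (ghOm : gehring_hayman C Om).
Variable k : R.
Hypothesis hk : forall x y, Om x -> Om y -> mdist x y <= k.

(* With this radius ratio, balls of radius 2 * whitney_ratio * bdist are small
   enough for the Poincare inequality inside the domain. *)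
Definition whitney_ratio := (16 * S ^+ 2)^-1.
Local Notation kap := whitney_ratio.
(** At radius [2 * kap * bdist] the Poincare inequality involves the ball of radius [q * bdist]. The
    step ratio [c3] below is small enough that consecutive Whitney balls lie in one such doubled
    ball. *)
Let q := 10 * sigma * kap.
Let c3 := kap / 3.

Let S0 : 0 < S. Proof. by have := S1; lra. Qed.
Let kap0 : 0 < kap. Proof. by rewrite invr_gt0 mulr_gt0// exprn_gt0. Qed.
Let kapS : S * S * kap = 1 / 16.
Proof. by rewrite /kap; field; rewrite gt_eqF. Qed.
Let SS1 : 1 <= S * S. Proof. by have := S1; nra. Qed.
Let kap16 : kap <= 1 / 16.
Proof. by rewrite -kapS ler_peMl// ltW. Qed.

Lemma whitney_ratio_le : 0 < 10 * sigma * kap <= 1 / 8.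
Proof.
rewrite !mulr_gt0//=; have := kapS; have := sigmaS; have := S1; have := kap0.
move=> h1 h2 h3 h4.
have : 5 * sigma * kap <= S * kap by rewrite ler_pM2r.
have : S * kap <= S * S * kap by rewrite ler_pM2r// ler_peMl// ltW.
lra.
Qed.

Let m z := avg mu U z (kap * bdist z).

(** Both averages are compared with the average over the ball of radius [2 * kap * bdist z] about
    [z], where the Poincare inequality applies. *)
Lemma whitney_avg_diff : exists2 K : R, 0 <= K & forall z z', Om z -> Om z' ->
  mdist z z' <= c3 * bdist z ->
  `|m z - m z'| <= bdist z * (K * (gavg mu p g z (q * bdist z)) `^ p^-1).
Proof.
have [K K1 hK] := avg_avg_compare hmu hd mU iU 3.
have := cP0 => cP0'; have := kap0 => kap0'; have := kap16 => kap16'.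
exists (8 * K * cP * kap); first by rewrite !mulr_ge0//; lra.
move=> z z' Oz Oz' zz'.
have b0 : 0 < bdist z by exact: bdist_gt0.
have t1 := bdist_triangle bOm z z'; have t2 := bdist_triangle bOm z' z.
rewrite [mdist z' z]metric_sym in t2.
have c3b : c3 * bdist z <= bdist z / 48 by rewrite /c3; nra.
have kb0 : 0 < kap * bdist z by rewrite mulr_gt0.
have kb'0 : 0 < kap * bdist z' by rewrite mulr_gt0// bdist_gt0.
have e3 : c3 * bdist z = kap * bdist z / 3 by rewrite /c3; ring.
have h1 : `|m z - avg mu U z (2 * (kap * bdist z))| <= K * osc mu U z (2 * (kap * bdist z)).
  by apply: hK => //; [rewrite mdistxx; lra|lra].
have kb' : kap * bdist z' <= 49 / 48 * (kap * bdist z).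
  have : bdist z' <= 49 / 48 * bdist z by lra.
  by move=> h; rewrite mulrCA ler_pM2l.
have kb'' : 47 / 48 * (kap * bdist z) <= kap * bdist z'.
  have : 47 / 48 * bdist z <= bdist z' by lra.
  by move=> h; rewrite mulrCA ler_pM2l.
have h2 : `|m z' - avg mu U z (2 * (kap * bdist z))| <= K * osc mu U z (2 * (kap * bdist z)).
  apply: hK => //; first by move: zz'; rewrite e3; lra.
  by lra.
have h3 : osc mu U z (2 * (kap * bdist z)) <=
    2 * cP * (2 * (kap * bdist z)) * (gavg mu p g z (q * bdist z)) `^ p^-1.
  have -> : q * bdist z = 5 * sigma * (2 * (kap * bdist z)) by rewrite /q; ring.
  apply: PI => //; first by lra.
  have -> : 2 * S * S * (2 * (kap * bdist z)) = 4 * (S * S * kap) * bdist z by ring.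
  by rewrite kapS; lra.
have h4 : `|m z - m z'| <= 2 * K * osc mu U z (2 * (kap * bdist z)).
  move: h1 h2; set w := avg _ _ _ _ => h1 h2.
  by have := ler_distD w (m z) (m z'); rewrite [`|w - _|]distrC; lra.
apply: le_trans h4 _.
have -> : bdist z * (8 * K * cP * kap * gavg mu p g z (q * bdist z) `^ p^-1) =
  2 * K * (2 * cP * (2 * (kap * bdist z)) * (gavg mu p g z (q * bdist z)) `^ p^-1) by ring.
by rewrite ler_wpM2l//; lra.
Qed.

Definition lebesgue_point (KL Lam : R) (y : X) := forall r, 0 < r ->
  2 * S * S * r < bdist y -> `|U y - avg mu U y r| <= KL * r * Lam.

(** Compare through the balls of radius [d] about [y'] and [2 * d] about [y], with [d] the distance
    of the points; the second contains the first, and goodness of [y] controls its oscillation. *)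
Lemma near_difference (KL : R) : 0 <= KL -> exists2 K : R, 0 <= K & forall (Lam : R) y y',
  0 <= Lam -> Om y -> Om y' -> good mu p g Om Lam y ->
  lebesgue_point KL Lam y -> lebesgue_point KL Lam y' ->
  mdist y y' <= c3 * bdist y -> `|U y - U y'| <= K * Lam * mdist y y'.
Proof.
move=> KL0; have [K K1 hK] := avg_avg_compare hmu hd mU iU 2.
have := cP0 => cP0'; have := kap0 => kap0'; have := kap16 => kap16'.
exists (3 * KL + 4 * K * cP); first by rewrite addr_ge0// !mulr_ge0//; lra.
move=> Lam y y' L0 Oy Oy' gy ly ly' yy'.
have b0 : 0 < bdist y by exact: bdist_gt0.
have [->|neq] := eqVneq y y'; first by rewrite subrr normr0 mdistxx mulr0.
set d := mdist y y' in yy' *.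
have d0 : 0 < d by rewrite mdist_gt0.
have t1 := bdist_triangle bOm y y'; rewrite -/d in t1.
have SSd : S * S * d <= bdist y / 48.
  have : S * S * d <= S * S * (c3 * bdist y) by rewrite ler_pM2l// mulr_gt0.
  have -> : S * S * (c3 * bdist y) = (S * S * kap) * bdist y / 3 by rewrite /c3; ring.
  by rewrite kapS; lra.
have dd : d <= S * S * d by rewrite ler_peMl// ltW.
have h1 : `|U y - avg mu U y (2 * d)| <= KL * (2 * d) * Lam.
  apply: ly; first by lra.
  by have -> : 2 * S * S * (2 * d) = 4 * (S * S * d); [ring|lra].
have h2 : `|U y' - avg mu U y' d| <= KL * d * Lam.
  apply: ly' => //.
  by have -> : 2 * S * S * d = 2 * (S * S * d); [ring|lra].
have h3 : `|avg mu U y' d - avg mu U y (2 * d)| <= K * osc mu U y (2 * d).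
  by apply: hK => //; rewrite -/d; lra.
have h4 : osc mu U y (2 * d) <= 2 * cP * (2 * d) * Lam.
  apply: (@osc_good _ _ mu hmu hd p cP sigma S g U Om) => //; first by lra.
  by have -> : 2 * S * S * (2 * d) = 4 * (S * S * d); [ring|lra].
have h5 : K * osc mu U y (2 * d) <= K * (2 * cP * (2 * d) * Lam).
  by rewrite ler_wpM2l//; lra.
have -> : (3 * KL + 4 * K * cP) * Lam * d =
  KL * (2 * d) * Lam + KL * d * Lam + K * (2 * cP * (2 * d) * Lam) by ring.
move: h1 h2 h3 h5; set w := avg _ _ y' _; set w' := avg _ _ y _ => h1 h2 h3 h5.
have := ler_distD w' (U y) (U y'); have := ler_distD w w' (U y').
rewrite [`|w' - w|]distrC [`|w - U y'|]distrC; lra.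
Qed.

Local Notation wmax eta := (whitney_max mu p q C g Om (eta / (1 + C))).

(** When the points are closer than [c3 * bdist y], the Lipschitz estimate is paid for by the
    constant part of the integrand. Otherwise [U] is replaced by Whitney averages at both ends,
    again at the expense of the constant part, and the averages are compared by the chain. *)
Lemma difference_along_curve (KL : R) : 0 <= KL ->
  exists K : R, 0 <= K /\ forall (Lam eta : R) (x0 : M) (T : R) y y' (h : R -> X) (tau : R),
  0 <= Lam -> 0 < eta -> 0 <= T -> good mu p g Om Lam y ->
  lebesgue_point KL Lam y -> lebesgue_point KL Lam y' ->
  (f @` core Om f x0 T eta) y -> (f @` core Om f x0 T eta) y' ->
  0 <= tau -> lip1 h -> (forall t, Om (h t)) -> h 0 = y -> h tau = y' ->
  (`|U y - U y'|%:E <= itg (fun t => (K * (Lam + wmax eta (h t)))%:E) 0 tau)%E.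
Proof.
move=> KL0; have [Kn Kn0 near_] := near_difference KL0.
have [Km Km0 hm] := whitney_avg_diff.
have := cP0 => cP0'; have := kap0 => kap0'; have := kap16 => kap16'; have := C1 => C1'.
have c30 : 0 < c3 by rewrite divr_gt0.
have c31 : c3 <= 1 by rewrite /c3; lra.
have c3i : 0 < c3^-1 by rewrite invr_gt0.
pose CC := chain_constant C c3.
have CC0 : 0 <= CC.
  rewrite /CC /chain_constant; have c3' : 0 <= c3 by lra.
  by rewrite !mulr_ge0 ?invr_ge0 ?mulr_ge0 ?addr_ge0 ?mulr_ge0 ?sqr_ge0//; lra.
(* Passing to Whitney averages costs [KL * kap * Lam] times [bdist y + bdist y'], and for distant
   points this sum is at most [(2 / c3 + 1) * tau]. *)
pose Kf := KL * kap * (2 * c3^-1 + 1).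
have Kf0 : 0 <= Kf by rewrite /Kf !mulr_ge0//; lra.
exists (Kn + Kf + CC * Km); split; first by rewrite !addr_ge0// mulr_ge0.
move=> Lam eta x0 T y y' h tau L0 eta0 T0 gy ly ly' [a [P [Pl P0 PT Pe]] fa]
  [a' [P' [P'l P'0 P'T P'e]] fa'] tau0 hl hO h0 htau.
have Oy : Om y by rewrite -h0.
have Oy' : Om y' by rewrite -htau.
have eC0 : 0 < eta / (1 + C) by rewrite divr_gt0//; lra.
have [q0 q8] := andP whitney_ratio_le.
pose W := wmax eta.
have W0 x : 0 <= W x by apply: (whitney_max_ge0 hmu hd C p0 q0 mg gp oOm bOm Oy hk eC0).
have mW : measurable_fun [set: borel X] (W : borel X -> R).
  exact: (whitney_max_measurable hmu hd C p0 q0 mg gp oOm bOm Oy hk eC0).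
have mWh : measurable_fun setT (fun t => W (h t)).
  exact: (measurableT_comp mW (lip1_measurable hl)).
pose K := Kn + Kf + CC * Km.
rewrite -/K (eq_itg (G := fun t => (K * Lam + K * W (h t))%:E)); last first.
  by move=> t _; rewrite mulrDr.
have K0 : 0 <= K by rewrite /K !addr_ge0// mulr_ge0.
rewrite itg_affine ?mulr_ge0// subr0.
have I0 : (0 <= itg (EFin \o (fun t => W (h t))) 0 tau)%E.
  by apply: itg_ge0 => t; rewrite lee_fin.
have dtau : mdist y y' <= tau.
  by rewrite -h0 -htau; apply: le_trans (hl _ _) _; rewrite sub0r normrN ger0_norm.
have [near|far] := leP (mdist y y') (c3 * bdist y).
  apply: (@le_trans _ _ (K * Lam * tau)%:E); last by rewrite leeDl// mule_ge0// lee_fin.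
  rewrite lee_fin; apply: le_trans (near_ _ _ _ L0 Oy Oy' gy ly ly' near) _.
  apply: ler_pM => //; [by rewrite mulr_ge0|exact: mdist_ge0|].
  rewrite ler_wpM2r// /K -addrA lerDl addr_ge0// mulr_ge0//.
have chain : (`|m y - m y'|%:E <= CC%:E * itg (EFin \o (fun t => Km * W (h t))%R) 0 tau)%E.
  (* The deep curve: back from [y] to [x0] on [[-T, 0]] along the reversed core path, then from [x0]
     to [y'] on [[0, T]]. *)
  pose kk := glue 0 (fun t => f (P (0 - t))) (fun t => f (P' t)).
  apply: (@chain_estimate _ _ Om M f C oOm bOm fbij fdist geo C1 sepOm ghOm c3 eta tau
    y y' h kk (- T) T (fun z => Km * (gavg mu p g z (q * bdist z)) `^ p^-1)) => //.
  - apply: lip1_glue; rewrite ?subr0 ?P0 ?P'0//.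
      exact: (internal_embed_lip1 fdist (lip1_flip 0 Pl)).
    exact: (internal_embed_lip1 fdist P'l).
  - by move=> t; rewrite /kk /glue; case: ifP => _; exact: (internal_embed fbij).
  - by rewrite /kk /glue oppr_le0 T0 sub0r opprK PT.
  - rewrite /kk /glue; case: ifPn => [T0'|_]; last by rewrite P'T.
    have T00 : T = 0 by apply/eqP; rewrite eq_le T0' T0.
    by rewrite -fa' -P'T T00 subr0 P0 P'0.
  - by lra.
  - by move=> t; rewrite /kk /glue; case: ifP => _.
  - by move=> z; rewrite mulr_ge0// powR_ge0.
  - move=> z t Oz ez hz; rewrite ler_wpM2l//.
    exact: (whitney_max_ge hmu hd p0 q0 mg gp oOm bOm Oy hk eC0 Oz ez hz).
  - exact: measurable_funM.
  - by move=> t; rewrite mulr_ge0.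
have dist_m z : Om z -> lebesgue_point KL Lam z -> `|U z - m z| <= KL * (kap * bdist z) * Lam.
  move=> Oz; apply; first by rewrite mulr_gt0// bdist_gt0.
  have -> : 2 * S * S * (kap * bdist z) = 2 * (S * S * kap) * bdist z by ring.
  by rewrite kapS; have := bdist_gt0 oOm bOm Oz; lra.
have uy := dist_m y Oy ly; have uy' := dist_m y' Oy' ly'.
have by1 : bdist y <= c3^-1 * tau.
  by rewrite mulrC ler_pdivlMr// mulrC; lra.
have by2 : bdist y' <= c3^-1 * tau + tau.
  by have := bdist_triangle bOm y' y; rewrite metric_sym; lra.
have sum_le : KL * (kap * bdist y) * Lam + KL * (kap * bdist y') * Lam <= Kf * Lam * tau.
  have -> : KL * (kap * bdist y) * Lam + KL * (kap * bdist y') * Lam =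
    KL * kap * Lam * (bdist y + bdist y') by ring.
  have -> : Kf * Lam * tau = KL * kap * Lam * (2 * c3^-1 * tau + tau) by rewrite /Kf; ring.
  by rewrite ler_wpM2l ?mulr_ge0//; lra.
have Kle : Kf * Lam * tau <= K * Lam * tau.
  by rewrite !ler_wpM2r// /K -addrA addrCA lerDl addr_ge0// mulr_ge0.
have split_ : `|U y - U y'| <= K * Lam * tau + `|m y - m y'|.
  have := ler_distD (m y) (U y) (U y'); have := ler_distD (m y') (m y) (U y').
  by rewrite [`|m y' - U y'|]distrC; lra.
apply: (@le_trans _ _ ((K * Lam * tau)%:E + `|m y - m y'|%:E)%E).
  by rewrite -EFinD lee_fin.
rewrite leeD2l//; apply: le_trans chain _.
have -> : itg (EFin \o (fun t => Km * W (h t))%R) 0 tau =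
    (Km%:E * itg (EFin \o (fun t => W (h t))) 0 tau)%E.
  rewrite (eq_itg (G := fun t => (0 + Km * W (h t))%:E)); last first.
    by move=> t _ /=; rewrite add0r.
  by rewrite itg_affine// mul0r add0e.
rewrite muleA -EFinM lee_wpmul2r// lee_fin /K lerDr addr_ge0//.
Qed.

End oscillation_along_curves.

(** * Extension from the good set *)

Section extension.
Context {R : realType} {X : completeMetricType R}.
Variables (Om : set X) (M : metricType R) (f : M -> X).
Hypotheses (oOm : open Om) (bOm : boundary Om !=set0).
Hypothesis fbij : set_bij [set: M] Om f.
Hypothesis fdist : forall a b, internal_dist Om (f a) (f b) = (mdist a b)%:E.
Hypothesis lcM : locally_compact [set: M].

(** Continuity in the internal metric, which may be finer than the metric of [X], does not give
    Borel measurability at once. Intersected with a compact core, a closed superlevel set is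
    compact, so its image in [X] is closed, and countably many cores exhaust [Om]. *)
Lemma internal_continuous_measurable (x0 : M) (v : X -> R) :
  continuous (fun a => v (f a)) ->
  measurable_fun (Om : set (borel X)) (v : borel X -> R).
Proof.
move=> cv mOm; apply: (measurability _ (RGenCInfty.measurableE R)) => // _ [_ [c ->] <-].
rewrite (_ : _ `&` _ = \bigcup_n (f @` (core Om f x0 n%:R n.+1%:R^-1 `&`
    [set a | c <= v (f a)]))).
  apply: bigcupT_measurable => n; apply: closed_borel.
  apply: compact_closed; first exact: metric_hausdorff.
  apply: continuous_compact.
    by apply: continuous_subspaceT; exact: internal_embed_continuous.
  apply: compact_closedI; first by apply: core_compact => //; rewrite invr_gt0.
  exact: (preimage_closed (fun a _ => cv a) (@closed_ge R c)).
apply/seteqP; split => x /=; rewrite in_itv /= andbT.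
  move=> [Ox cx]; have [a fa] := internal_onto fbij Ox.
  have [n hn] := core_cover oOm bOm fbij fdist x0 a.
  by exists n => //; exists a => //; split => //=; rewrite fa.
by move=> [n _ [a [_ ca] <-]]; split => //; exact: (internal_embed fbij).
Qed.

Variables (F0 : set X) (u rho : X -> R) (Lam Bd : R).
Hypothesis F0u : forall y, F0 y -> `|u y| <= Lam.
Hypotheses (Lam0 : 0 <= Lam) (rho0 : forall x, 0 <= rho x) (rhoB : forall x, rho x <= Bd).
Hypothesis mrho : measurable_fun [set: borel X] (rho : borel X -> R).

Definition path_cost (h : R -> X) (t : R) : R := fine (itg (fun s => (rho (h s))%:E) 0 t).

Hypothesis F0_cost : forall (h : R -> X) t, 0 <= t -> lip1 h -> (forall s, Om (h s)) ->
  F0 (h 0) -> F0 (h t) -> `|u (h 0) - u (h t)| <= path_cost h t.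

Let mh (h : R -> X) : lip1 h -> measurable_fun setT (fun s => (rho (h s))%:E).
Proof.
by move=> hl; apply/measurable_EFinP; exact: (measurableT_comp mrho (lip1_measurable hl)).
Qed.

Let rhoE0 (h : R -> X) t : (0 <= (rho (h t))%:E)%E. Proof. by rewrite lee_fin. Qed.

Lemma path_cost_fin (h : R -> X) s t : lip1 h -> s <= t ->
  (itg (fun s => (rho (h s))%:E) s t <= (Bd * (t - s))%:E)%E.
Proof.
move=> hl st; rewrite EFinM -itg_cst//; apply: le_itg => //; first exact: mh.
by move=> x _; rewrite lee_fin.
Qed.

Lemma path_costE (h : R -> X) t : lip1 h -> 0 <= t ->
  itg (fun s => (rho (h s))%:E) 0 t = (path_cost h t)%:E.
Proof.
move=> hl t0; rewrite fineK// ge0_fin_numE ?itg_ge0//.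
by apply: le_lt_trans (path_cost_fin hl t0) _; rewrite ltry.
Qed.

Lemma path_cost_ge0 (h : R -> X) t : 0 <= path_cost h t.
Proof. by rewrite fine_ge0// itg_ge0. Qed.

(** A McShane extension for the path metric weighted by [rho]; the extra element [Lam] is the
    truncation from above and covers points that no admissible path reaches. *)
Definition extension_set (x : X) : set R := [set Lam] `|`
  [set a | exists h t, [/\ 0 <= t, lip1 h, forall s, Om (h s), F0 (h 0) &
     h t = x /\ a = u (h 0) + path_cost h t]].

Definition extension (x : X) : R := inf (extension_set x).

Let ext_lb x : lbound (extension_set x) (- Lam).
Proof.
move=> _ [->|[h [t [t0 hl hO hF [hx ->]]]]]; first by have := Lam0; lra.
have := F0u hF; rewrite ler_norml => /andP[+ _].
by have := path_cost_ge0 h t; lra.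
Qed.

Lemma extension_bounded x : `|extension x| <= Lam.
Proof.
rewrite ler_norml; apply/andP; split.
  by apply: lb_le_inf; [exists Lam; left|exact: ext_lb].
by apply: ge_inf; [exists (- Lam); exact: ext_lb|left].
Qed.

Let ext_le x a : extension_set x a -> extension x <= a.
Proof. by move=> h; apply: ge_inf => //; exists (- Lam); exact: ext_lb. Qed.

Lemma extension_eq x : Om x -> F0 x -> extension x = u x.
Proof.
move=> Ox Fx; apply/le_anti/andP; split.
  apply: ext_le; right; exists (fun=> x), 0; split => //; first exact: lip1_const.
  by split => //; rewrite /path_cost itgxx addr0.
apply: lb_le_inf; first by exists Lam; left.
move=> _ [->|[h [t [t0 hl hO hF [hx ->]]]]].
  by have := F0u Fx; rewrite ler_norml => /andP[].
have := F0_cost t0 hl hO hF; rewrite hx => /(_ Fx).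
by rewrite ler_norml => /andP[+ _]; lra.
Qed.

Let ext_le_path (k : R -> X) s : lip1 k -> (forall t, Om (k t)) -> 0 <= s ->
  extension (k s) <= extension (k 0) + path_cost k s.
Proof.
move=> kl kO s0; rewrite -lerBlDr; apply: lb_le_inf; first by exists Lam; left.
have c0 := path_cost_ge0 k s.
move=> _ [->|[h [t [t0 hl hO hF [hx ->]]]]].
  by have := extension_bounded (k s); rewrite ler_norml => /andP[_]; lra.
rewrite lerBlDr; pose H := glue t h (fun r => k (- t + r)).
have Hl : lip1 H by apply: lip1_glue => //; [exact: lip1_shift|rewrite addNr].
have H0 : H 0 = h 0 by rewrite /H /glue t0.
apply: ext_le; right; exists H, (t + s); split => //.
- by rewrite addr_ge0.
- by move=> r; rewrite /H /glue; case: ifP.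
- by rewrite H0.
split.
  rewrite /H /glue; case: ifPn => [h1|_]; last by rewrite addKr.
  have -> : s = 0 by lra.
  by rewrite addr0.
rewrite H0 -addrA; congr (_ + _).
apply: EFin_inj; rewrite EFinD -!path_costE ?addr_ge0//.
rewrite [RHS](@itg_cat _ _ 0 t)//; [|exact: mh|by rewrite lerDl].
congr (_ + _)%E.
  by apply: eq_itg => r /andP[_ rt]; rewrite /H /glue rt.
rewrite -[X in _ = itg _ X _]addr0 -(itg_shift t 0 s (mh Hl))//.
apply: eq_itg => r /andP[r0 _]; rewrite /H /glue; case: ifPn => [h1|_].
  have -> : r = 0 by lra.
  by rewrite addr0 hx.
by rewrite addKr.
Qed.

(** The opposite inequality is [ext_le_path] for the reversed path, which has the same cost. *)
Lemma extension_path (k : R -> X) s : lip1 k -> (forall t, Om (k t)) -> 0 <= s ->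
  `|extension (k 0) - extension (k s)| <= path_cost k s.
Proof.
move=> kl kO s0; have h1 := ext_le_path kl kO s0.
have := ext_le_path (lip1_flip s kl) (fun t => kO _) s0; rewrite subrr subr0.
have -> : path_cost (fun t => k (s - t)) s = path_cost k s.
  by rewrite /path_cost (itg_flip s 0 s (mh kl))// subrr subr0.
by rewrite ler_norml; lra.
Qed.

Lemma extension_upper_gradient (c : curve X) : rectifiable c -> trace c `<=` Om ->
  upper_gradient_along extension (EFin \o rho) c.
Proof.
move=> rc cO; have L0 := fine_clength_ge0 c.
rewrite /upper_gradient_along line_integralE// -[leRHS]/(itg _ _ _).
rewrite (path_costE (unit_param_lip rc))// lee_fin -(unit_param0 rc) -(unit_paramL rc).
by apply: extension_path => //; [exact: unit_param_lip|move=> t; apply: cO; exact: unit_param_trace].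
Qed.

Lemma extension_lip a b : `|extension (f a) - extension (f b)| <= Bd * mdist a b.
Proof.
have B0 : 0 <= Bd := le_trans (rho0 (f a)) (rhoB _).
apply/ler_addgt0Pr => e e0.
have e1 : 0 < e / (Bd + 1) by rewrite divr_gt0// ltr_wpDl.
have : (internal_dist Om (f a) (f b) < (mdist a b + e / (Bd + 1))%:E)%E.
  by rewrite fdist lte_fin ltrDl.
move=> /ereal_inf_lt[_ [c [cO [c0 c1]] <-] cl].
have rc : rectifiable c by apply: lt_trans cl _; rewrite ltry.
have L0 := fine_clength_ge0 c.
have := extension_upper_gradient rc cO; rewrite /upper_gradient_along c0 c1.
rewrite line_integralE// -[leRHS]/(itg _ _ _) => /le_trans/(_ (path_cost_fin (unit_param_lip rc) L0)).
rewrite lee_fin subr0 => /le_trans; apply.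
move: cl; rewrite -(clength_fineK rc) lte_fin => cl.
apply: (@le_trans _ _ (Bd * (mdist a b + e / (Bd + 1)))); first by rewrite ler_wpM2l// ltW.
rewrite mulrDr lerD2l mulrCA ger_pMr// ler_pdivrMr; lra.
Qed.

Lemma extension_measurable (x0 : M) :
  measurable_fun (Om : set (borel X)) (extension : borel X -> R).
Proof.
apply: (internal_continuous_measurable x0) => a.
have B0 : 0 <= Bd := le_trans (rho0 (f a)) (rhoB _).
apply/cvgrPdist_lt => e e0.
have d0 : 0 < e / (Bd + 1) by rewrite divr_gt0// ltr_wpDl.
near=> b.
apply: le_lt_trans (extension_lip a b) _.
have : mdist a b < e / (Bd + 1).
  by near: b; apply: filterS (nbhsx_ballx a _ d0) => b; rewrite ballEmdist.
rewrite ltr_pdivlMr; last by lra.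
have := mdist_ge0 a b; nra.
Unshelve. all: by end_near. Qed.

End extension.

(** * Gradients of functions vanishing on a large set *)

Section vanishing.
Context {R : realType}.
Implicit Types (w : R -> R) (G : R -> \bar R) (B : set R) (L s t z : R).
Local Notation leb := (@lebesgue_measure R).

Lemma itg_small G L (e : R) : measurable_fun setT G -> (forall t, (0 <= G t)%E) ->
  (itg G 0 L < +oo)%E -> 0 < e -> exists2 d : R, 0 < d &
  forall s t, 0 <= s -> s <= t -> t <= L -> t - s <= d -> (itg G s t <= e%:E)%E.
Proof.
move=> mG G0 Gfin e0.
pose G1 := (G \_ `[0, L] : R -> \bar R).
have mG1 : measurable_fun setT G1.
  by apply/(measurable_restrictT _ _).1 => //; exact: measurable_funTS.
have G10 t : (0 <= G1 t)%E by rewrite /G1 patchE; case: ifP.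
have G1fin : (\int[leb]_t G1 t < +oo)%E by rewrite -integral_mkcond.
have [d d0 hd] := @integral_abs_continuous _ (measurableTypeR R) R leb G1 mG1 G10 G1fin e e0.
exists d => // s t s0 st tL std.
have -> : itg G s t = itg G1 s t.
  apply: eq_itg => r /andP[sr rt]; rewrite /G1 patchE mem_set//=.
  by rewrite in_itv /= (le_trans s0 sr) (le_trans rt tL).
apply: hd; first exact: measurable_itv.
have : lebesgue_measure `[s, t] = (t - s)%:E.
  rewrite lebesgue_measure_itv /= lte_fin.
  by case: ltP => // ts; congr (_%:E); lra.
by move=> e1; apply: le_trans (_ : (t - s)%:E <= _)%E; rewrite ?lee_fin// -e1.
Qed.

(** Before the infimum [t1] of the zeros every parameter lies in [B], so restricting [G] to [B]
    matters at most at the single point [t1]. The infimum need not itself be assumed a zero: zeros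
    accumulate at it or attain it, and the integral of [G] over short intervals is small. *)
Lemma first_zero w G B L z : measurable_fun setT G -> (forall t, (0 <= G t)%E) ->
  (itg G 0 L < +oo)%E -> measurable B -> 0 <= z -> z <= L -> w z = 0 ->
  (forall s t, 0 <= s -> s <= t -> t <= L -> (`|w s - w t|%:E <= itg G s t)%E) ->
  (forall t, 0 <= t -> t <= L -> ~ B t -> w t = 0) ->
  exists2 t1, 0 <= t1 <= z & (`|w 0|%:E <= itg (G \_ B) 0 t1)%E.
Proof.
move=> mG G0 Gfin mB z0 zL wz wG wB.
pose Z := [set t | [/\ 0 <= t, t <= L & w t = 0]].
have Zz : Z z by [].
have Zlb : lbound Z 0 by move=> t [].
have Zinf : has_inf Z by split; [exists z|exists 0].
pose t1 := inf Z.
have t10 : 0 <= t1 by apply: lb_le_inf => //; exists z.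
have t1z : t1 <= z by apply: ge_inf => //; exists 0.
exists t1; first by rewrite t10.
have -> : itg (G \_ B) 0 t1 = itg G 0 t1.
  rewrite /itg; apply: (@integral_eq_off_null _ (measurableTypeR R) R leb [set t1]) => //.
    exact: lebesgue_measure_set1.
  move=> t; rewrite /= in_itv /= => /andP[t0 tt1] tne; rewrite patchE.
  case: ifPn => // /negP tB; exfalso; apply: tne; apply/eqP; rewrite eq_le tt1/=.
  have tL : t <= L by rewrite (le_trans tt1)// (le_trans t1z).
  apply: ge_inf; [by exists 0|split => //; apply: wB => // Bt].
  by apply: tB; exact: mem_set.
apply/lee_addgt0Pr => e e0.
have [d d0 hd] := itg_small mG G0 Gfin e0.
have [s [s0 sL ws] ss] := inf_adherent d0 Zinf.
have t1s : t1 <= s by apply: ge_inf => //; exists 0.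
have := wG 0 s (lexx 0) s0 sL; rewrite ws subr0 => /le_trans; apply.
rewrite (@itg_cat _ _ 0 t1 s)// leeD2l//; apply: hd => //.
by move: ss; rewrite -/t1; lra.
Qed.

(** Up to the first zero and after the last one the path stays in [B]; the part between them is
    dropped. Without any zero the whole interval lies in [B]. *)
Lemma vanishing_gradient w G B L : measurable_fun setT G -> (forall t, (0 <= G t)%E) ->
  (itg G 0 L < +oo)%E -> measurable B -> 0 <= L ->
  (forall s t, 0 <= s -> s <= t -> t <= L -> (`|w s - w t|%:E <= itg G s t)%E) ->
  (forall t, 0 <= t -> t <= L -> ~ B t -> w t = 0) ->
  (`|w 0 - w L|%:E <= itg (G \_ B) 0 L)%E.
Proof.
move=> mG G0 Gfin mB L0 wG wB.
have mGB : measurable_fun setT (G \_ B).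
  by apply/(measurable_restrictT _ _).1 => //; exact: measurable_funTS.
have GB0 t : (0 <= (G \_ B) t)%E by rewrite patchE; case: ifP.
have [[z [z0 zL wz]]|nz] := pselect (exists z, [/\ 0 <= z, z <= L & w z = 0]); last first.
  apply: le_trans (wG 0 L (lexx 0) L0 (lexx L)) _.
  rewrite (@eq_itg _ G (G \_ B))// => t /andP[t0 tL]; rewrite patchE.
  case: ifPn => // /negP tB; exfalso; apply: nz; exists t; split => //.
  by apply: wB => // Bt; apply: tB; exact: mem_set.
have [t1 /andP[t10 t1z] h1] := first_zero mG G0 Gfin mB z0 zL wz wG wB.
have fl : measurable_fun setT (fun t : R => L - t).
  by apply: measurable_funB.
(* The last zero is the first zero of the reversed path. *)
have [t2 /andP[t20 t2z] h2] : exists2 t2, 0 <= t2 <= L - z &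
    (`|w (L - 0)|%:E <= itg ((fun t => G (L - t)%R) \_ ((fun t => L - t)%R @^-1` B)) 0 t2)%E.
  apply: (@first_zero (fun t => w (L - t)) _ _ L) => //.
  - by have := measurableT_comp mG fl.
  - by rewrite itg_flip// subrr subr0.
  - by rewrite -[X in measurable X]setTI; exact: fl.
  - by lra.
  - by lra.
  - by rewrite subKr.
  - move=> s t s0 st tL; rewrite itg_flip// distrC; apply: wG; lra.
  - by move=> t t0 tL; apply: wB; lra.
rewrite subr0 in h2.
have e2 : itg ((fun t => G (L - t)%R) \_ ((fun t => L - t)%R @^-1` B)) 0 t2 =
    itg (G \_ B) (L - t2) L.
  by rewrite -[X in _ = itg _ _ X]subr0 -(itg_flip L 0 t2 mGB GB0); apply: eq_itg.
rewrite e2 in h2.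
have hL : L - t2 <= L by lra.
have h12 : t1 <= L - t2 by lra.
rewrite (itg_cat mGB GB0 t10 (le_trans h12 hL)) (itg_cat mGB GB0 h12 hL).
apply: (@le_trans _ _ (`|w 0|%:E + `|w L|%:E)%E); first by rewrite -EFinD lee_fin ler_normB.
by apply: leeD => //; apply: le_trans h2 _; rewrite leeDr// itg_ge0.
Qed.

End vanishing.

Section upper_gradient_calculus.
Context {R : realType} {X : completeMetricType R}.
Variables (Om : set X).

Lemma upper_gradient_alongB (u v : X -> R) (g g' : X -> \bar R) (c : curve X) :
  rectifiable c -> measurable_fun [set: borel X] g -> measurable_fun [set: borel X] g' ->
  (forall x, (0 <= g x)%E) -> (forall x, (0 <= g' x)%E) ->
  upper_gradient_along u g c -> upper_gradient_along v g' c ->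
  upper_gradient_along (fun x => u x - v x) (fun x => g x + g' x)%E c.
Proof.
move=> rc mg mg' g0 g'0; rewrite /upper_gradient_along !line_integralE// => hu hv.
rewrite ge0_integralD//=; last 2 first.
- apply: measurable_funTS; exact: (measurableT_comp mg (lip1_measurable (unit_param_lip rc))).
- apply: measurable_funTS; exact: (measurableT_comp mg' (lip1_measurable (unit_param_lip rc))).
apply: le_trans (leeD hu hv); rewrite -EFinD lee_fin.
set a := u _; set b := u _; set c1 := v _; set c2 := v _.
have -> : a - c1 - (b - c2) = (a - b) - (c1 - c2) by ring.
exact: ler_normB.
Qed.

Lemma upper_gradient_restrict (w : X -> R) (g : X -> \bar R) (B : set X) :
  measurable_fun [set: borel X] g -> (forall x, (0 <= g x)%E) ->
  measurable (B : set (borel X)) ->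
  (forall c, rectifiable c -> trace c `<=` Om -> upper_gradient_along w g c) ->
  (forall x, Om x -> ~ B x -> w x = 0) ->
  forall c, rectifiable c -> trace c `<=` Om -> (line_integral c g < +oo)%E ->
    upper_gradient_along w (g \_ B) c.
Proof.
move=> mg g0 mB wg wB c rc cO; rewrite /upper_gradient_along !line_integralE// => gfin.
have ml := lip1_measurable (unit_param_lip rc).
have L0 := fine_clength_ge0 c.
have mgu : measurable_fun setT (fun t => g (unit_param c t)).
  exact: (measurableT_comp mg ml).
rewrite -(unit_param0 rc) -(unit_paramL rc).
have := @vanishing_gradient _ (fun t => w (unit_param c t))
  (fun t => g (unit_param c t)) (unit_param c @^-1` B) _ mgu (fun t => g0 _) gfin _ L0.
apply.
- by rewrite -[X in measurable X]setTI; exact: ml.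
- move=> s t s0 st tL; have := wg (lip_curve (unit_param_lip rc) st).
  rewrite /upper_gradient_along line_integral_lip_curve//; last first.
    by move=> r /andP[sr rt]; apply: unit_param_speed => //; exact: le_trans tL.
  apply; first exact: lip_curve_rectifiable.
  by move=> z /lip_curve_trace[r _ ->]; apply: cO; exact: unit_param_trace.
- by move=> t t0 tL; apply: wB; apply: cO; exact: unit_param_trace.
Qed.

Variable mu : {measure set (borel X) -> \bar R}.
Local Open Scope ereal_scope.

Lemma Mod_ge0 (p : \bar R) Gamma : 0 <= Mod mu p Gamma.
Proof.
case: p => [r| |] /=; apply: le_ereal_inf_tmp => _ [rho _ <-];
  by rewrite ?poweR_ge0// Lnorm_ge0.
Qed.

Lemma Mod_set0 (p : \bar R) : p != 0 -> Mod mu p set0 = 0.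
Proof.
move=> p0; apply/eqP; rewrite eq_le Mod_ge0 andbT.
have h : admissible (set0 : set (curve X)) (cst 0).
  by split => //; split => // x _.
have N0 : Lnorm_on mu [set: X] p (cst 0) = 0.
  rewrite /Lnorm_on (_ : (_ \_ _) = cst 0) ?Lnorm0//.
  by apply/funext => x; rewrite patchE; case: ifP.
case: p p0 N0 => [r| |] p0 N0 /=; apply: ereal_inf_lbound; exists (cst 0) => //.
by rewrite N0 poweR0r// -eqe.
Qed.

(** Every positive multiple of [g] is admissible for this family, and the p-th power of its norm is
    as small as desired. *)
Lemma Mod_infinite_integral (p : R) (g : X -> \bar R) : (0 < p)%R ->
  measurable_fun [set: borel X] g -> (forall x, 0 <= g x) ->
  \int[mu]_(x in [set: borel X]) (g x `^ p) < +oo ->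
  Mod mu p%:E [set c | line_integral c g = +oo] = 0.
Proof.
move=> p0 mg g0 gp; apply/eqP; rewrite eq_le Mod_ge0 andbT /=.
pose A := fine (\int[mu]_(x in [set: borel X]) (g x `^ p)).
have I0 : 0 <= \int[mu]_(x in [set: borel X]) (g x `^ p).
  by apply: integral_ge0 => x _; exact: poweR_ge0.
have AE : \int[mu]_(x in [set: borel X]) (g x `^ p) = A%:E.
  by rewrite fineK// ge0_fin_numE.
have A0 : (0 <= A)%R by exact: fine_ge0.
have pn0 : p != 0%R by rewrite gt_eqF.
apply/lee_addgt0Pr => e e0; rewrite add0e.
have eA : (0 < e / (A + 1))%R by rewrite divr_gt0// ltr_wpDl.
pose c := ((e / (A + 1)) `^ p^-1)%R.
have c0 : (0 < c)%R by exact: powR_gt0.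
apply: ge_ereal_inf; exists (Lnorm_on mu [set: X] p%:E (fun x => c%:E * g x) `^ p).
  exists (fun x => c%:E * g x) => //; split.
    by split; [exact: emeasurable_funM|move=> x _; rewrite mule_ge0// lee_fin ltW].
  move=> k ki rk; rewrite line_integralE// ge0_integralZl//=.
  - by rewrite -line_integralE// ki gt0_muley// leey.
  - apply: measurable_funTS; exact: (measurableT_comp mg (lip1_measurable (unit_param_lip rk))).
  - by rewrite lee_fin ltW.
rewrite Lnorm_onE// poweRVK//; last by apply: integral_ge0 => x _; exact: poweR_ge0.
have -> : \int[mu]_(x in [set: borel X]) (`|c%:E * g x| `^ p) =
    \int[mu]_(x in [set: borel X]) ((e / (A + 1))%:E * (g x `^ p)).
  apply: eq_integral => x _; rewrite gee0_abs; last by rewrite mule_ge0// lee_fin ltW.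
  rewrite poweRM//; last by rewrite lee_fin ltW.
  by rewrite poweR_EFin /c -powRrM mulVf// powRr1// ltW.
rewrite ge0_integralZl//; last 3 first.
- exact: measurable_fun_poweR.
- by move=> x _; exact: poweR_ge0.
- by rewrite lee_fin ltW.
rewrite AE -EFinM lee_fin mulrAC ler_pdivrMr; last by rewrite ltr_wpDl.
by rewrite ler_pM2l// lerDl.
Qed.

End upper_gradient_calculus.

(** * Comparison of the exponent +oo with finite exponents *)

Section sup_norm.
Context {R : realType} {X : completeMetricType R}.
Variable mu : {measure set (borel X) -> \bar R}.
Hypothesis muX : (0 < mu [set: borel X])%E.
Local Open Scope ereal_scope.

Lemma Lnorm_on_ooP (D : set X) (f : X -> \bar R) (B : R) : (0 <= B)%R ->
  Lnorm_on mu D +oo f <= B%:E <->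
  exists2 N : set X, measurable (N : set (borel X)) /\ mu (N : set (borel X)) = 0 &
    forall x, D x -> ~ N x -> `|f x| <= B%:E.
Proof.
move=> B0; rewrite /Lnorm_on unlock muX; split.
  move=> /ess_sup_inf.ess_supP[N [mN N0 h]]; exists N => // x Dx nN.
  apply: contrapT => hx; apply: nN; apply: h => /=.
  by rewrite patchE mem_set.
move=> [N [mN N0] h]; apply/ess_sup_inf.ess_supP; exists N; split => // x /= hx.
apply: contrapT => nN; apply: hx; rewrite patchE.
by case: ifPn => [/set_mem Dx|_]; [exact: h|rewrite -[point]/(0 : \bar R) abse0 lee_fin].
Qed.

Lemma Lnorm_on_oo_lty (D : set X) (f : X -> \bar R) : Lnorm_on mu D +oo f < +oo ->
  exists2 B : R, (0 <= B)%R & Lnorm_on mu D +oo f <= B%:E.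
Proof.
move=> h; exists (fine (Lnorm_on mu D +oo f)); first by rewrite fine_ge0// Lnorm_ge0.
by rewrite fineK// ge0_fin_numE// Lnorm_ge0.
Qed.

Lemma integral_bounded_le (N D : set X) (f : X -> \bar R) (B p : R) :
  measurable (N : set (borel X)) -> mu (N : set (borel X)) = 0 ->
  measurable (D : set (borel X)) -> (0 <= p)%R -> (0 <= B)%R ->
  (forall x, D x -> ~ N x -> `|f x| <= B%:E) ->
  \int[mu]_(x in (D : set (borel X))) (`|f x| `^ p) <= (B `^ p)%:E * mu (D : set (borel X)).
Proof.
move=> mN N0 mD p0 B0 h; rewrite -integral_cst// [leLHS]integral_mkcond [leRHS]integral_mkcond.
apply: (ge0_integral_le_off_null mN N0).
- by move=> x; rewrite patchE; case: ifP => // _; exact: poweR_ge0.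
- by move=> x; rewrite patchE; case: ifP => // _; rewrite lee_fin powR_ge0.
- move=> x nN; rewrite !patchE; case: ifPn => // /set_mem Dx.
  by rewrite /= -poweR_EFin; apply: le_poweR => //; exact: h.
Qed.

Variables (Om : set X).
Hypotheses (oOm : open Om) (muOm : mu (Om : set (borel X)) < +oo).

Let mOm : measurable (Om : set (borel X)). Proof. exact: open_borel. Qed.

Lemma Lnorm_on_oo_p (p : R) (f : X -> \bar R) : (0 < p)%R ->
  Lnorm_on mu Om +oo f < +oo -> Lnorm_on mu Om p%:E f < +oo.
Proof.
move=> p0 /Lnorm_on_oo_lty[B B0 /(Lnorm_on_ooP _ _ B0)[N [mN N0] h]].
rewrite Lnorm_on_lty//; apply: le_lt_trans (integral_bounded_le mN N0 mOm (ltW p0) B0 h) _.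
by rewrite lte_mul_pinfty// lee_fin powR_ge0.
Qed.

(** For curves inside [Om] an admissible function may be cut off outside [Om]; the measure there is
    finite, so a small essential bound gives a small p-norm. *)
Lemma Mod_oo_p (p : R) (Gamma : set (curve X)) : (0 < p)%R -> Mod mu +oo Gamma = 0 ->
  Mod mu p%:E (Gamma `&` [set c | trace c `<=` Om]) = 0.
Proof.
move=> p0 M0; apply/eqP; rewrite eq_le Mod_ge0 andbT /=.
have pn0 : p != 0%R by rewrite gt_eqF.
pose A := fine (mu (Om : set (borel X))).
have AE : mu (Om : set (borel X)) = A%:E by rewrite fineK// ge0_fin_numE.
have A0 : (0 <= A)%R by exact: fine_ge0.
apply/lee_addgt0Pr => e e0; rewrite add0e.
have eA : (0 < e / (A + 1))%R by rewrite divr_gt0// ltr_wpDl.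
pose d := ((e / (A + 1)) `^ p^-1)%R.
have d0 : (0 < d)%R by exact: powR_gt0.
have : Mod mu +oo Gamma < d%:E by rewrite M0 lte_fin.
move=> /ereal_inf_lt[_ [rho [[mrho rho0] adm] <-]] /ltW/(Lnorm_on_ooP _ _ (ltW d0)).
move=> [N [mN N0] hN].
apply: ge_ereal_inf; exists (Lnorm_on mu [set: X] p%:E (rho \_ Om) `^ p).
  exists (rho \_ Om) => //; split.
    split; first by apply: measurable_patch => //; exact: measurable_funTS.
    by move=> x _; rewrite patchE; case: ifP => // _; exact: rho0.
  move=> c [Gc cO] rc; have := adm c Gc rc; rewrite !line_integralE//.
  congr (_ <= _); apply: eq_integral => t _; rewrite patchE mem_set//.
  by apply: cO; exact: unit_param_trace.
rewrite Lnorm_onE// poweRVK//; last by apply: integral_ge0 => x _; exact: poweR_ge0.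
have -> : \int[mu]_(x in [set: borel X]) (`|(rho \_ Om) x| `^ p) =
    \int[mu]_(x in (Om : set (borel X))) (`|rho x| `^ p).
  rewrite [RHS]integral_mkcond; apply: eq_integral => x _.
  by rewrite !patchE; case: ifP => // _; rewrite -[point]/(0 : \bar R) abse0 poweR0r.
apply: le_trans (integral_bounded_le mN N0 mOm (ltW p0) (ltW d0) _) _.
  by move=> x _; exact: hN.
rewrite AE -EFinM lee_fin /d -powRrM mulVf// powRr1; last exact: ltW.
rewrite mulrAC ler_pdivrMr; last by rewrite ltr_wpDl.
by rewrite ler_pM2l// lerDl.
Qed.

Lemma N1_oo_p (p : R) : (0 < p)%R -> N1 mu Om +oo `<=` N1 mu Om p%:E.
Proof.
move=> p0 u [[mu_u Lu] [g [[mg g0] [Gamma M0 hG]] Lg]]; split.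
  by split => //; exact: Lnorm_on_oo_p.
exists g; last exact: Lnorm_on_oo_p.
split => //; exists (Gamma `&` [set c | trace c `<=` Om]); first exact: Mod_oo_p.
by move=> c rc cO nG; apply: hG => // Gc; apply: nG.
Qed.

Lemma N1_oo_bounded (v : X -> R) (rho : X -> R) (B B' : R) :
  measurable_fun (Om : set (borel X)) (v : borel X -> R) ->
  (forall x, Om x -> `|v x| <= B)%R ->
  measurable_fun [set: borel X] (rho : borel X -> R) ->
  (forall x, 0 <= rho x <= B')%R ->
  (forall c, rectifiable c -> trace c `<=` Om -> upper_gradient_along v (EFin \o rho) c) ->
  (0 <= B)%R -> (0 <= B')%R -> N1 mu Om +oo v.
Proof.
move=> mv vB mrho rhoB ug B0 B'0; split.
  split.
    exists (v \_ Om); first by apply/(measurable_restrictT _ _).1.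
    by apply: nearW => x Ox; rewrite patchE mem_set.
  apply: (@le_lt_trans _ _ B%:E); last by rewrite ltry.
  apply/(Lnorm_on_ooP _ _ B0); exists set0; first by rewrite measure0.
  by move=> x Ox _; rewrite lee_fin; exact: vB.
exists (EFin \o rho).
  split.
    split; first by apply: measurable_funTS; exact/measurable_EFinP.
    by move=> x _; rewrite lee_fin; have /andP[] := rhoB x.
  by exists set0; [exact: Mod_set0|move=> c rc cO _; exact: ug].
apply: (@le_lt_trans _ _ B'%:E); last by rewrite ltry.
apply/(Lnorm_on_ooP _ _ B'0); exists set0; first by rewrite measure0.
by move=> x Ox _; have /andP[h1 h2] := rhoB x; rewrite lee_fin ger0_norm.
Qed.

End sup_norm.

(** * Density *)

Section bad_set.
Context {R : realType} {X : completeMetricType R}.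
Hypothesis sepX : separable X.
Variable mu : {measure set (borel X) -> \bar R}.
Hypotheses (hmu : locally_finite mu) (hd : doubling mu).
Variables (Om : set X) (M : metricType R) (f : M -> X) (x0 : M).
Hypotheses (oOm : open Om) (bOm : boundary Om !=set0).
Hypothesis fbij : set_bij [set: M] Om f.
Hypothesis fdist : forall a b, internal_dist Om (f a) (f b) = (mdist a b)%:E.
Hypothesis lcM : locally_compact [set: M].
Hypothesis muOm : (mu (Om : set (borel X)) < +oo)%E.
Local Notation core n := (f @` core Om f x0 n%:R n.+1%:R^-1).

Lemma core_borel n : measurable (core n : set (borel X)).
Proof.
apply: closed_borel; apply: compact_closed; first exact: metric_hausdorff.
apply: continuous_compact.
  by apply: continuous_subspaceT; exact: (internal_embed_continuous fdist).
by apply: core_compact => //; rewrite invr_gt0.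
Qed.

Lemma core_exhaustion (e : R) : 0 < e ->
  exists n, (mu ((Om `\` core n) : set (borel X)) <= e%:E)%E.
Proof.
move=> e0; pose F n : set (borel X) := Om `\` core n.
have mOm : measurable (Om : set (borel X)) by exact: open_borel.
have mF n : measurable (F n) by apply: measurableD => //; exact: core_borel.
have F0 : \bigcap_n F n = set0.
  apply/seteqP; split => // x hx; have [Ox _] := hx 0%N I.
  have [a fa] := internal_onto fbij Ox.
  have [n hn] := core_cover oOm bOm fbij fdist x0 a.
  by have [_ []] := hx n I; exists a.
have := @nonincreasing_cvg_mu _ _ _ mu F; rewrite F0 measure0 => cvg.
have {}cvg : mu \o F @ \oo --> 0%E.
  apply: cvg => //.
  - apply: le_lt_trans muOm; apply: le_measure; rewrite ?inE//.
    by move=> x [].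
  - move=> i j ij; apply/subsetPset => x [Ox nx]; split => // -[a ha fa]; apply: nx.
    exists a => //; move: ha; apply: core_mono => //; first by rewrite ler_nat.
    by rewrite lef_pV2 ?posrE// ler_nat.
have nb : nbhs (0 : \bar R) [set y | (y < e%:E)%E].
  by apply: open_nbhs_nbhs; split; [exact: open_ereal_lt_ereal|rewrite /= lte_fin].
have [n hn] := @filter_ex _ \oo _ [set n | (mu (F n) < e%:E)%E] (cvg _ nb).
by exists n; exact: ltW.
Qed.

Variables (p S KL : R) (g : X -> \bar R) (u U : X -> R) (N0 : set X).
Hypothesis p0 : 0 < p.
Hypotheses (mg : measurable_fun [set: borel X] g) (g0 : forall x, (0 <= g x)%E).
Hypothesis gp : (\int[mu]_(x in [set: borel X]) (g x `^ p) < +oo)%E.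
Hypothesis mU : measurable_fun [set: borel X] (U : borel X -> R).
Hypothesis Up : (\int[mu]_(x in [set: borel X]) (`|U x| `^ p)%:E < +oo)%E.
Hypotheses (mN0 : measurable (N0 : set (borel X))) (N00 : mu (N0 : set (borel X)) = 0%E).
Hypothesis uU : forall x, Om x -> ~ N0 x -> u x = U x.
Variable Dm : R.
Hypothesis hDm : forall x, Om x -> bdist Om x <= Dm.
Hypothesis lebU : forall Lam, 0 < Lam ->
  exists2 N : set X, measurable (N : set (borel X)) /\ mu (N : set (borel X)) = 0%E &
  forall y, Om y -> good mu p g Om Lam y -> ~ N y -> lebesgue_point mu S U Om KL Lam y.

Definition tame (Lam : R) n (y : X) :=
  [/\ core n y, good mu p g Om Lam y, lebesgue_point mu S U Om KL Lam y,
      `|U y| <= Lam & u y = U y].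

(** The exceptional set has three essential parts: points with large maximal function, points with
    large [|U|], and points off the core. The factor [Lam^p] is absorbed by tail integrals in the
    first two and by choosing the core after [Lam] in the third. *)
Lemma tame_complement_small (dl : R) : 0 < dl -> exists (Lam : R) n (G : set X),
  [/\ 1 <= Lam, measurable (G : set (borel X)),
      forall x, Om x -> ~ G x -> tame Lam n x &
      ((Lam `^ p)%:E * mu (G : set (borel X)) <= dl%:E)%E].
Proof.
move=> dl0; have [Kw Kw0 weak] := weak_type sepX hmu hd mg gp.
have mgp : measurable_fun [set: borel X] (fun x => g x `^ p)%E.
  exact: measurable_fun_poweR.
have mUp : measurable_fun [set: borel X] (fun x => (`|U x| `^ p)%:E).
  apply: (@measurable_fun_poweR _ _ _ _ (fun x : borel X => `|U x|%:E)).
  by apply/measurable_EFinP; exact: measurableT_comp.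
have Up0 (x : borel X) : (0 <= (`|U x| `^ p)%:E)%E by rewrite lee_fin powR_ge0.
(* The three parts contribute [Kw * e], [e] and [e]. *)
pose e := dl / (Kw + 2).
have e0 : 0 < e by rewrite divr_gt0//; lra.
have [n1 hn1] := tail_integral_small mgp (fun x => poweR_ge0 _ _) gp e0.
have [n2 hn2] := tail_integral_small mUp Up0 Up e0.
(* This gives [L0 / 2 >= n1] and [L0 >= n2], so both tail estimates apply; [L0] becomes [Lam^p]. *)
pose L0 : R := 1 + 2 * n1%:R + n2%:R.
have L01 : 1 <= L0 by rewrite /L0 -addrA lerDl addr_ge0// mulr_ge0.
pose Lam := L0 `^ p^-1.
have LamE : Lam `^ p = L0 by rewrite -powRrM mulVf ?gt_eqF// powRr1//; lra.
have Lam1 : 1 <= Lam.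
  have <- : 1 `^ p^-1 = 1 :> R by rewrite powR1.
  by apply: ge0_ler_powR; rewrite ?invr_ge0 ?nnegrE ?(ltW p0)//; lra.
have L0p : 0 < L0 by lra.
have [N [mN Nn] hN] := lebU (lt_le_trans ltr01 Lam1).
have [n hn] := core_exhaustion (divr_gt0 e0 L0p).
pose B := [set y | Om y /\ ~ good mu p g Om Lam y].
have /choice[rad hrad] : forall y, exists s, B y ->
    [/\ 0 < s, s <= bdist Om y & L0 * vol mu y s < gmass mu p g y s].
  move=> y; have [[Oy ng]|nB] := pselect (B y); last by exists 0.
  apply: contrapT => h; apply: ng => s s0 sb; rewrite leNgt; apply/negP => hs.
  by apply: h; exists s => _; split => //; rewrite -LamE.
have [G1 [mG1 BG1 hG1]] := weak B rad Dm L0 L0p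
  (fun x Bx => let: And3 h1 h2 _ := hrad x Bx in
     introT andP (conj h1 (le_trans h2 (hDm Bx.1))))
  (fun x Bx => let: And3 _ _ h := hrad x Bx in h).
pose G2 : set X := [set x | (L0%:E < (`|U x| `^ p)%:E)%E].
have mG2 : measurable (G2 : set (borel X)) by exact: superlevel_measurable.
pose G3 : set X := Om `\` core n.
have mG3 : measurable (G3 : set (borel X)).
  by apply: measurableD; [exact: open_borel|exact: core_borel].
exists Lam, n, (G1 `|` G2 `|` G3 `|` (N `|` N0)); split => //.
- by do !apply: measurableU.
- move=> x Ox nG; have gx : good mu p g Om Lam x.
    by apply: contrapT => ng; apply: nG; left; left; left; apply: BG1.
  split => //.
  + by apply: contrapT => nc; apply: nG; left; right.
  + by apply: hN => // Nx; apply: nG; right; left.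
  + rewrite leNgt; apply/negP => h; apply: nG; left; left; right.
    rewrite /G2 /= lte_fin -LamE; apply: gt0_ltr_powR => //; rewrite nnegrE//.
    exact: powR_ge0.
  + by apply: uU => // Nx; apply: nG; right; right.
rewrite LamE.
have h1 : (L0%:E * mu (G1 : set (borel X)) <= (Kw * e)%:E)%E.
  apply: le_trans hG1 _; rewrite [leRHS]EFinM lee_wpmul2l ?lee_fin//.
  apply: le_trans (ltW hn1); apply: ge0_subset_integral => //.
  - exact: superlevel_measurable.
  - exact: superlevel_measurable.
  - exact: measurable_funTS.
  - by move=> x _; exact: poweR_ge0.
  - move=> x /=; apply: le_lt_trans; rewrite lee_fin /L0.
    by have := ler0n R n1; have := ler0n R n2; lra.
have h2 : (L0%:E * mu (G2 : set (borel X)) <= e%:E)%E.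
  rewrite -integral_cst//.
  apply: (@le_trans _ _ (\int[mu]_(x in (G2 : set (borel X))) (`|U x| `^ p)%:E)%E).
    apply: ge0_le_integral => //; first by move=> x _; rewrite lee_fin ltW.
    - exact: measurable_funTS.
    - by move=> x /ltW.
  apply: le_trans (ltW hn2); apply: ge0_subset_integral => //.
  - exact: superlevel_measurable.
  - exact: measurable_funTS.
  - move=> x /=; apply: le_lt_trans; rewrite lee_fin /L0.
    by have := ler0n R n1; have := ler0n R n2; lra.
have h3 : (L0%:E * mu (G3 : set (borel X)) <= e%:E)%E.
  apply: (@le_trans _ _ (L0%:E * (e / L0)%:E)%E).
    by rewrite lee_wpmul2l ?lee_fin ?(ltW L0p).
  by rewrite -EFinM mulrC divfK// gt_eqF.
have N4 : mu ((N `|` N0) : set (borel X)) = 0%E.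
  exact: etrans (measureU0 mN mN0 N00) Nn.
have L0e : (0 <= L0%:E)%E by rewrite lee_fin ltW.
apply: (@le_trans _ _ (L0%:E * (mu (G1 : set (borel X)) + mu (G2 : set (borel X)) +
   mu (G3 : set (borel X)) + mu ((N `|` N0) : set (borel X)))))%E.
  rewrite lee_wpmul2l//.
  apply: le_trans (measureU2 _ _ _) _; [by do !apply: measurableU|exact: measurableU|].
  rewrite leeD2r//.
  apply: le_trans (measureU2 _ _ _) _ => //; first exact: measurableU.
  rewrite leeD2r//; exact: measureU2.
rewrite N4 adde0 !ge0_muleDr ?adde_ge0//.
have -> : dl = Kw * e + e + e by rewrite /e; field; rewrite gt_eqF//; lra.
by rewrite !EFinD; apply: leeD => //; apply: leeD.
Qed.

End bad_set.

Section approximation_tools.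
Context {R : realType} {X : completeMetricType R}.
Variable mu : {measure set (borel X) -> \bar R}.
Variables (Om : set X) (p : R).
Hypotheses (oOm : open Om) (p1 : 1 < p).
Local Open Scope ereal_scope.

Let p0 : (0 < p)%R. Proof. by have := p1; lra. Qed.
Let pn0 : p != 0%R. Proof. by rewrite gt_eqF. Qed.
Let mOm : measurable (Om : set (borel X)). Proof. exact: open_borel. Qed.

(** Integrability comes from [|U| <= 1 + |U|^p] on [Om], which has finite measure, and from [U]
    vanishing elsewhere. *)
Lemma borel_representative (u : X -> R) : mu (Om : set (borel X)) < +oo ->
  Lp mu Om p%:E u -> exists (U : X -> R) (N : set X),
  [/\ measurable_fun [set: borel X] (U : borel X -> R),
      mu.-integrable [set: borel X] (EFin \o (U : borel X -> R)),
      \int[mu]_(x in [set: borel X]) (`|U x| `^ p)%:E < +oo,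
      measurable (N : set (borel X)) /\ mu (N : set (borel X)) = 0 &
      (forall x, Om x -> ~ N x -> u x = U x) /\ (forall x, ~ Om x -> U x = 0%R)].
Proof.
move=> muOm [[v mv [N [mN N0 hN]]] Lu].
pose U := (v \_ Om : X -> R); exists U, N.
have uU x : Om x -> ~ N x -> u x = U x.
  move=> Ox nN; rewrite /U patchE mem_set//; apply: contrapT => h; apply: nN.
  by apply: hN => /= /(_ Ox).
have U0 x : ~ Om x -> U x = 0%R by move=> nO; rewrite /U patchE memNset.
have mU : measurable_fun [set: borel X] (U : borel X -> R).
  by apply/(measurable_restrictT _ _).1 => //; exact: measurable_funTS.
have mUn : measurable_fun [set: borel X] (fun x : borel X => `|U x|%:E).
  by apply/measurable_EFinP; exact: measurableT_comp.
have mUp : measurable_fun [set: borel X] (fun x : borel X => (`|U x| `^ p)%:E).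
  exact: (@measurable_fun_poweR _ _ _ _ (fun x : borel X => `|U x|%:E)).
have Up : \int[mu]_(x in [set: borel X]) (`|U x| `^ p)%:E < +oo.
  have Lu' : \int[mu]_(x in (Om : set (borel X))) (`|(u x)%:E| `^ p) < +oo.
    by rewrite -(@Lnorm_on_lty _ _ mu Om p (EFin \o u)).
  rewrite integral_mkcond in Lu'; apply: le_lt_trans Lu'.
  rewrite le_eqVlt; apply/orP; left; apply/eqP.
  apply: (integral_eq_off_null mN N0) => x _ nN; rewrite patchE.
  case: ifPn => [/set_mem Ox|/negP nO]; first by rewrite -(uU x Ox nN).
  rewrite U0; last by move=> Ox; apply: nO; exact: mem_set.
  by rewrite normr0 powR0.
split => //; apply/integrableP; split; first exact/measurable_EFinP.
have Up0 (x : borel X) : 0 <= (`|U x| `^ p)%:E by rewrite lee_fin powR_ge0.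
apply: (@le_lt_trans _ _ (\int[mu]_(x in [set: borel X])
    ((\1_Om x : R)%:E + (`|U x| `^ p)%:E))).
  apply: ge0_le_integral => //.
  - by apply: emeasurable_funD => //; apply/measurable_EFinP; exact: measurable_indic.
  move=> x _; rewrite /= -EFinD lee_fin indicE.
  have [Ox|nO] := boolP (x \in Om); last first.
    by rewrite U0 ?normr0 ?addr_ge0 ?powR_ge0// => Ox; move/negP: nO; apply; exact: mem_set.
  have [h|h] := leP (`|U x|)%R 1%R; first by rewrite ler_wpDr ?powR_ge0.
  rewrite ler_wpDl// -[leLHS]powRr1//; apply: ler_powR; exact: ltW.
rewrite ge0_integralD//=; last by apply/measurable_EFinP; exact: measurable_indic.
by rewrite lte_add_pinfty// integral_indic// setIT.
Qed.

Lemma N1norm_le (w : X -> R) (gw : X -> \bar R) (a : R) : (0 <= a)%R ->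
  weak_upper_gradient mu Om p%:E w gw ->
  \int[mu]_(x in (Om : set (borel X))) (`|(w x)%:E| `^ p) <= a%:E ->
  \int[mu]_(x in (Om : set (borel X))) (`|gw x| `^ p) <= a%:E ->
  N1norm mu Om p%:E w <= (2 * a `^ p^-1)%:E.
Proof.
move=> a0 hg h1 h2; have -> : (2 * a `^ p^-1 = a `^ p^-1 + a `^ p^-1)%R by ring.
have le_root I : 0 <= I -> I <= a%:E -> I `^ p^-1 <= (a `^ p^-1)%:E.
  by move=> I0 Ia; rewrite -poweR_EFin; apply: le_poweR => //; rewrite invr_ge0 ltW.
have I0 (h : X -> \bar R) : 0 <= \int[mu]_(x in (Om : set (borel X))) (`|h x| `^ p).
  by apply: integral_ge0 => x _; exact: poweR_ge0.
rewrite EFinD; apply: leeD; first by rewrite Lnorm_onE//; apply: le_root => //; exact: (I0 (EFin \o w)).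
apply: (@le_trans _ _ (Lnorm_on mu Om p%:E gw)); first by apply: ereal_inf_lbound; exists gw.
by rewrite Lnorm_onE//; exact: le_root.
Qed.

(** The restriction argument uses absolute continuity of the integral along the curve, so it needs a
    finite integral; the curves in [Om] with infinite integral form the exceptional family. *)
Lemma vanishing_weak_upper_gradient (w : X -> R) (g : X -> \bar R) (G : set X) :
  measurable_fun [set: borel X] g -> (forall x, 0 <= g x) ->
  \int[mu]_(x in [set: borel X]) ((g \_ Om) x `^ p) < +oo ->
  measurable (G : set (borel X)) ->
  (forall c, rectifiable c -> trace c `<=` Om -> upper_gradient_along w g c) ->
  (forall x, Om x -> ~ G x -> w x = 0%R) ->
  weak_upper_gradient mu Om p%:E w (g \_ G).
Proof.
move=> mg g0 gp mG ug wG; split.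
  split; last by move=> x _; rewrite patchE; case: ifP.
  by apply: measurable_funTS; apply: measurable_patch => //; exact: measurable_funTS.
have lO c : rectifiable c -> trace c `<=` Om -> line_integral c (g \_ Om) = line_integral c g.
  move=> rc cO; rewrite !line_integralE//; apply: eq_integral => t _.
  by rewrite patchE mem_set//; apply: cO; exact: unit_param_trace.
exists [set c | line_integral c (g \_ Om) = +oo].
  apply: Mod_infinite_integral => //; last by move=> x; rewrite patchE; case: ifP.
  by apply: measurable_patch => //; exact: measurable_funTS.
move=> c rc cO nc; apply: (@upper_gradient_restrict _ _ Om) => //.
by rewrite -lO// ltey; exact/eqP.
Qed.

End approximation_tools.

Lemma gradient_power_bound (R : realType) (p K Lam W : R) (g F : \bar R) :
  0 <= p -> 0 <= K -> 0 <= Lam -> 0 <= W -> (0 <= g)%E -> (0 <= F)%E ->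
  ((W `^ p)%:E <= F)%E ->
  ((g + (K * (Lam + W))%:E) `^ p <=
   (2 `^ p * (1 + K `^ p * 2 `^ p))%:E * (g `^ p + F + (Lam `^ p)%:E))%E.
Proof.
move=> p0 K0 L0 W0 g0 F0 WF.
have KW0 : 0 <= K * (Lam + W) by rewrite mulr_ge0// addr_ge0.
apply: le_trans (poweRD_le p0 g0 _) _; first by rewrite lee_fin.
rewrite [X in (_ <= X * _)%E]EFinM -muleA lee_wpmul2l ?lee_fin ?powR_ge0//.
set B := K `^ p * 2 `^ p; have B0 : 0 <= B by rewrite mulr_ge0// powR_ge0.
have h : ((K * (Lam + W))%:E `^ p <= B%:E * (F + (Lam `^ p)%:E))%E.
  rewrite EFinM poweRM ?lee_fin ?addr_ge0// EFinM -muleA poweR_EFin.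
  rewrite lee_wpmul2l ?lee_fin ?powR_ge0// EFinD.
  apply: le_trans (poweRD_le p0 _ _) _; rewrite ?lee_fin//.
  by rewrite lee_wpmul2l ?lee_fin ?powR_ge0// addeC; apply: leeD.
have gp0 : (0 <= g `^ p)%E by exact: poweR_ge0.
have FL0 : (0 <= F + (Lam `^ p)%:E)%E by rewrite adde_ge0// lee_fin powR_ge0.
apply: le_trans (leeD (lexx _) h) _; rewrite -addeA [leRHS]ge0_muleDr//.
apply: leeD.
  by rewrite -[leLHS]mul1e lee_wpmul2r// lee_fin lerDl.
by rewrite lee_wpmul2r// lee_fin lerDr.
Qed.

Lemma difference_power_bound (R : realType) (p Lam a b : R) : 0 <= p -> `|b| <= Lam ->
  (`|(a - b)%:E| `^ p <= (2 `^ p)%:E * ((`|a| `^ p)%:E + (Lam `^ p)%:E))%E.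
Proof.
move=> p0 bL; have L0 : 0 <= Lam by exact: le_trans bL.
have := @poweRD_le _ `|a|%:E Lam%:E p p0; rewrite !lee_fin => /(_ (normr_ge0 _) L0).
apply: le_trans; apply: ge0_ler_powR; rewrite ?nnegrE ?addr_ge0//.
by apply: le_trans (ler_normB _ _) _; rewrite lerD2l.
Qed.

(** Order of choices: the majorant [F] and hence [H] come first, then [dl] by absolute continuity of
    the integral of [H], and only then [Lam], the core and [G]. The functions [W] and [rho] depend
    on the latter, but [W^p <= F] does not. *)
Lemma bounded_approximation (R : realType) (p : R) (hp : 1 < p)
    (X : completeMetricType R) (hsep : separable X)
    (mu : {measure set (borel X) -> \bar R}) (hmu : locally_finite mu)
    (hPI : PI_space mu 1 p) (C : R) (hC : 1 <= C) (Om : set X) (hOm : GHS_domain C Om)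
    (u : X -> R) (e : R) : Om !=set0 -> N1 mu Om p%:E u -> 0 < e ->
  exists2 v : X -> R, N1 mu Om +oo%E v &
    (N1norm mu Om p%:E (fun x => (u x - v x)%R) < e%:E)%E.
Proof.
move=> [x1 Ox1] [Lu [g1 wg1 Lg1]] e0.
have p0 : 0 < p by lra.
have p0' := ltW p0.
have [hd [cP [sigma [cP0 sigma0 hP]]]] := hPI.
have [oOm _ propOm [k hk] sepOm ghOm [M [f [fbij fdist lcM _]]]] := hOm.
have bOm := boundary_nonempty hmu hd hp hP oOm (ex_intro _ x1 Ox1) propOm.
have muOm := mu_bounded_lty hmu hd oOm hk.
have mOm : measurable (Om : set (borel X)) by exact: open_borel.
have [b0 bb0] := bOm.
have hDm x : Om x -> bdist Om x <= k + mdist x1 b0.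
  move=> Ox; apply: le_trans (bdist_le_mdist bOm x bb0) _.
  by apply: le_trans (metric_triangle x x1 b0) _; rewrite lerD2r hk.
have [x0 fx0] := internal_onto fbij Ox1.
have geo x y : Om x -> Om y -> exists G, qh_geodesic Om x y G.
  exact: (qh_geodesic_exists oOm bOm fbij fdist lcM hDm).
have [g [mg g0 gp ug]] := weak_upper_gradient_upper p0 oOm wg1 Lg1.
have [U [N0 [mU iU Up [mN0 N00] [uU U0]]]] := borel_representative oOm hp muOm Lu.
pose S := dilation sigma.
have S1 : 1 <= S := dilation_ge1 sigma.
have sigmaS : 5 * sigma <= S := dilation_ge sigma.
have PI x r : Om x -> 0 < r -> 2 * S * S * r < bdist Om x ->
    osc mu U x r <= 2 * cP * r * (gavg mu p g x (5 * sigma * r)) `^ p^-1.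
  exact: (domain_poincare hmu hd hp cP0 sigma0 hP oOm bOm mU iU mN0 N00 uU U0 mg g0 gp ug).
have ball_in x r : Om x -> 0 < r -> S * r < bdist Om x -> ball x r `<=` Om.
  exact: (ball_in_domain hmu hd hp hP oOm bOm).
have [KL KL0 leb] := good_lebesgue hsep hmu hd p0 cP0 sigma0 S1 sigmaS mU iU oOm bOm
  muOm ball_in PI.
have [K [K0 diff]] := difference_along_curve hmu hd p0 cP0 sigma0 S1 sigmaS mg gp mU iU
  oOm bOm PI fbij fdist geo hC sepOm ghOm hk KL0.
have /andP[q0 q8] := whitney_ratio_le sigma0 S1 sigmaS.
have [F [mF F0 Fint Fdom]] := whitney_dominant hsep hmu hd q0 q8 hC mg gp oOm bOm hDm.
pose H x := ((`|U x| `^ p)%:E + (g x `^ p + F x))%E.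
have mgp : measurable_fun [set: borel X] (fun x => g x `^ p)%E.
  exact: measurable_fun_poweR.
have mUp : measurable_fun [set: borel X] (fun x : borel X => (`|U x| `^ p)%:E).
  apply: (@measurable_fun_poweR _ _ _ _ (fun x : borel X => `|U x|%:E)).
  by apply/measurable_EFinP; exact: measurableT_comp.
have mH : measurable_fun [set: borel X] (H : borel X -> \bar R).
  by do !apply: emeasurable_funD => //.
have gp0 x : (0 <= g x `^ p)%E by exact: poweR_ge0.
have Up0 x : (0 <= (`|U x| `^ p)%:E)%E by rewrite lee_fin powR_ge0.
have H0 x : (0 <= H x)%E by rewrite !adde_ge0.
have Hint : (\int[mu]_(x in [set: borel X]) H x < +oo)%E.
  rewrite ge0_integralD//=; last 2 first.
  - by move=> x _; rewrite adde_ge0.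
  - exact: emeasurable_funD.
  by rewrite lte_add_pinfty// ge0_integralD// lte_add_pinfty.
(* With both p-th power integrals at most [a], the Sobolev norm is at most [2 * (e / 4)]. *)
pose a := (e / 4) `^ p.
have a0 : 0 < a by apply: powR_gt0; clear -e0; lra.
pose Cst := 2 `^ p * (1 + K `^ p * 2 `^ p) : R.
have Cst0 : 0 < Cst.
  by rewrite mulr_gt0 ?powR_gt0// ltr_wpDr// mulr_ge0 ?powR_ge0.
(* The integral of [H] over [G] and [Lam^p mu(G)] each get [e2], and [Cst * (e2 + e2) = a]. *)
pose e2 := a / Cst / 2.
have e20 : 0 < e2 by rewrite !divr_gt0.
have [dl dl0 hdl] := integral_abs_continuous mH H0 Hint e20.
have lebU (Lam : R) : 0 < Lam ->
    exists2 N : set X, measurable (N : set (borel X)) /\ mu (N : set (borel X)) = 0%E &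
    forall y, Om y -> good mu p g Om Lam y -> ~ N y -> lebesgue_point mu S U Om KL Lam y.
  exact: leb.
have m0 : 0 < Num.min dl e2 by rewrite lt_min dl0.
have [Lam [n [G [Lam1 mG hG muG]]]] := tame_complement_small hsep hmu hd x0 oOm bOm fbij
  fdist lcM muOm p0 mg gp mU Up mN0 N00 uU hDm lebU m0.
have Lam0 : 0 <= Lam := le_trans ler01 Lam1.
have Lp1 : 1 <= Lam `^ p.
  have <- : 1 `^ p = 1 :> R by rewrite powR1.
  by apply: ge0_ler_powR; rewrite ?nnegrE.
have muGdl : (mu (G : set (borel X)) <= dl%:E)%E.
  apply: le_trans (le_trans muG _); last by rewrite lee_fin ge_min lexx.
  by rewrite -[leLHS]mul1e lee_wpmul2r.
have muGe2 : ((Lam `^ p)%:E * mu (G : set (borel X)) <= e2%:E)%E.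
  by apply: le_trans muG _; rewrite lee_fin ge_min lexx orbT.
pose eta : R := n.+1%:R^-1.
have eta0 : 0 < eta by rewrite invr_gt0.
have eC0 : 0 < eta / (1 + C) by rewrite divr_gt0//; clear -hC; lra.
pose W := whitney_max mu p (10 * sigma * whitney_ratio S) C g Om (eta / (1 + C)).
have W0 x : 0 <= W x by apply: (whitney_max_ge0 hmu hd C p0 q0 mg gp oOm bOm Ox1 hk eC0).
have [BW BW0 WB] := whitney_max_bounded hmu hd C p0 q0 mg gp oOm bOm Ox1 hk eC0.
have mW : measurable_fun [set: borel X] (W : borel X -> R).
  exact: (whitney_max_measurable hmu hd C p0 q0 mg gp oOm bOm Ox1 hk eC0).
have WF x : ((W x `^ p)%:E <= F x)%E.
  apply: (whitney_max_dominated hmu hd p0 q0 mg gp oOm bOm Ox1 hk eC0) => // y Oy.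
  exact: Fdom.
pose rho x := K * (Lam + W x).
have rho0 x : 0 <= rho x by rewrite mulr_ge0// addr_ge0.
have rhoB x : rho x <= K * (Lam + BW) by rewrite ler_wpM2l// lerD2l; exact: WB.
have mrho : measurable_fun [set: borel X] (rho : borel X -> R).
  by apply: measurable_funM => //; exact: measurable_funD.
pose T := tame mu Om f x0 p S KL g u U Lam n.
have TL y : T y -> `|u y| <= Lam by move=> [_ _ _ + ->].
have Tcost (h : R -> X) t : 0 <= t -> lip1 h -> (forall s, Om (h s)) ->
    T (h 0) -> T (h t) -> `|u (h 0) - u (h t)| <= path_cost rho h t.
  move=> t0 hl hO [c0 gd0 l0 _ ->] [ct _ lt _ ->].
  rewrite -lee_fin -(path_costE rho0 rhoB mrho hl t0).
  exact: (diff Lam eta x0 n%:R).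
pose v := extension Om T u rho Lam.
have vB x : `|v x| <= Lam by exact: extension_bounded.
have vu x : Om x -> T x -> v x = u x by exact: extension_eq.
have ugv c : rectifiable c -> trace c `<=` Om -> upper_gradient_along v (EFin \o rho) c.
  exact: extension_upper_gradient.
have muX : (0 < mu [set: borel X])%E.
  by rewrite lt0e measure_ge0 andbT; apply/eqP; exact: hd.1.
exists v.
  apply: (N1_oo_bounded muX oOm (B := Lam) (B' := K * (Lam + BW)) _ _ mrho) => //.
  - exact: (extension_measurable oOm bOm fbij fdist lcM TL Lam0 rho0 rhoB mrho x0).
  - by move=> x; rewrite rho0 rhoB.
  - by rewrite mulr_ge0// addr_ge0.
pose w x := u x - v x.
have wG x : Om x -> ~ G x -> w x = 0.
  by move=> Ox nG; rewrite /w vu ?subrr//; exact: hG.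
pose gr x := (g x + (rho x)%:E)%E.
have mgr : measurable_fun [set: borel X] (gr : borel X -> \bar R).
  by apply: emeasurable_funD => //; exact/measurable_EFinP.
have gr0 x : (0 <= gr x)%E by rewrite adde_ge0// lee_fin.
have ugw c : rectifiable c -> trace c `<=` Om -> upper_gradient_along w gr c.
  move=> rc cO; apply: (upper_gradient_alongB rc mg (g' := EFin \o rho)) => //.
  - exact/measurable_EFinP.
  - exact: ug.
  - exact: ugv.
(* One function that dominates the p-th powers of both [w] and the gradient [gr], so that a single
   integral over [G] controls the whole norm. *)
pose Q x := (Cst%:E * (H x + (Lam `^ p)%:E))%E.
have mHL : measurable_fun [set: borel X] (fun x => H x + (Lam `^ p)%:E)%E.
  exact: emeasurable_funD.
have HL0 x : (0 <= H x + (Lam `^ p)%:E)%E by rewrite adde_ge0// lee_fin powR_ge0.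
have Q0 x : (0 <= Q x)%E by rewrite mule_ge0// lee_fin ltW.
have Qint (D : set X) : measurable (D : set (borel X)) ->
    (\int[mu]_(x in (D : set (borel X))) Q x = Cst%:E *
     (\int[mu]_(x in (D : set (borel X))) H x + (Lam `^ p)%:E * mu (D : set (borel X))))%E.
  move=> mD; rewrite ge0_integralZl//; last 2 first.
  - exact: measurable_funTS.
  - by rewrite lee_fin ltW.
  rewrite ge0_integralD//; last 2 first.
  - exact: measurable_funTS.
  - by move=> x _; rewrite lee_fin powR_ge0.
  by rewrite integral_cst.
have QG : (\int[mu]_(x in (G : set (borel X))) Q x <= a%:E)%E.
  rewrite Qint//; have -> : a = Cst * (e2 + e2) by rewrite /e2; field; rewrite gt_eqF.
  rewrite [leRHS]EFinM EFinD lee_wpmul2l ?lee_fin ?(ltW Cst0)//.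
  by apply: leeD => //; exact: hdl.
have grQ x : (gr x `^ p <= Q x)%E.
  apply: le_trans (gradient_power_bound p0' K0 Lam0 (W0 x) (g0 x) (F0 x) (WF x)) _.
  rewrite lee_wpmul2l ?lee_fin ?(ltW Cst0)// leeD2r// leeDr//.
have wQ x : Om x -> ~ N0 x -> (`|(w x)%:E| `^ p <= Q x)%E.
  move=> Ox nN; apply: le_trans (difference_power_bound (u x) p0' (vB x)) _.
  rewrite uU//; apply: lee_pmul => //.
  - by rewrite adde_ge0// lee_fin powR_ge0.
  - by rewrite lee_fin ler_peMr ?powR_ge0// lerDl mulr_ge0 ?powR_ge0.
  - by rewrite leeD2r// leeDl// adde_ge0.
have wgr : weak_upper_gradient mu Om p%:E w (gr \_ G).
  apply: vanishing_weak_upper_gradient => //.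
  apply: (@le_lt_trans _ _ (\int[mu]_(x in (Om : set (borel X))) Q x)%E); last first.
    rewrite Qint// lte_mul_pinfty ?lee_fin ?(ltW Cst0)// lte_add_pinfty//.
      apply: le_lt_trans Hint; apply: ge0_subset_integral => //.
    by rewrite lte_mul_pinfty// lee_fin powR_ge0.
  rewrite [leRHS]integral_mkcond.
  apply: (ge0_integral_le_off_null (@measurable0 _ (borel X)) (measure0 mu)).
  - by move=> x; exact: poweR_ge0.
  - by move=> x; rewrite patchE; case: ifP.
  - move=> x _; rewrite !patchE; case: ifP => // _.
    by rewrite -[point]/(0%E : \bar R) poweR0r// gt_eqF.
apply: (@le_lt_trans _ _ (2 * a `^ p^-1)%:E); last first.
  rewrite lte_fin /a -powRrM divff ?gt_eqF// powRr1; clear -e0; lra.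
apply: (N1norm_le hp (ltW a0) wgr).
- apply: le_trans QG; rewrite [leLHS]integral_mkcond [leRHS]integral_mkcond.
  apply: (ge0_integral_le_off_null mN0 N00).
  + by move=> x; rewrite patchE; case: ifP => // _; exact: poweR_ge0.
  + by move=> x; rewrite patchE; case: ifP.
  + move=> x nN; rewrite !patchE; case: ifPn => [/set_mem Ox|_]; last by case: ifP.
    case: ifPn => [_|/negP nG]; first exact: wQ.
    rewrite wG//; last by move=> Gx; apply: nG; exact: mem_set.
    by rewrite -[point]/(0%E : \bar R) abse0 poweR0r// gt_eqF.
- apply: le_trans QG; rewrite [leLHS]integral_mkcond [leRHS]integral_mkcond.
  apply: (ge0_integral_le_off_null (@measurable0 _ (borel X)) (measure0 mu)).
  + by move=> x; rewrite patchE; case: ifP => // _; exact: poweR_ge0.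
  + by move=> x; rewrite patchE; case: ifP.
  + move=> x _; rewrite !patchE; case: ifPn => _; last by case: ifP.
    case: ifPn => _; first by rewrite gee0_abs.
    by rewrite -[point]/(0%E : \bar R) abse0 poweR0r// gt_eqF.
Qed.

Lemma N1norm_set0 (R : realType) (X : completeMetricType R)
    (mu : {measure set (borel X) -> \bar R}) (p : R) (w : X -> R) : 0 < p ->
  (N1norm mu set0 p%:E w <= 0)%E.
Proof.
move=> p0; have L0 (h : X -> \bar R) : Lnorm_on mu set0 p%:E h = 0%E.
  by rewrite Lnorm_onE ?gt_eqF// integral_set0 poweR0r// invr_neq0// gt_eqF.
rewrite /N1norm L0 add0e; apply: ereal_inf_lbound; exists (cst 0%E); last exact: L0.
split; first by split.
exists set0; first by apply: Mod_set0; rewrite eqe gt_eqF.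
move=> c _ /(_ (c (cstart c))) h _; exfalso; apply: h.
by exists (cstart c) => //=; rewrite in_itv /= lexx cstart_le_end.
Qed.

Theorem theorem1p1 (R : realType) (p : R) (hp : 1 < p)
    (X : completeMetricType R) (hsep : separable X)
    (mu : {measure set (borel X) -> \bar R}) (hmu : locally_finite mu)
    (hPI : PI_space mu 1 p)
    (C : R) (hC : 1 <= C) (Omega : set X) (hOmega : GHS_domain C Omega) :
  N1 mu Omega +oo%E `<=` N1 mu Omega p%:E /\
  (forall u : X -> R, N1 mu Omega p%:E u ->
   forall e : R, 0 < e ->
   exists2 v : X -> R, N1 mu Omega +oo%E v &
     (N1norm mu Omega p%:E (fun x => (u x - v x)%R) < e%:E)%E).
Proof.
have p0 : 0 < p by lra.
have [hd _] := hPI.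
have oO := GHS_open hOmega.
have muX : (0 < mu [set: borel X])%E.
  by rewrite lt0e measure_ge0 andbT; apply/eqP; exact: hd.1.
split.
  have [k hk] := GHS_bounded hOmega.
  exact: (N1_oo_p muX oO (mu_bounded_lty hmu hd oO hk)).
move=> u hu e e0.
have [/set0P Omn|] := boolP (Omega != set0).
  exact: (bounded_approximation hp hsep hmu hPI hC hOmega).
rewrite negbK => /eqP O0; exists (cst 0).
  apply: (N1_oo_bounded muX oO (B := 0) (B' := 0) (rho := cst 0)) => //.
  - by move=> x _ /=; rewrite normr0.
  - by move=> x /=; rewrite lexx.
  - move=> c rc _; rewrite /upper_gradient_along subrr normr0.
    by apply: line_integral_ge0.
by rewrite O0; apply: le_lt_trans (N1norm_set0 mu _ p0) _; rewrite lte_fin.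
Qed.
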